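(* Assume that the system $\dot X(t)=\sum_{k=1}^m u_k(t)S_kX(t)$ on $\mathrm{U}(n)$ is controllable and that its initial condition is $X(0)=I$. Let $T>0$, let $X_{goal}\in\mathcal W$, choose any gains $f_1,\dots,f_m>0$ and fix any $a_{max}>0$. Then there exists $\overline M>0$ big enough such that, for every integer $M\ge\overline M$, the stochastic control laws defined in the context ensure that $\lim_{j\to\infty}X(jT)=X_{goal}$ almost surely.
   Context: Fix $n\ge 1$. $\mathrm{U}(n)$ is the group of $n\times n$ unitary matrices and $\mathfrak u(n)$ its (real) Lie algebra of skew-Hermitian matrices; $X^\dagger$ is the conjugate transpose. Consider the driftless right-invariant system $\dot X(t)=\sum_{k=1}^m u_k(t)S_kX(t)$, with state $X\in\mathrm U(n)$, controls $u_k\in\mathbb R$ and fixed $S_1,\dots,S_m\in\mathfrak u(n)$. Controllable means that the Lie algebra generated by $S_1,\dots,S_m$ equals $\mathfrak u(n)$. Set $\mathcal W=\{W\in\mathrm U(n):\det(I+W)\ne 0\}$. Stochastic control laws: let $\omega=2\pi/T$, let $M>0$ be an integer and let $\mathbf A=[-\tfrac{a_{max}}2,\tfrac{a_{max}}2]^{mM}$. Let $\mathbf a_j=(a^j_{k,\ell})_{1\le k\le m,\,1\le\ell\le M}$, $j\in\mathbb N=\{0,1,2,\dots\}$, be independent identically distributed random vectors uniformly distributed on $\mathbf A$. The reference controls are $\overline u_k(t)=\sum_{\ell=1}^M a^j_{k,\ell}\sin(\ell\omega t)$ for $t\in[jT,(j+1)T)$, $j\in\mathbb N$, and the reference trajectory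 $\overline X(t)$ is the solution of $\dot{\overline X}(t)=\sum_{k=1}^m\overline u_k(t)S_k\overline X(t)$, $\overline X(0)=X_{goal}$ (it satisfies $\overline X(jT)=X_{goal}$ for all $j$). The control laws are $$u_k(X,t)=\overline u_k(t)+f_k\,\mathrm{Tr}\left(X(\overline X^\dagger(t)X-I)(\overline X^\dagger(t)X+I)^{-3}\overline X^\dagger(t)S_k\right),\quad k=1,\dots,m.$$ The trace is real when $X\in\mathrm U(n)$ and $\overline X^\dagger(t)X\in\mathcal W$, and the closed-loop solution with $X(0)=I$ satisfies $\overline X^\dagger(t)X(t)\in\mathcal W$ for all $t\ge0$. *)

(* Defs.v *)
From HB Require Import structures.
From mathcomp Require Import all_boot all_order all_algebra.
From mathcomp Require Import all_classical all_reals all_analysis.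
From mathcomp Require Import complex spectral.

Set Implicit Arguments.
Unset Strict Implicit.
Unset Printing Implicit Defensive.

Import Order.TTheory GRing.Theory Num.Theory.
Import numFieldNormedType.Exports.

Local Open Scope classical_set_scope.
Local Open Scope sesquilinear_scope.
Local Open Scope complex_scope.
Local Open Scope ring_scope.

Section unitary_group.
Context {R : realType} {n : nat}.
Implicit Types A B W : 'M[R[i]]_n.

Definition skew_hermitian : set 'M[R[i]]_n := [set A | A^t* = - A].

(* Subspaces are over the reals: u(n) is not stable under complex scalars. *)
Definition real_lie_subalgebra (L : set 'M[R[i]]_n) : Prop :=
  [/\ L 0,
      forall A B, L A -> L B -> L (A + B),
      forall (r : R) A, L A -> L (r%:C *: A)
    & forall A B, L A -> L B -> L (A *m B - B *m A)].

Definition lie_generated (G : set 'M[R[i]]_n) : set 'M[R[i]]_n :=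
  smallest real_lie_subalgebra G.

Definition controllable m (S : 'I_m -> 'M[R[i]]_n) : Prop :=
  lie_generated (range S) = skew_hermitian.

Definition Wset : set 'M[R[i]]_n :=
  [set W | W \is unitarymx /\ \det (1%:M + W) != 0].

(* Classical solution on [0, +oo[ of X' = F t X, X 0 = X0, expressed on the
   real and imaginary parts of the entries; only continuity is required at 0
   (for a right-hand side that is continuous along X, the one-sided derivative
   at 0 then has the expected value). *)
Definition ode_solution (F : R -> 'M[R[i]]_n -> 'M[R[i]]_n)
    (X0 : 'M[R[i]]_n) (X : R -> 'M[R[i]]_n) : Prop :=
  X 0 = X0 /\
  forall i j,
    [/\ {within `[0, +oo[, continuous (fun t => complex.Re (X t i j))},
        {within `[0, +oo[, continuous (fun t => complex.Im (X t i j))}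
      & forall t : R, 0 < t ->
          is_derive t 1 (fun s => complex.Re (X s i j))
            (complex.Re (F t (X t) i j)) /\
          is_derive t 1 (fun s => complex.Im (X s i j))
            (complex.Im (F t (X t) i j))].

Definition driftless m (S : 'I_m -> 'M[R[i]]_n) (u : 'I_m -> R)
    (X : 'M[R[i]]_n) : 'M[R[i]]_n :=
  \sum_(k < m) (u k)%:C *: (S k *m X).

(* A vector of R^(m * M) is seen as a family indexed by (k, l) through
   mxvec_index; the frequencies are 1, ..., M, hence l.+1. On 0 <= t,
   Num.truncn (t / T) is the j such that j T <= t < (j + 1) T. *)
Definition ref_control m M (T : R) (a : nat -> (m * M).-tuple R)
    (k : 'I_m) (t : R) : R :=
  \sum_(l < M) tnth (a (Num.truncn (t / T))) (mxvec_index k l)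
               * sin (l.+1%:R * (2 * pi / T) * t).

Definition ref_trajectory m M (S : 'I_m -> 'M[R[i]]_n) (T : R)
    (Xgoal : 'M[R[i]]_n) (a : nat -> (m * M).-tuple R)
    (Xbar : R -> 'M[R[i]]_n) : Prop :=
  ode_solution (fun t => driftless S (fun k => ref_control T a k t)) Xgoal Xbar.

(* The trace is real when X is unitary and Xbar^t* *m X is in Wset, so that
   taking its real part only turns it into an element of R. *)
Definition feedback_control m M (S : 'I_m -> 'M[R[i]]_n) (T : R) (f : 'I_m -> R)
    (a : nat -> (m * M).-tuple R) (Xbar : R -> 'M[R[i]]_n)
    (k : 'I_m) (X : 'M[R[i]]_n) (t : R) : R :=
  let Z := (Xbar t)^t* *m X in
  ref_control T a k t +
  f k * complex.Re (\tr (X *m (Z - 1%:M) *m (invmx (Z + 1%:M)) ^+ 3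
                           *m (Xbar t)^t* *m S k)).

Definition closed_loop_trajectory m M (S : 'I_m -> 'M[R[i]]_n) (T : R)
    (f : 'I_m -> R) (a : nat -> (m * M).-tuple R)
    (Xbar X : R -> 'M[R[i]]_n) : Prop :=
  ode_solution
    (fun t Y => driftless S (fun k => feedback_control S T f a Xbar k Y t) Y)
    1%:M X.

End unitary_group.

Section uniform_law.
Context {R : realType}.

(* d-dimensional Lebesgue measure on Borel sets, by iterated integration. *)
Fixpoint lebesgue_tuple (d : nat) : set (d.-tuple R) -> \bar R :=
  match d with
  | 0 => fun E => \d_([tuple] : 0.-tuple R) E
  | d'.+1 => fun E => (\int[@lebesgue_measure R]_x
               lebesgue_tuple [set v : d'.-tuple R | E [tuple of x :: v]])%E
  end.

Definition cube (d : nat) (amax : R) : set (d.-tuple R) :=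
  [set v | forall i, - (amax / 2) <= tnth v i <= amax / 2].

Context {disp : measure_display} {Omega : measurableType disp}
        (P : probability Omega R).

Definition uniform_on_cube d (amax : R) (a : {RV P >-> d.-tuple R}) : Prop :=
  forall E : set (d.-tuple R), measurable E ->
    distribution P a E =
    ((fine (lebesgue_tuple (cube amax : set (d.-tuple R))))^-1%:E
       * lebesgue_tuple (E `&` cube amax))%E.

Definition mutually_independent d (a : nat -> {RV P >-> d.-tuple R}) : Prop :=
  forall (J : seq nat) (E : nat -> set (d.-tuple R)),
    uniq J -> (forall j, measurable (E j)) ->
    P (\bigcap_(j in [set` J]) (a j @^-1` E j)) =
    (\prod_(j <- J) P (a j @^-1` E j))%E.

End uniform_law.

(* Main.v *)
Require Import Defs.
From HB Require Import structures.
From mathcomp Require Import all_boot all_order all_algebra.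
From mathcomp Require Import all_classical all_reals all_analysis.
From mathcomp Require Import complex spectral.
From mathcomp Require Import ring lra.

Import Order.TTheory GRing.Theory Num.Theory.
Import numFieldNormedType.Exports.

Local Open Scope classical_set_scope.
Local Open Scope ring_scope.

(** The tracking error Z = Xbar^* X is unitary and satisfies Z' = H Z, where H is a
    real combination of the transported generators Xbar^* S_k Xbar. Everything is
    read in its Cayley coordinate K = (Z - 1) (Z + 1)^-1, a skew-Hermitian matrix
    that vanishes exactly when X = Xbar. There the feedback matrix becomes a quarter
    of K - K^3, which is the gradient of V = |K|^2 (Frobenius norm), and
    V' = - sum_k (f_k / 4) tau_k^2 with tau_k = <K - K^3, Xbar^* S_k Xbar>. So V does
    not increase, K stays bounded, and Z + 1 never becomes singular
    ([error_regular]). As the reference controls are odd about the middle of each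
    period, Xbar returns to Xgoal at the times jT ([reference_periodic]), and it
    remains to prove that V tends to 0 almost surely.

    Controllability enters through [separation]: a skew-Hermitian matrix G that is
    orthogonal to Y^* S_k Y along all reference motions Y with admissible
    coefficients is zero. Perturbing the control in direction l by a sine
    polynomial concentrated just before a given time t (large at t, of small
    integral up to t) shows that such a G is also orthogonal to all Y^* [B, S_l] Y
    when it is orthogonal to all Y^* B Y, hence to the whole generated Lie algebra.
    Linear algebra then extracts finitely many reference motions whose transported
    generators form a frame of u(n) ([frame_exists], [spanning_word]); Mbar is
    chosen so that their frequencies are available.

    Play these motions one after the other, one per period, as a word of reference
    coefficients. If V hardly decreases meanwhile, then K hardly moves, and every
    tau_k is small at some time near each sample time; so K - K^3 is almost
    orthogonal to a frame, hence small, and K is even smaller. Thus the word, even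
    read with small errors, brings V below a given level or makes it drop by a fixed
    amount, whatever the state at its start ([block_drop]). Since the coefficients
    are independent and uniform, the word is almost surely read infinitely often
    ([occurs_infinitely_often]), which forces V to 0. *)

Section LocalSettings.
Local Open Scope sesquilinear_scope.
Local Open Scope complex_scope.
Local Open Scope ring_scope.
Set Implicit Arguments.
Unset Strict Implicit.
Unset Printing Implicit Defensive.

Local Notation Re := complex.Re.
Local Notation Im := complex.Im.

(** * Differentiable real curves on a segment *)

Section Paths.
Context {R : realType}.
Implicit Types (a b t c : R) (f g df dg w dw : R -> R).

(** A function with its derivative on a segment: differentiability is only
    required in the interior, as for the solutions of the differential equations
    below, whose derivative at the initial time is not prescribed. *)
Definition rpath a b f df : Prop :=
  {within `[a, b], continuous f} /\
  forall t, a < t < b -> is_derive t 1 f (df t).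

Lemma rpath_eq a b f df dg : rpath a b f df ->
  (forall t, a < t < b -> df t = dg t) -> rpath a b f dg.
Proof. by move=> [cf hf] e; split=> // t ht; rewrite -e //; exact: hf. Qed.

Lemma rpath_congr a b f g df : {in `[a, b], f =1 g} ->
  rpath a b f df -> rpath a b g df.
Proof.
move=> fg [cf hf]; split.
  apply: (@subspace_eq_continuous _ _ _ (f : subspace _ -> R)) cf => x.
  by rewrite inE => hx; exact: fg.
move=> t ht; have h := hf t ht.
apply: (near_eq_is_derive _ h).
near=> x; rewrite -fg // in_itv /=; apply/andP; split; apply/ltW; near: x.
  by apply: lt_nbhsr; case/andP: ht.
by apply: lt_nbhsl; case/andP: ht.
Unshelve. all: by end_near. Qed.

Lemma rpath_sub a b a' b' f df :
  rpath a b f df -> a <= a' -> b' <= b -> rpath a' b' f df.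
Proof.
move=> [cf hf] aa bb; split.
  apply: continuous_subspaceW cf => x /=.
  by rewrite !in_itv /= => /andP[ax xb]; rewrite (le_trans aa ax) (le_trans xb bb).
by move=> t /andP[h1 h2]; apply: hf; rewrite (le_lt_trans aa h1) (lt_le_trans h2 bb).
Qed.

Lemma rpath_derive a b f df :
  (forall t, is_derive t 1 f (df t)) -> rpath a b f df.
Proof.
move=> h; split=> [|t _]; last exact: h.
apply: continuous_subspaceT => x; apply: differentiable_continuous.
by apply/derivable1_diffP; case: (h x).
Qed.

Lemma rpath_cst a b c : rpath a b (fun=> c) (fun=> 0).
Proof. by apply: rpath_derive => t; exact: is_derive_cst. Qed.

Lemma rpathD a b f df g dg : rpath a b f df -> rpath a b g dg ->
  rpath a b (fun t => f t + g t) (fun t => df t + dg t).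
Proof.
move=> [cf hf] [cg hg]; split=> [x|t ht]; first by apply: cvgD; [exact: cf|exact: cg].
by apply: is_deriveD; [exact: hf|exact: hg].
Qed.

Lemma rpathN a b f df : rpath a b f df -> rpath a b (fun t => - f t) (fun t => - df t).
Proof.
move=> [cf hf]; split=> [x|t ht]; first by apply: cvgN; exact: cf.
by apply: is_deriveN; exact: hf.
Qed.

Lemma rpathB a b f df g dg : rpath a b f df -> rpath a b g dg ->
  rpath a b (fun t => f t - g t) (fun t => df t - dg t).
Proof. by move=> hf hg; exact: rpathD hf (rpathN hg). Qed.

Lemma rpathM a b f df g dg : rpath a b f df -> rpath a b g dg ->
  rpath a b (fun t => f t * g t) (fun t => df t * g t + f t * dg t).
Proof.
move=> [cf hf] [cg hg]; split=> [x|t ht]; first by apply: cvgM; [exact: cf|exact: cg].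
apply: is_derive_eq; first by apply: is_deriveM; [exact: hf|exact: hg].
by rewrite /= addrC [X in X + _]mulrC.
Qed.

Lemma rpathZ a b c f df : rpath a b f df ->
  rpath a b (fun t => c * f t) (fun t => c * df t).
Proof.
move=> h; apply: rpath_eq (rpathM (rpath_cst a b c) h) _ => t _.
by rewrite mul0r add0r.
Qed.

Lemma rpath_comp a b f df (g dg : R -> R) :
  (forall t, a <= t <= b -> is_derive (f t) 1 g (dg (f t))) ->
  rpath a b f df ->
  rpath a b (fun t => g (f t)) (fun t => dg (f t) * df t).
Proof.
move=> hg [cf hf]; split=> [|t ht].
  apply: (@within_continuous_comp R R R _ f g) => // y.
  rewrite inE => -[t /=]; rewrite in_itv /= => /hg h <-.
  by apply: differentiable_continuous; apply/derivable1_diffP; case: h.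
apply: (@is_derive1_comp _ g f); last exact: hf.
by case/andP: ht => h1 h2; apply: hg; rewrite !ltW.
Qed.

Lemma rpathV a b f df : rpath a b f df ->
  (forall t, a <= t <= b -> f t != 0) ->
  rpath a b (fun t => (f t)^-1) (fun t => - df t / f t ^+ 2).
Proof.
move=> hf f0.
have h : rpath a b (fun t => (f t)^-1) (fun t => - (f t) ^- 2 * df t).
  apply: (@rpath_comp _ _ f _ (fun y => y^-1) (fun y => - y ^- 2)) hf.
  move=> t ht; have := @is_deriveV R id (f t) 1 1 (f0 _ ht) (is_derive_id _ _).
  by rewrite /= scaler1.
by apply: rpath_eq h _ => t _; rewrite mulrC mulrN mulNr.
Qed.

Lemma rpath_affine a b f df c s :
  rpath a b f df ->
  forall a' b', (forall t, a' <= t <= b' -> a <= c + s * t <= b) ->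
  (forall t, a' < t < b' -> a < c + s * t < b) ->
  rpath a' b' (fun t => f (c + s * t)) (fun t => s * df (c + s * t)).
Proof.
move=> [cf hf] a' b' hcc hoo.
have hd t : is_derive t 1 (fun t => c + s * t) s.
  have h := is_deriveD (is_derive_cst c t 1) (is_deriveZ s (is_derive_id t 1)).
  by apply: is_derive_eq h _; rewrite add0r [LHS]mulr1.
split=> [|t ht]; last first.
  have h := @is_derive1_comp _ f (fun t => c + s * t) t _ _ (hf _ (hoo _ ht)) (hd t).
  by apply: is_derive_eq h _; rewrite mulrC.
apply/subspace_continuousP => x /=; rewrite in_itv /= => hx.
move/subspace_continuousP: cf => /(_ (c + s * x)); rewrite /= in_itv /= => /(_ (hcc _ hx)) cf.
apply: cvg_trans cf => U /=.
have hc : {for x, continuous (fun t => c + s * t)}.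
  by apply: differentiable_continuous; apply/derivable1_diffP; case: (hd x).
rewrite /nbhs /= /within /= => hU.
move: (hc _ hU); rewrite /nbhs /=.
apply: (@filterS _ (nbhs x)) => t /= h; rewrite in_itv /= => ht; apply: h.
by rewrite in_itv /=; exact: hcc.
Qed.

Lemma rpath_le a b f df : a <= b -> rpath a b f df ->
  (forall t, a < t < b -> df t <= 0) -> f b <= f a.
Proof.
move=> ab [cf hf] h.
have h1 x : x \in `]a, b[ -> derivable f x 1.
  by rewrite in_itv /= => /hf [].
have h2 x : x \in `]a, b[ -> derive1 f x <= 0.
  by rewrite in_itv /= => hx; rewrite derive1E; case: (hf _ hx) => _ ->; exact: h.
by apply: (ler0_derive1_le_cc h1 h2 cf); rewrite // in_itv /= ab lexx.
Qed.

Lemma rpath_MVT a b f df : a < b -> rpath a b f df ->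
  exists2 c, a < c < b & f b - f a = df c * (b - a).
Proof.
move=> ab [cf hf].
have h x : x \in `]a, b[ -> is_derive x 1 f (df x) by rewrite in_itv /=; exact: hf.
have [c hc e] := MVT ab h cf.
by exists c => //; rewrite in_itv /= in hc.
Qed.

End Paths.

(** * Differentiable curves of complex matrices *)

Section ComplexParts.
Context {R : realType}.
Implicit Types z w : R[i].

Lemma cReD z w : Re (z + w) = Re z + Re w.
Proof. by case: z w => [a b] [c d]. Qed.

Lemma cImD z w : Im (z + w) = Im z + Im w.
Proof. by case: z w => [a b] [c d]. Qed.

Lemma cReM z w : Re (z * w) = Re z * Re w - Im z * Im w.
Proof. by case: z w => [a b] [c d]. Qed.

Lemma cImM z w : Im (z * w) = Re z * Im w + Im z * Re w.
Proof. by case: z w => [a b] [c d]. Qed.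

Lemma cRe_conj z : Re (Num.conj z) = Re z.
Proof. by case: z. Qed.

Lemma cIm_conj z : Im (Num.conj z) = - Im z.
Proof. by case: z. Qed.

Lemma cReMr (r : R) z : Re (r%:C * z) = r * Re z.
Proof. by rewrite cReM /= mul0r subr0. Qed.

Lemma cImMr (r : R) z : Im (r%:C * z) = r * Im z.
Proof. by rewrite cImM /= mul0r addr0. Qed.

Lemma cReV z : Re z^-1 = Re z / (Re z ^+ 2 + Im z ^+ 2).
Proof. by case: z. Qed.

Lemma cImV z : Im z^-1 = - Im z / (Re z ^+ 2 + Im z ^+ 2).
Proof. by case: z => a b /=; rewrite mulNr. Qed.

Lemma cRe_sum I (r : seq I) (P : pred I) (F : I -> R[i]) :
  Re (\sum_(i <- r | P i) F i) = \sum_(i <- r | P i) Re (F i).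
Proof. exact: (big_morph _ cReD). Qed.

Lemma cIm_sum I (r : seq I) (P : pred I) (F : I -> R[i]) :
  Im (\sum_(i <- r | P i) F i) = \sum_(i <- r | P i) Im (F i).
Proof. exact: (big_morph _ cImD). Qed.

Lemma complex_eq z w : Re z = Re w -> Im z = Im w -> z = w.
Proof. by case: z w => [a b] [c d] /= -> ->. Qed.

End ComplexParts.

Section MatrixPaths.
Context {R : realType}.
Implicit Types (a b t c : R).

Definition cpath a b (z dz : R -> R[i]) : Prop :=
  rpath a b (fun t => Re (z t)) (fun t => Re (dz t)) /\
  rpath a b (fun t => Im (z t)) (fun t => Im (dz t)).

Lemma cpath_eq a b z dz dw : cpath a b z dz ->
  (forall t, a < t < b -> dz t = dw t) -> cpath a b z dw.
Proof. by move=> [h1 h2] e; split; [apply: rpath_eq h1 _|apply: rpath_eq h2 _] => t /e ->. Qed.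

Lemma cpath_congr a b z w dz : {in `[a, b], z =1 w} ->
  cpath a b z dz -> cpath a b w dz.
Proof.
by move=> zw [h1 h2]; split; [apply: rpath_congr h1|apply: rpath_congr h2] => t /zw ->.
Qed.

Lemma cpath_cst a b (c : R[i]) : cpath a b (fun=> c) (fun=> 0).
Proof. by split; apply: rpath_cst. Qed.

Lemma cpathD a b z dz w dw : cpath a b z dz -> cpath a b w dw ->
  cpath a b (fun t => z t + w t) (fun t => dz t + dw t).
Proof.
move=> [z1 z2] [w1 w2]; split.
  have := rpathD z1 w1; congr rpath; apply/funext => t;
  by rewrite cReD.
have := rpathD z2 w2; congr rpath; apply/funext => t;
by rewrite cImD.
Qed.

Lemma cpathM a b z dz w dw : cpath a b z dz -> cpath a b w dw ->
  cpath a b (fun t => z t * w t) (fun t => dz t * w t + z t * dw t).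
Proof.
move=> [z1 z2] [w1 w2]; split.
  have := rpathB (rpathM z1 w1) (rpathM z2 w2).
  congr rpath; apply/funext => t; rewrite ?cReM //.
  rewrite cReD /= !cReM; ring.
have := rpathD (rpathM z1 w2) (rpathM z2 w1).
congr rpath; apply/funext => t; rewrite ?cImM //.
rewrite cImD /= !cImM; ring.
Qed.

Lemma cpath_conj a b z dz : cpath a b z dz ->
  cpath a b (fun t => Num.conj (z t)) (fun t => Num.conj (dz t)).
Proof.
move=> [z1 z2]; split.
  by move: z1; congr rpath; apply/funext => t; rewrite cRe_conj.
by move: (rpathN z2); congr rpath; apply/funext => t; rewrite cIm_conj.
Qed.

Lemma sqr_Re_Im_neq0 (z : R[i]) : z != 0 -> Re z ^+ 2 + Im z ^+ 2 != 0.
Proof.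
case: z => x y; apply: contraNneq => /= /eqP.
by rewrite paddr_eq0 ?sqr_ge0 // !sqrf_eq0 => /andP[/eqP -> /eqP ->].
Qed.

Lemma cpathV a b z dz : cpath a b z dz -> (forall t, a <= t <= b -> z t != 0) ->
  exists dw, cpath a b (fun t => (z t)^-1) dw.
Proof.
move=> [z1 z2] nz.
have h2 := rpathV (rpathD (rpathM z1 z1) (rpathM z2 z2)).
have {}h2 := h2 (fun t ht => sqr_Re_Im_neq0 (nz t ht)).
have [d1 h1] : exists d, rpath a b (fun t => Re (z t)^-1) d.
  by eexists; have := rpathM z1 h2; congr rpath; apply/funext => t; rewrite cReV.
have [d3 h3] : exists d, rpath a b (fun t => Im (z t)^-1) d.
  by eexists; have := rpathM (rpathN z2) h2; congr rpath; apply/funext => t; rewrite cImV.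
by exists (fun t => Complex (d1 t) (d3 t)).
Qed.

Lemma cpath_sum a b I (r : seq I) (P : pred I) (z dz : I -> R -> R[i]) :
  (forall i, cpath a b (z i) (dz i)) ->
  cpath a b (fun t => \sum_(i <- r | P i) z i t) (fun t => \sum_(i <- r | P i) dz i t).
Proof.
move=> h; elim: r => [|x r ih].
  have := cpath_cst a b 0; congr cpath; apply/funext => t; by rewrite big_nil.
case: (boolP (P x)) => px; last first.
  by move: ih; congr cpath; apply/funext => t; rewrite big_cons (negbTE px).
by have := cpathD (h x) ih; congr cpath; apply/funext => t; rewrite big_cons px.
Qed.

(** Differentiability without naming the derivative, for quantities such as
    determinants whose derivative is irrelevant. *)
Definition csmooth a b z := exists dz, cpath a b z dz.

Lemma csmoothM a b z w : csmooth a b z -> csmooth a b w ->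
  csmooth a b (fun t => z t * w t).
Proof. by move=> [dz hz] [dw hw]; eexists; exact: cpathM hz hw. Qed.

Lemma csmooth_prod a b I (r : seq I) (P : pred I) (z : I -> R -> R[i]) :
  (forall i, csmooth a b (z i)) ->
  csmooth a b (fun t => \prod_(i <- r | P i) z i t).
Proof.
move=> h; elim: r => [|x r [dz ih]].
  by exists (fun=> 0); have := cpath_cst a b 1; congr cpath; apply/funext => t; rewrite big_nil.
case: (boolP (P x)) => px; last first.
  by exists dz; move: ih; congr cpath; apply/funext => t; rewrite big_cons (negbTE px).
have [dw hw] := h x; eexists.
by have := cpathM hw ih; congr cpath; apply/funext => t; rewrite big_cons px.
Qed.

Lemma csmooth_sum a b I (r : seq I) (P : pred I) (z : I -> R -> R[i]) :
  (forall i, csmooth a b (z i)) ->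
  csmooth a b (fun t => \sum_(i <- r | P i) z i t).
Proof.
by move=> /choice[dz h]; eexists; exact: cpath_sum h.
Qed.

Definition mpath a b p q (X dX : R -> 'M[R[i]]_(p, q)) : Prop :=
  forall i j, cpath a b (fun t => X t i j) (fun t => dX t i j).

Lemma mpath_eq a b p q (X dX dY : R -> 'M[R[i]]_(p, q)) : mpath a b X dX ->
  (forall t, a < t < b -> dX t = dY t) -> mpath a b X dY.
Proof. by move=> h e i j; apply: cpath_eq (h i j) _ => t /e ->. Qed.

Lemma mpath_uniq a b p q (X dX dY : R -> 'M[R[i]]_(p, q)) :
  mpath a b X dX -> mpath a b X dY -> forall t, a < t < b -> dX t = dY t.
Proof.
move=> h h' t ht; apply/matrixP => i j.
have [[_ h1] [_ h2]] := h i j; have [[_ h3] [_ h4]] := h' i j.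
apply: complex_eq.
  by case: (h1 _ ht) => _ <-; case: (h3 _ ht) => _ <-.
by case: (h2 _ ht) => _ <-; case: (h4 _ ht) => _ <-.
Qed.

Lemma mpath_sub a b a' b' p q (X dX : R -> 'M[R[i]]_(p, q)) :
  mpath a b X dX -> a <= a' -> b' <= b -> mpath a' b' X dX.
Proof. by move=> h aa bb i j; have [h1 h2] := h i j; split; [apply: rpath_sub h1 _ _|apply: rpath_sub h2 _ _]. Qed.

Lemma mpath_cst a b p q (X : 'M[R[i]]_(p, q)) : mpath a b (fun=> X) (fun=> 0).
Proof. by move=> i j; have := cpath_cst a b (X i j); congr cpath; apply/funext => t; rewrite mxE. Qed.

Lemma mpathD a b p q (X dX Y dY : R -> 'M[R[i]]_(p, q)) :
  mpath a b X dX -> mpath a b Y dY ->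
  mpath a b (fun t => X t + Y t) (fun t => dX t + dY t).
Proof.
by move=> hX hY i j; have := cpathD (hX i j) (hY i j); congr cpath; apply/funext => t; rewrite mxE.
Qed.

Lemma mpathM a b p q r (X dX : R -> 'M[R[i]]_(p, q)) (Y dY : R -> 'M[R[i]]_(q, r)) :
  mpath a b X dX -> mpath a b Y dY ->
  mpath a b (fun t => X t *m Y t) (fun t => dX t *m Y t + X t *m dY t).
Proof.
move=> hX hY i j.
have := @cpath_sum a b _ (index_enum 'I_q) xpredT _ _ (fun k => cpathM (hX i k) (hY k j)).
congr cpath; apply/funext => t; rewrite !mxE //.
by rewrite -big_split.
Qed.

Lemma mpathZ a b p q (c : R[i]) (X dX : R -> 'M[R[i]]_(p, q)) :
  mpath a b X dX -> mpath a b (fun t => c *: X t) (fun t => c *: dX t).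
Proof.
move=> hX i j; apply: cpath_eq.
  by have := cpathM (cpath_cst a b c) (hX i j); congr cpath; apply/funext => t; rewrite ?mxE.
by move=> t _; rewrite !mxE mul0r add0r.
Qed.

Lemma mpathN a b p q (X dX : R -> 'M[R[i]]_(p, q)) :
  mpath a b X dX -> mpath a b (fun t => - X t) (fun t => - dX t).
Proof.
move=> hX; have := mpathZ (-1) hX.
by congr mpath; apply/funext => t; rewrite scaleN1r.
Qed.

Lemma mpathB a b p q (X dX Y dY : R -> 'M[R[i]]_(p, q)) :
  mpath a b X dX -> mpath a b Y dY ->
  mpath a b (fun t => X t - Y t) (fun t => dX t - dY t).
Proof. by move=> hX hY; exact: mpathD hX (mpathN hY). Qed.

Lemma mpath_adj a b p q (X dX : R -> 'M[R[i]]_(p, q)) :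
  mpath a b X dX -> mpath a b (fun t => (X t)^t*) (fun t => (dX t)^t*).
Proof.
move=> hX i j; have := cpath_conj (hX j i).
by congr cpath; apply/funext => t; rewrite !mxE.
Qed.

Lemma csmooth_det a b n (X dX : R -> 'M[R[i]]_n) :
  mpath a b X dX -> csmooth a b (fun t => \det (X t)).
Proof.
move=> hX; apply: csmooth_sum => s.
apply: csmoothM; first by eexists; exact: cpath_cst.
by apply: csmooth_prod => i; eexists; exact: hX.
Qed.

(** Cramer's rule gives differentiability of the inverse, and then
    differentiating X X^-1 = 1 gives the value of the derivative. *)
Lemma mpathV a b n (X dX : R -> 'M[R[i]]_n) :
  mpath a b X dX -> (forall t, a <= t <= b -> X t \in unitmx) ->
  mpath a b (fun t => invmx (X t)) (fun t => - (invmx (X t) *m dX t *m invmx (X t))).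
Proof.
move=> hX hu.
have [dY hY] : exists dY, mpath a b (fun t => invmx (X t)) dY.
  have [dd hd] := csmooth_det hX.
  have nz t : a <= t <= b -> \det (X t) != 0.
    by move/hu; rewrite unitmxE unitfE.
  have [de he] := cpathV hd nz.
  have h i j : exists dz, cpath a b (fun t => invmx (X t) i j) dz.
    have [df hf] : csmooth a b (fun t => cofactor (X t) j i).
      have h : mpath a b (fun t => row' j (col' i (X t))) (fun t => row' j (col' i (dX t))).
        move=> k l; have := hX (lift j k) (lift i l).
        by congr cpath; apply/funext => t; rewrite !mxE.
      have [dg hg] := csmooth_det h.
      by eexists; exact: cpathM (cpath_cst _ _ _) hg.
    eexists; apply: (cpath_congr _ (cpathM he hf)) => t; rewrite in_itv /= => /hu ut.
    by rewrite /invmx ut !mxE.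
  have /choice[dY hY] : forall ij, exists dz, cpath a b (fun t => invmx (X t) ij.1 ij.2) dz.
    by move=> ij; exact: h.
  exists (fun t => \matrix_(i, j) dY (i, j) t) => i j.
  by have := hY (i, j); congr cpath; apply/funext => t; rewrite mxE.
have h0 : mpath a b (fun t => X t *m invmx (X t)) (fun=> 0).
  move=> i j; have := mpath_cst a b (1%:M : 'M[R[i]]_n) i j.
  apply: cpath_congr => t; rewrite in_itv /= => /hu ut; by rewrite mulmxV.
apply: (mpath_eq hY) => t ht.
have ut : X t \in unitmx by apply: hu; case/andP: ht => *; rewrite !ltW.
have : dX t *m invmx (X t) + X t *m dY t = 0.
  exact: (mpath_uniq (mpathM hX hY) h0 ht).
move/(congr1 (mulmx (invmx (X t)))).
rewrite mulmx0 mulmxDr !mulmxA mulVmx // mul1mx => /eqP.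
by rewrite addrC addr_eq0 => /eqP.
Qed.

End MatrixPaths.

(** * The Frobenius inner product and its norm *)

Section Frobenius.
Context {R : realType} {n : nat}.
Implicit Types A B D U : 'M[R[i]]_n.

Lemma adjmxM A B : (A *m B)^t* = B^t* *m A^t*.
Proof. by rewrite trmx_mul map_mxM. Qed.

Lemma adjmxD A B : (A + B)^t* = A^t* + B^t*.
Proof. by rewrite linearD map_mxD. Qed.

Lemma adjmxN A : (- A)^t* = - A^t*.
Proof. by rewrite linearN map_mxN. Qed.

Lemma Re_adj p q (A : 'M[R[i]]_(p, q)) i j : Re (A^t* i j) = Re (A j i).
Proof. by rewrite !mxE; case: (A j i). Qed.

Lemma Im_adj p q (A : 'M[R[i]]_(p, q)) i j : Im (A^t* i j) = - Im (A j i).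
Proof. by rewrite !mxE; case: (A j i). Qed.

Lemma adjmxZ (r : R) A : (r%:C *: A)^t* = r%:C *: A^t*.
Proof.
apply/matrixP => i j; apply: complex_eq.
  by rewrite Re_adj !mxE !cReMr cRe_conj.
by rewrite Im_adj !mxE !cImMr cIm_conj mulrN.
Qed.

Lemma adjmx1 : (1%:M : 'M[R[i]]_n)^t* = 1%:M.
Proof. by rewrite trmx1 map_mx1. Qed.

Lemma adjmxK A : A^t*^t* = A. Proof. exact: trmxCK. Qed.

(** The real part makes this a Euclidean structure on the matrices seen as a real
    vector space, which is what the real Lie algebra u(n) calls for. *)
Definition ip A B : R := Re (\tr (A^t* *m B)).

Lemma ipE A B : ip A B = \sum_i \sum_j (Re (A i j) * Re (B i j) + Im (A i j) * Im (B i j)).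
Proof.
rewrite /ip /mxtrace exchange_big cRe_sum; apply: eq_bigr => j _ /=.
rewrite mxE cRe_sum; apply: eq_bigr => i _.
by rewrite cReM Re_adj Im_adj mulNr opprK.
Qed.

Lemma ipC A B : ip A B = ip B A.
Proof. by rewrite !ipE; do 2!apply: eq_bigr => ? _; rewrite ![Re (A _ _) * _]mulrC ![Im (A _ _) * _]mulrC. Qed.

Lemma ipDr A B D : ip A (B + D) = ip A B + ip A D.
Proof. by rewrite /ip mulmxDr raddfD cReD. Qed.

Lemma ipDl A B D : ip (B + D) A = ip B A + ip D A.
Proof. by rewrite !(ipC _ A) ipDr. Qed.

Lemma ipZr (r : R) A B : ip A (r%:C *: B) = r * ip A B.
Proof. by rewrite /ip -scalemxAr mxtraceZ cReMr. Qed.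

Lemma ipZl (r : R) A B : ip (r%:C *: A) B = r * ip A B.
Proof. by rewrite ipC ipZr ipC. Qed.

Lemma ipNr A B : ip A (- B) = - ip A B.
Proof. by rewrite -[- B](scaleN1r B) -[-1](rmorphN1 (real_complex R)) ipZr mulN1r. Qed.

Lemma ipNl A B : ip (- A) B = - ip A B.
Proof. by rewrite ipC ipNr ipC. Qed.

Lemma ipBr A B D : ip A (B - D) = ip A B - ip A D.
Proof. by rewrite ipDr ipNr. Qed.

Lemma ipBl A B D : ip (B - D) A = ip B A - ip D A.
Proof. by rewrite ipDl ipNl. Qed.

Lemma ip0r A : ip A 0 = 0.
Proof. by rewrite /ip mulmx0 raddf0. Qed.

Lemma ip0l A : ip 0 A = 0.
Proof. by rewrite ipC ip0r. Qed.

Lemma ip_sumr I (r : seq I) (P : pred I) A (F : I -> 'M[R[i]]_n) :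
  ip A (\sum_(i <- r | P i) F i) = \sum_(i <- r | P i) ip A (F i).
Proof. exact: (big_morph (ip A) (ipDr A) (ip0r A)). Qed.

Lemma ip_mulr A B D : ip (A *m B) D = ip B (A^t* *m D).
Proof. by rewrite /ip adjmxM mulmxA. Qed.

Lemma ip_mull A B D : ip (A *m B) D = ip A (D *m B^t*).
Proof. by rewrite /ip adjmxM -mulmxA mxtrace_mulC mulmxA. Qed.

Lemma ip_rmulr A B D : ip A (B *m D) = ip (B^t* *m A) D.
Proof. by rewrite ip_mulr adjmxK. Qed.

Lemma ip_rmull A B D : ip A (B *m D) = ip (A *m D^t*) B.
Proof. by rewrite ip_mull adjmxK. Qed.

Lemma ip_adj A B : ip (A^t*) (B^t*) = ip A B.
Proof. by rewrite /ip adjmxK mxtrace_mulC -/(ip B A) ipC. Qed.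

Lemma ip_ge0 A : 0 <= ip A A.
Proof. by rewrite ipE; do 2!apply: sumr_ge0 => ? _; rewrite addr_ge0 // -expr2 sqr_ge0. Qed.

Lemma ip_eq0 A : ip A A = 0 -> A = 0.
Proof.
have p i j : 0 <= Re (A i j) * Re (A i j) + Im (A i j) * Im (A i j).
  by rewrite addr_ge0 // -expr2 sqr_ge0.
rewrite ipE => /eqP; rewrite psumr_eq0; last by move=> i _; apply: sumr_ge0 => j _; exact: p.
move=> /allP h; apply/matrixP => i j; rewrite !mxE.
have := h i (mem_index_enum _) => /=; rewrite psumr_eq0; last by move=> k _; exact: p.
move=> /allP /(_ j (mem_index_enum _)) /=.
rewrite paddr_eq0 -?expr2 ?sqr_ge0 // !sqrf_eq0 => /andP[/eqP h1 /eqP h2].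
exact: complex_eq.
Qed.

Definition fnorm A : R := Num.sqrt (ip A A).

Lemma fnorm_ge0 A : 0 <= fnorm A. Proof. exact: sqrtr_ge0. Qed.

Lemma fnorm_sqr A : fnorm A ^+ 2 = ip A A. Proof. by rewrite sqr_sqrtr // ip_ge0. Qed.

Lemma fnorm_eq0 A : fnorm A = 0 -> A = 0.
Proof. by move=> h; apply: ip_eq0; rewrite -fnorm_sqr h expr0n. Qed.

Lemma fnorm0 : fnorm 0 = 0.
Proof. by rewrite /fnorm ip0r sqrtr0. Qed.

Lemma ip_sqr_le A B : ip A B ^+ 2 <= ip A A * ip B B.
Proof.
case: (eqVneq (ip B B) 0) => [/ip_eq0 ->|b0]; first by rewrite !ip0r expr0n mulr0.
have bp : 0 < ip B B by rewrite lt_def b0 ip_ge0.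
have := ip_ge0 ((ip B B)%:C *: A - (ip A B)%:C *: B).
rewrite ipBl !ipBr !ipZl !ipZr (ipC B A).
move: (ip A A) (ip B B) (ip A B) bp => a b c bpos h.
rewrite -subr_ge0 -(pmulr_rge0 _ bpos); apply: le_trans h _.
by rewrite le_eqVlt; apply/orP; left; apply/eqP; ring.
Qed.

Lemma ip_le A B : `|ip A B| <= fnorm A * fnorm B.
Proof.
by rewrite -(@ler_pXn2r _ 2) ?nnegrE ?mulr_ge0 ?fnorm_ge0 // real_normK ?num_real // exprMn !fnorm_sqr ip_sqr_le.
Qed.

Lemma ip_le1 A B : ip A B <= fnorm A * fnorm B.
Proof. exact: le_trans (ler_norm _) (ip_le A B). Qed.

Lemma fnorm_le A (c : R) : 0 <= c -> ip A A <= c ^+ 2 -> fnorm A <= c.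
Proof. by move=> c0 h; rewrite -(@ler_pXn2r _ 2) ?nnegrE ?fnorm_ge0 // fnorm_sqr. Qed.

Lemma fnormD A B : fnorm (A + B) <= fnorm A + fnorm B.
Proof.
apply: fnorm_le; first by rewrite addr_ge0 ?fnorm_ge0.
rewrite ipDl !ipDr (ipC B A) sqrrD !fnorm_sqr.
have := ip_le1 A B; lra.
Qed.

Lemma fnormN A : fnorm (- A) = fnorm A.
Proof. by rewrite /fnorm ipNl ipNr opprK. Qed.

Lemma fnormB A B : fnorm (A - B) <= fnorm A + fnorm B.
Proof. by rewrite -(fnormN B) fnormD. Qed.

Lemma fnorm_distC A B : fnorm (A - B) = fnorm (B - A).
Proof. by rewrite -fnormN opprB. Qed.

Lemma fnormZ (r : R) A : fnorm (r%:C *: A) = `|r| * fnorm A.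
Proof. by rewrite /fnorm ipZl ipZr mulrA -expr2 sqrtrM ?sqr_ge0 // sqrtr_sqr. Qed.

Lemma fnorm_sum I (r : seq I) (P : pred I) (F : I -> 'M[R[i]]_n) :
  fnorm (\sum_(i <- r | P i) F i) <= \sum_(i <- r | P i) fnorm (F i).
Proof.
elim/big_ind2 : _ => [|x1 x2 y1 y2 h1 h2|//]; first by rewrite fnorm0.
exact: le_trans (fnormD _ _) (lerD h1 h2).
Qed.

Lemma fnorm_adj A : fnorm (A^t*) = fnorm A.
Proof. by rewrite /fnorm ip_adj. Qed.

Lemma fnorm_entry A i j : `|Re (A i j)| <= fnorm A /\ `|Im (A i j)| <= fnorm A.
Proof.
have h : Re (A i j) ^+ 2 + Im (A i j) ^+ 2 <= fnorm A ^+ 2.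
  rewrite fnorm_sqr ipE (bigD1 i) //= (bigD1 j) //= -!expr2 -!addrA lerD2l lerDl.
  rewrite addr_ge0 ?sumr_ge0 // => *; rewrite ?sumr_ge0 // => *;
  by rewrite addr_ge0 // -expr2 sqr_ge0.
split; rewrite -(@ler_pXn2r _ 2) ?nnegrE ?fnorm_ge0 // real_normK ?num_real //;
by apply: le_trans h; rewrite ?lerDl ?lerDr sqr_ge0.
Qed.

Lemma sum_CauchySchwarz I (r : seq I) (x y : I -> R) :
  (\sum_(i <- r) x i * y i) ^+ 2 <= (\sum_(i <- r) x i ^+ 2) * (\sum_(i <- r) y i ^+ 2).
Proof.
elim: r => [|k r ih]; first by rewrite !big_nil expr0n mulr0.
rewrite !big_cons.
set s := \sum_(j <- r) x j * y j in ih *.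
set a := \sum_(j <- r) x j ^+ 2 in ih *.
set b := \sum_(j <- r) y j ^+ 2 in ih *.
have a0 : 0 <= a by apply: sumr_ge0 => *; exact: sqr_ge0.
have b0 : 0 <= b by apply: sumr_ge0 => *; exact: sqr_ge0.
suff h : 2 * (x k * y k) * s <= x k ^+ 2 * b + y k ^+ 2 * a by nra.
apply: le_trans (ler_norm _) _.
rewrite -(@ler_pXn2r _ 2) ?nnegrE //; last by rewrite addr_ge0 // mulr_ge0 ?sqr_ge0.
rewrite real_normK ?num_real //.
have := sqr_ge0 (x k ^+ 2 * b - y k ^+ 2 * a).
have : (x k * y k) ^+ 2 * s ^+ 2 <= (x k * y k) ^+ 2 * (a * b) by apply: ler_wpM2l => //; exact: sqr_ge0.
set p := x k; set q := y k => h1 h2; nra.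
Qed.

(** The form needed for complex entries: list real and imaginary parts one after the
    other. *)
Lemma sum_CauchySchwarz2 I (r : seq I) (x y u v : I -> R) :
  (\sum_(i <- r) (x i * u i + y i * v i)) ^+ 2 <=
  (\sum_(i <- r) (x i ^+ 2 + y i ^+ 2)) * (\sum_(i <- r) (u i ^+ 2 + v i ^+ 2)).
Proof.
have := sum_CauchySchwarz (map inl r ++ map inr r)
  (fun s : I + I => match s with inl i => x i | inr i => y i end)
  (fun s : I + I => match s with inl i => u i | inr i => v i end).
by rewrite !big_cat !big_map !big_split.
Qed.

(** Each entry z of A B satisfies |z|^2 = Re (z^* z), and pushing z^* inside the
    sum makes the right-hand side a real scalar product. *)
Lemma fnormM A B : fnorm (A *m B) <= fnorm A * fnorm B.
Proof.
apply: fnorm_le; first by rewrite mulr_ge0 ?fnorm_ge0.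
rewrite exprMn !fnorm_sqr !ipE.
pose a i := \sum_k (Re (A i k) * Re (A i k) + Im (A i k) * Im (A i k)).
pose b j := \sum_k (Re (B k j) * Re (B k j) + Im (B k j) * Im (B k j)).
have -> : \sum_i \sum_j (Re (B i j) * Re (B i j) + Im (B i j) * Im (B i j)) = \sum_j b j.
  exact: exchange_big.
rewrite mulr_suml; apply: ler_sum => i _; rewrite -/(a i) mulr_sumr.
apply: ler_sum => j _; rewrite -!expr2.
set p := Re _; set q := Im _.
have e : p ^+ 2 + q ^+ 2 = \sum_k ((p * Re (A i k) + q * Im (A i k)) * Re (B k j)
    + (q * Re (A i k) - p * Im (A i k)) * Im (B k j)).
  rewrite [p ^+ 2]expr2 [q ^+ 2]expr2 {2}/p {2}/q !mxE cRe_sum cIm_sum.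
  rewrite !mulr_sumr -big_split; apply: eq_bigr => k _ /=.
  rewrite cReM cImM; ring.
have := sum_CauchySchwarz2 (index_enum 'I_n) (fun k => p * Re (A i k) + q * Im (A i k))
  (fun k => q * Re (A i k) - p * Im (A i k)) (fun k => Re (B k j)) (fun k => Im (B k j)).
rewrite -e.
have -> : \sum_(k < n) ((p * Re (A i k) + q * Im (A i k)) ^+ 2 +
   (q * Re (A i k) - p * Im (A i k)) ^+ 2) = (p ^+ 2 + q ^+ 2) * a i.
  rewrite mulr_sumr; apply: eq_bigr => k _; ring.
have -> : \sum_k (Re (B k j) ^+ 2 + Im (B k j) ^+ 2) = b j.
  by apply: eq_bigr => k _; rewrite !expr2.
rewrite expr2 -mulrA.
have : 0 <= p ^+ 2 + q ^+ 2 by rewrite addr_ge0 ?sqr_ge0.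
rewrite le_eqVlt => /predU1P[<- _|h]; last by rewrite ler_pM2l.
by rewrite mulr_ge0 // sumr_ge0 // => k _; rewrite addr_ge0 // -expr2 sqr_ge0.
Qed.

Lemma ip_unitaryl U A B : U^t* *m U = 1%:M -> ip (U *m A) (U *m B) = ip A B.
Proof. by move=> h; rewrite ip_mulr mulmxA h mul1mx. Qed.

Lemma ip_unitaryr U A B : U *m U^t* = 1%:M -> ip (A *m U) (B *m U) = ip A B.
Proof. by move=> h; rewrite ip_mull -mulmxA h mulmx1. Qed.

Lemma fnorm_unitaryl U A : U^t* *m U = 1%:M -> fnorm (U *m A) = fnorm A.
Proof. by move=> h; rewrite /fnorm ip_unitaryl. Qed.

Lemma fnorm_unitaryr U A : U *m U^t* = 1%:M -> fnorm (A *m U) = fnorm A.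
Proof. by move=> h; rewrite /fnorm ip_unitaryr. Qed.

End Frobenius.

(** * Mean value inequality for matrix curves *)

Section MeanValue.
Context {R : realType} {n : nat}.
Implicit Types (a b t : R) (X dX Y dY : R -> 'M[R[i]]_n).

Lemma rpath_ip a b X dX Y dY : mpath a b X dX -> mpath a b Y dY ->
  rpath a b (fun t => ip (X t) (Y t)) (fun t => ip (dX t) (Y t) + ip (X t) (dY t)).
Proof.
move=> hX hY; have h := mpathM (mpath_adj hX) hY.
have [h1 _] := @cpath_sum _ a b _ (index_enum 'I_n) xpredT _ _ (fun i => h i i).
move: h1; congr rpath; apply/funext => t //.
by rewrite -cReD -raddfD.
Qed.

(** Pairing the curve with its own increment D reduces the claim to the scalar
    function <D, X t> - |D| w t, which is nonincreasing. *)
Lemma mpath_mean_value a b X dX (w dw : R -> R) : a <= b ->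
  mpath a b X dX -> rpath a b w dw ->
  (forall t, a < t < b -> fnorm (dX t) <= dw t) ->
  fnorm (X b - X a) <= w b - w a.
Proof.
move=> ab hX hw h.
set D := X b - X a.
have hD := rpathB (rpath_ip (mpath_cst a b D) hX) (rpathZ (fnorm D) hw).
have : ip D (X b) - fnorm D * w b <= ip D (X a) - fnorm D * w a.
  apply: (rpath_le ab hD) => t ht.
  rewrite ip0l add0r subr_le0; apply: le_trans (ip_le1 _ _) _.
  by rewrite ler_wpM2l ?fnorm_ge0 // h.
move=> h2.
have e : fnorm D * fnorm D = ip D (X b) - ip D (X a) by rewrite -expr2 fnorm_sqr -ipBr.
have : fnorm D * fnorm D <= fnorm D * (w b - w a) by rewrite mulrBr e; lra.
have := fnorm_ge0 D; rewrite le_eqVlt => /predU1P[<- _|d0]; last by rewrite ler_pM2l.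
rewrite subr_ge0 -lerN2.
have hN := rpathN hw; apply: (rpath_le ab hN) => t ht.
by rewrite oppr_le0; apply: le_trans (h _ ht); exact: fnorm_ge0.
Qed.

Lemma mpath_const a b X dX : a <= b -> mpath a b X dX ->
  (forall t, a < t < b -> dX t = 0) -> X b = X a.
Proof.
move=> ab hX h; apply/eqP; rewrite -subr_eq0; apply/eqP/fnorm_eq0/le_anti.
rewrite fnorm_ge0 andbT -(subrr (0 : R)).
apply: (@mpath_mean_value a b X dX (fun=> 0) (fun=> 0)) => //; first exact: rpath_cst.
by move=> t /h ->; rewrite fnorm0.
Qed.

Lemma rpath_cvg_right a b f df : a < b -> rpath a b f df ->
  forall e, 0 < e -> exists2 d, 0 < d & forall t, a <= t <= b -> `|t - b| < d -> `|f t - f b| < e.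
Proof.
move=> ab [hc _] e e0.
have hb : `[a, b]%classic b by rewrite /= in_itv /= lexx ltW.
move/subspace_continuousP: hc => /(_ b hb) /cvgrPdist_lt /(_ e e0).
rewrite near_withinE near_nbhs => -[d /= d0 hd]; exists d => // t ht tb.
by rewrite distrC; apply: hd; rewrite /ball_ /= 1?distrC // in_itv.
Qed.

Lemma rpath_cvg_left a b f df : a < b -> rpath a b f df ->
  forall e, 0 < e -> exists2 d, 0 < d & forall t, a <= t <= b -> `|t - a| < d -> `|f t - f a| < e.
Proof.
move=> ab [hc _] e e0.
have ha : `[a, b]%classic a by rewrite /= in_itv /= lexx ltW.
move/subspace_continuousP: hc => /(_ a ha) /cvgrPdist_lt /(_ e e0).
rewrite near_withinE near_nbhs => -[d /= d0 hd]; exists d => // t ht tb.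
by rewrite distrC; apply: hd; rewrite /ball_ /= 1?distrC // in_itv.
Qed.

Let dist_path a b X dX (B : 'M[R[i]]_n) : mpath a b X dX ->
  exists df, rpath a b (fun t => ip (X t - B) (X t - B)) df.
Proof.
by move=> hX; eexists; apply: (rpath_ip (mpathB hX (mpath_cst a b B)) (mpathB hX (mpath_cst a b B))).
Qed.

Lemma mpath_near_right a b X dX : a < b -> mpath a b X dX ->
  forall e, 0 < e -> exists2 d, 0 < d & forall t, a <= t <= b -> `|t - b| < d -> fnorm (X t - X b) < e.
Proof.
move=> ab hX e e0; have [df hf] := dist_path (X b) hX.
have e2 : 0 < e ^+ 2 by rewrite exprn_gt0.
have [d d0 hd] := rpath_cvg_right ab hf e2; exists d => // t h1 h2.
have := hd t h1 h2; rewrite subrr ip0r subr0 ger0_norm ?ip_ge0 // -fnorm_sqr.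
by rewrite ltr_pXn2r ?nnegrE ?fnorm_ge0 // ltW.
Qed.

Lemma mpath_near_left a b X dX : a < b -> mpath a b X dX ->
  forall e, 0 < e -> exists2 d, 0 < d & forall t, a <= t <= b -> `|t - a| < d -> fnorm (X t - X a) < e.
Proof.
move=> ab hX e e0; have [df hf] := dist_path (X a) hX.
have e2 : 0 < e ^+ 2 by rewrite exprn_gt0.
have [d d0 hd] := rpath_cvg_left ab hf e2; exists d => // t h1 h2.
have := hd t h1 h2; rewrite subrr ip0r subr0 ger0_norm ?ip_ge0 // -fnorm_sqr.
by rewrite ltr_pXn2r ?nnegrE ?fnorm_ge0 // ltW.
Qed.

End MeanValue.

(** * Linear flows with skew-Hermitian generator *)

Section Flows.
Context {R : realType} {n : nat}.
Implicit Types (a b t : R) (X Y A B : R -> 'M[R[i]]_n).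

Lemma mpath_affine a b (c s : R) X dX : mpath a b X dX ->
  forall a' b', (forall t, a' <= t <= b' -> a <= c + s * t <= b) ->
  (forall t, a' < t < b' -> a < c + s * t < b) ->
  mpath a' b' (fun t => X (c + s * t)) (fun t => s%:C *: dX (c + s * t)).
Proof.
move=> hX a' b' h1 h2 i j; have [hr hi] := hX i j.
split; [have := rpath_affine hr h1 h2|have := rpath_affine hi h1 h2];
  by congr rpath; apply/funext => t; rewrite mxE ?cReMr ?cImMr.
Qed.

(** X^* X has derivative X^* (A^* + A) X = 0. *)
Lemma unitary_flow a b X A : mpath a b X (fun t => A t *m X t) ->
  (forall t, a < t < b -> (A t)^t* = - A t) ->
  (X a)^t* *m X a = 1%:M ->
  forall t, a <= t <= b -> (X t)^t* *m X t = 1%:M.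
Proof.
move=> hX hA h1 t /andP[at_ tb]; rewrite -h1.
have hX' := mpath_sub hX (lexx a) tb.
apply: (mpath_const at_ (mpathM (mpath_adj hX') hX')) => s /andP[h2 h3].
rewrite adjmxM hA ?h2 ?(lt_le_trans h3 tb) //.
by rewrite mulmxN mulNmx !mulmxA addNr.
Qed.

(** Y^* X is the identity at a and has derivative Y^* (A - B) X, whose norm is that
    of A - B by unitary invariance: no exponential factor appears. *)
Lemma flow_compare a b X Y A B (w dw : R -> R) : a <= b ->
  mpath a b X (fun t => A t *m X t) -> mpath a b Y (fun t => B t *m Y t) ->
  (forall t, a < t < b -> (A t)^t* = - A t) ->
  (forall t, a < t < b -> (B t)^t* = - B t) ->
  (X a)^t* *m X a = 1%:M -> X a = Y a -> rpath a b w dw ->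
  (forall t, a < t < b -> fnorm (A t - B t) <= dw t) ->
  fnorm (X b - Y b) <= w b - w a.
Proof.
move=> ab hX hY hA hB h1 XY hw h.
have uX := unitary_flow hX hA h1.
have uY : forall t, a <= t <= b -> (Y t)^t* *m Y t = 1%:M.
  by apply: unitary_flow hY hB _; rewrite -XY.
have -> : fnorm (X b - Y b) = fnorm ((Y b)^t* *m X b - (Y a)^t* *m X a).
  have ub : (Y b)^t* *m Y b = 1%:M by apply: uY; rewrite ab lexx.
  have ua : (Y a)^t* *m Y a = 1%:M by apply: uY; rewrite lexx ab.
  rewrite XY ua -ub -mulmxBr fnorm_unitaryl; first by [].
  by rewrite adjmxK; exact: mulmx1C ub.
apply: (mpath_mean_value ab (mpathM (mpath_adj hY) hX) hw) => t ht.
apply: le_trans (h t ht); rewrite adjmxM (hB t ht).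
have ht' : a <= t <= b by case/andP: ht => *; rewrite !ltW.
rewrite mulmxN mulNmx addrC !mulmxA -mulmxBl -mulmxBr -mulmxA.
rewrite fnorm_unitaryl ?adjmxK; last exact: mulmx1C (uY t ht').
by rewrite fnorm_unitaryr; last exact: mulmx1C (uX t ht').
Qed.

Lemma flow_uniq a b X Y A : a <= b ->
  mpath a b X (fun t => A t *m X t) -> mpath a b Y (fun t => A t *m Y t) ->
  (forall t, a < t < b -> (A t)^t* = - A t) ->
  (X a)^t* *m X a = 1%:M -> X a = Y a -> X b = Y b.
Proof.
move=> ab hX hY hA h1 XY; apply/eqP; rewrite -subr_eq0; apply/eqP/fnorm_eq0/le_anti.
rewrite fnorm_ge0 andbT -(subrr (0 : R)).
apply: (flow_compare (w := fun=> 0) ab hX hY hA hA h1 XY (rpath_cst a b 0)) => t _.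
by rewrite subrr fnorm0.
Qed.

(** Time reflection about the midpoint turns an odd driving term into itself, so
    the reflected curve solves the same equation and agrees with X at the midpoint;
    by uniqueness the two ends of X coincide. *)
Lemma flow_return a b X A : a < b -> mpath a b X (fun t => A t *m X t) ->
  (forall t, a < t < b -> (A t)^t* = - A t) ->
  (forall t, a < t < b -> A (a + b - t) = - A t) ->
  (X a)^t* *m X a = 1%:M -> X b = X a.
Proof.
move=> ab hX hA hodd h1.
pose c := (a + b) / 2.
have ac : a < c by rewrite /c; lra.
have cb : c < b by rewrite /c; lra.
have hX' := mpath_sub hX (ltW ac) (lexx b).
have h2 t : c <= t <= b -> a <= (a + b) + (-1) * t <= b by rewrite /c => /andP[]; lra.
have h3 t : c < t < b -> a < (a + b) + (-1) * t < b by rewrite /c => /andP[]; lra.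
have sub t : c < t < b -> a < t < b by move=> /andP[q1 q2]; rewrite q2 (lt_trans ac q1).
have hW := mpath_affine hX h2 h3.
have hW' : mpath c b (fun t => X ((a + b) + (-1) * t))
    (fun t => A t *m X ((a + b) + (-1) * t)).
  apply: (mpath_eq hW) => t ht.
  by rewrite mulN1r hodd ?sub // rmorphN1 scaleN1r mulNmx opprK.
have := flow_uniq (ltW cb) hX' hW' (fun t ht => hA t (sub t ht)).
have -> : (a + b) + (-1) * c = c by rewrite /c; field.
have -> : (a + b) + (-1) * b = a by ring.
by apply=> //; apply: unitary_flow hX hA h1 _ _; rewrite !ltW.
Qed.

(** If D N = 0 then D = D (M - N) P, which is shorter than D unless D = 0. *)
Lemma near_unitmx (M P N : 'M[R[i]]_n) : M *m P = 1%:M ->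
  fnorm (N - M) * fnorm P < 1 -> N \in unitmx.
Proof.
move=> MP h; rewrite -row_free_unit -kermx_eq0; apply/eqP/fnorm_eq0.
set D := kermx N; have DN : D *m N = 0 by exact: mulmx_ker.
have e : D = D *m ((M - N) *m P).
  by rewrite mulmxA mulmxBr DN subr0 -mulmxA MP mulmx1.
have : fnorm D <= fnorm D * (fnorm (N - M) * fnorm P).
  rewrite {1}e fnorm_distC; apply: le_trans (fnormM _ _) _.
  by rewrite ler_wpM2l ?fnorm_ge0 // fnormM.
have := fnorm_ge0 D; rewrite le_eqVlt => /predU1P[//|d0].
by rewrite -subr_ge0 -{2}[fnorm D]mulr1 -mulrBr pmulr_rge0 // subr_ge0 leNgt h.
Qed.

End Flows.

(** * The Cayley coordinate of a unitary matrix *)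

Section Cayley.
Context {R : realType} {n : nat}.
Implicit Types Z P K H A : 'M[R[i]]_n.

(** This is (Z - 1) (Z + 1)^-1, written so that only the inverse depends on Z. *)
Definition cayley Z := 1%:M - 2%:C *: invmx (Z + 1%:M).
(** For K = cayley Z this is four times the feedback matrix Z (Z - 1) (Z + 1)^-3
    ([tangent_cayley]) and also the gradient of |K|^2 along Z' = H Z
    ([ip_cayley_velocity]); that the two agree is why the feedback works. *)
Definition tangent K := K - K *m K *m K.

Section At.
Variable Z : 'M[R[i]]_n.
Hypothesis uZ : Z^t* *m Z = 1%:M.
Hypothesis vZ : Z + 1%:M \in unitmx.
Local Notation P := (invmx (Z + 1%:M)).
Local Notation K := (cayley Z).

Lemma cayley_ZP : Z *m P = 1%:M - P.
Proof. by apply/eqP; rewrite eq_sym subr_eq -[X in _ + X]mul1mx -mulmxDl mulmxV. Qed.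

Lemma cayley_PZ : P *m Z = 1%:M - P.
Proof. by apply/eqP; rewrite eq_sym subr_eq -[X in _ + X]mulmx1 -mulmxDr mulVmx. Qed.

(** (Z + 1)^-1 and its adjoint Z (Z + 1)^-1 add up to 1. *)
Lemma cayley_skew : K^t* = - K.
Proof.
have Padj : P^t* = Z *m P.
  have h : P^t* *m (Z^t* + 1%:M) = 1%:M.
    have -> : Z^t* + 1%:M = (Z + 1%:M)^t* by rewrite adjmxD adjmx1.
    by rewrite -adjmxM mulmxV ?adjmx1.
  have : P^t* *m (Z + 1%:M) = Z.
    by rewrite -[RHS]mul1mx -[X in X *m Z]h -mulmxA mulmxDl uZ mul1mx addrC.
  by move/(congr1 (mulmx^~ P)); rewrite -mulmxA mulmxV // mulmx1.
rewrite /cayley adjmxD adjmxN adjmxZ adjmx1 Padj cayley_ZP scalerBr !opprB addrCA.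
congr (_ + _); rewrite -[X in X - _]scale1r -scalerBl -[RHS]scaleN1r; congr (_ *: _).
by apply: complex_eq => /=; ring.
Qed.

Lemma tangent_skew A : A^t* = - A -> (tangent A)^t* = - tangent A.
Proof.
move=> h; rewrite /tangent adjmxD adjmxN !adjmxM !h !(mulmxN, mulNmx, opprK) mulmxA.
by rewrite opprB addrC.
Qed.

(** <K, K - K^3> = |K|^2 + |K^2|^2 when K is skew-Hermitian, so K - K^3 can only
    be small when K is. *)
Lemma fnorm_le_tangent A : A^t* = - A -> fnorm A <= fnorm (tangent A).
Proof.
move=> h; have : fnorm A * fnorm A <= fnorm A * fnorm (tangent A).
  apply: le_trans (ip_le1 _ _); rewrite -expr2 fnorm_sqr /tangent ipBr lerBrDr -lerBrDl.
  rewrite subrr -oppr_ge0 -ipNr -mulmxN -h -ip_mull; exact: ip_ge0.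
have := fnorm_ge0 A; rewrite le_eqVlt => /predU1P[<- _|d0]; first exact: fnorm_ge0.
by rewrite ler_pM2l.
Qed.

(** With P = (Z + 1)^-1 one has Z P = 1 - P and K = 1 - 2 P, so both sides are the
    same polynomial in P. *)
Lemma tangent_cayley : Z *m (Z - 1%:M) *m P ^+ 3 = (4^-1)%:C *: tangent K.
Proof.
have ZZ : (Z - 1%:M) *m P = K.
  rewrite mulmxBl mul1mx cayley_ZP /cayley -addrA -opprD -[P in P + P]scale1r -scalerDl.
  by congr (_ - _ *: _); apply: complex_eq => /=; ring.
have PZ : P *m Z = Z *m P by rewrite cayley_PZ cayley_ZP.
have KKZ : 1%:M - K *m K = 4%:C *: (Z *m P *m P).
  rewrite cayley_ZP /cayley !(mulmxBl, mulmxBr, mul1mx, mulmx1) -!(scalemxAl, scalemxAr) scalerA.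
  apply/matrixP => i j; rewrite !mxE.
  have -> : 2%:C * 2%:C = 4%:C :> R[i] by apply: complex_eq => /=; ring.
  have -> : 4%:C = 2%:C + 2%:C :> R[i] by apply: complex_eq => /=; ring.
  ring.
have -> : tangent K = K *m (1%:M - K *m K) by rewrite mulmxBr mulmx1 mulmxA.
have -> : P ^+ 3 = P *m (P *m P) by rewrite exprS expr2.
have ZK : Z *m K = K *m Z.
  by rewrite /cayley mulmxBl mulmxBr mul1mx mulmx1 -scalemxAl -scalemxAr PZ.
rewrite KKZ -scalemxAr scalerA -mulmxA [(Z - _) *m _]mulmxA ZZ !mulmxA ZK.
have -> : (4^-1)%:C * 4%:C = 1 :> R[i] by rewrite -rmorphM /= mulVf ?pnatr_eq0.
by rewrite scale1r.
Qed.

Lemma cayley_invE : P = (2^-1)%:C *: (1%:M - K).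
Proof.
rewrite /cayley opprB addrCA subrr addr0 scalerA -rmorphM /= mulVf ?pnatr_eq0 //.
by rewrite scale1r.
Qed.

(** A bound on K keeps Z + 1 away from the singular matrices. *)
Lemma fnorm_cayley_inv : fnorm P <= (fnorm (1%:M : 'M[R[i]]_n) + fnorm K) / 2.
Proof.
rewrite {1}cayley_invE fnormZ ger0_norm ?invr_ge0 // mulrC ler_pM2r ?invr_gt0 //.
exact: fnormB.
Qed.

(** The left-hand side is the velocity of K when Z' = H Z. *)
Lemma cayley_velocity H : 2%:C *: (P *m (H *m Z) *m P) =
  (2^-1)%:C *: ((1%:M - K) *m H *m (1%:M + K)).
Proof.
have -> : 1%:M - K = 2%:C *: P by rewrite /cayley opprB addrCA subrr addr0.
have -> : 1%:M + K = 2%:C *: (Z *m P).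
  rewrite cayley_ZP scalerBr /cayley addrA; congr (_ - _).
  have -> : 2%:C = 1 + 1 :> R[i] by apply: complex_eq => /=; ring.
  by rewrite scalerDl scale1r.
rewrite -!(scalemxAl, scalemxAr) !scalerA !mulmxA; congr (_ *: _).
by apply: complex_eq => /=; field.
Qed.

(** This is the derivative of |K|^2 along Z' = H Z. *)
Lemma ip_cayley_velocity H :
  2 * ip K (2%:C *: (P *m (H *m Z) *m P)) = ip (tangent K) H.
Proof.
rewrite cayley_velocity ipZr mulrA divff ?pnatr_eq0 // mul1r.
have K1 : (1%:M - K)^t* = 1%:M + K by rewrite adjmxD adjmxN adjmx1 cayley_skew opprK.
have K2 : (1%:M + K)^t* = 1%:M - K by rewrite adjmxD adjmx1 cayley_skew.
rewrite ip_rmull ip_rmulr K1 K2; congr ip.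
rewrite /tangent; move: (cayley Z) => k.
rewrite mulmxBr mulmx1 mulmxDl mul1mx mulmxBr mulmxA.
by rewrite addrA subrK.
Qed.

Lemma fnorm_cayley_velocity H : 
  fnorm (2%:C *: (P *m (H *m Z) *m P)) <= (1 + fnorm K) ^+ 2 / 2 * fnorm H.
Proof.
rewrite cayley_velocity fnormZ ger0_norm ?invr_ge0 // [leRHS]mulrAC mulrC ler_pM2r ?invr_gt0 //.
have h : fnorm (H *m (1%:M + K)) <= fnorm H * (1 + fnorm K).
  rewrite mulmxDr mulmx1 mulrDr mulr1; apply: le_trans (fnormD _ _) _.
  by rewrite lerD2l fnormM.
rewrite -mulmxA mulmxBl mul1mx; apply: le_trans (fnormB _ _) _.
apply: (@le_trans _ _ ((1 + fnorm K) * fnorm (H *m (1%:M + K)))).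
  by rewrite mulrDl mul1r lerD2l fnormM.
by rewrite expr2 -mulrA ler_wpM2l ?addr_ge0 ?fnorm_ge0 // mulrC.
Qed.

End At.
End Cayley.

(** * The closed loop in the Cayley coordinate *)

Section ClosedLoop.
Context {R : realType} {n m : nat}.
Variables (S : 'I_m -> 'M[R[i]]_n) (f : 'I_m -> R) (U X Y : R -> 'M[R[i]]_n).
Hypothesis hS : forall k, (S k)^t* = - S k.
Hypothesis hf : forall k, 0 < f k.
Hypothesis hU : forall t, (U t)^t* = - U t.

Definition error (t : R) := (Y t)^t* *m X t.
(** The correction that the feedback adds to the reference control. *)
Definition gain k (t : R) : R := f k * Re (\tr (X t *m (error t - 1%:M) *m
   (invmx (error t + 1%:M)) ^+ 3 *m (Y t)^t* *m S k)).

Hypothesis hY : forall b, mpath 0 b Y (fun t => U t *m Y t).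
Hypothesis hX : forall b, mpath 0 b X
  (fun t => (U t + \sum_k (gain k t)%:C *: S k) *m X t).
Hypothesis uY0 : (Y 0)^t* *m Y 0 = 1%:M.
Hypothesis uX0 : (X 0)^t* *m X 0 = 1%:M.
Hypothesis v0 : error 0 + 1%:M \in unitmx.

Lemma skew_comb (c : 'I_m -> R) : (\sum_k (c k)%:C *: S k)^t* = - \sum_k (c k)%:C *: S k.
Proof.
rewrite raddf_sum map_mx_sum -sumrN; apply: eq_bigr => k _.
by rewrite adjmxZ hS scalerN.
Qed.

Let A t := U t + \sum_k (gain k t)%:C *: S k.
Let hA t : (A t)^t* = - A t.
Proof. by rewrite adjmxD hU skew_comb opprD. Qed.

Lemma reference_unitary t : 0 <= t -> (Y t)^t* *m Y t = 1%:M.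
Proof. by move=> t0; apply: (unitary_flow (hY t) (fun s _ => hU s) uY0); rewrite t0 lexx. Qed.

Lemma state_unitary t : 0 <= t -> (X t)^t* *m X t = 1%:M.
Proof. by move=> t0; apply: (unitary_flow (hX t) (fun s _ => hA s) uX0); rewrite t0 lexx. Qed.

Lemma state_error t : 0 <= t -> X t = Y t *m error t.
Proof. by move=> t0; rewrite mulmxA (mulmx1C (reference_unitary t0)) mul1mx. Qed.

Lemma error_unitary t : 0 <= t -> (error t)^t* *m error t = 1%:M.
Proof.
move=> t0; rewrite /error adjmxM adjmxK mulmxA -(mulmxA _ (Y t)).
by rewrite (mulmx1C (reference_unitary t0)) mulmx1 state_unitary.
Qed.

(** The generator seen from the moving frame of the reference: the error obeys
    Z' = H Z where H combines these matrices with the gains as coefficients. *)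
Definition moved k (t : R) := (Y t)^t* *m S k *m Y t.
Definition error_coord t := cayley (error t).
(** The derivative of |K|^2 when the error moves along the k-th transported
    generator ([ip_cayley_velocity]). *)
Definition output k (t : R) := ip (tangent (error_coord t)) (moved k t).

Lemma fnorm_moved k t : 0 <= t -> fnorm (moved k t) = fnorm (S k).
Proof.
move=> t0; rewrite /moved -mulmxA fnorm_unitaryl ?adjmxK; last exact: mulmx1C (reference_unitary t0).
by rewrite fnorm_unitaryr // (mulmx1C (reference_unitary t0)).
Qed.

(** The feedback is a descent direction: each gain opposes the derivative of
    |K|^2 in its own direction. *)
Lemma gainE k t : 0 <= t -> error t + 1%:M \in unitmx ->
  gain k t = - (f k / 4 * output k t).
Proof.
move=> t0 ut; have h := tangent_cayley ut.
set W := (error t - 1%:M) in h; set P := (invmx (error t + 1%:M) ^+ 3) in h.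
rewrite /gain -/W -/P {1}(state_error t0) -(mulmxA (Y t)) -(mulmxA (Y t)) h.
rewrite -(mulmxA (Y t)) -(mulmxA (Y t)) mxtrace_mulC -scalemxAl -!scalemxAl mxtraceZ cReMr.
rewrite /output /ip tangent_skew ?cayley_skew ?error_unitary // mulNmx raddfN.
rewrite /moved !mulmxA.
set z := \tr _; rewrite (_ : Re (- z) = - Re z); last by case: z.
by field.
Qed.

Let H t := \sum_k (gain k t)%:C *: moved k t.

Lemma error_path b : mpath 0 b error (fun t => H t *m error t).
Proof.
apply: (mpath_eq (mpathM (mpath_adj (hY b)) (hX b))) => t /andP[/ltW t0 _].
rewrite adjmxM hU mulmxN mulNmx !mulmxA mulmxDr mulmxDl addrA addNr add0r.
congr (_ *m _).
rewrite mulmx_sumr mulmx_suml /H; apply: eq_bigr => k _.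
rewrite -scalemxAr -scalemxAl; congr (_ *: _).
by rewrite /moved -[RHS]mulmxA (mulmx1C (reference_unitary t0)) mulmx1.
Qed.

Definition error_dcoord t : 'M[R[i]]_n :=
  2%:C *: (invmx (error t + 1%:M) *m (H t *m error t) *m invmx (error t + 1%:M)).

Section Interval.
Variables a b : R.
Hypothesis a0 : 0 <= a.
Hypothesis reg : forall t, a <= t <= b -> error t + 1%:M \in unitmx.

Lemma coord_path_on : mpath a b error_coord error_dcoord.
Proof.
have h1 := mpathD (mpath_sub (error_path b) a0 (lexx b)) (mpath_cst a b 1%:M).
have h2 := mpathB (mpath_cst a b (1%:M : 'M[R[i]]_n)) (mpathZ 2%:C (mpathV h1 reg)).
apply: (mpath_eq h2) => t _.
by rewrite addr0 sub0r scalerN opprK.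
Qed.

(** By [gainE] each direction contributes a negative square. *)
Lemma lyapunov_path_on : rpath a b (fun t => ip (error_coord t) (error_coord t))
  (fun t => - \sum_k f k / 4 * output k t ^+ 2).
Proof.
apply: (rpath_eq (rpath_ip coord_path_on coord_path_on)) => t /andP[ta tb].
have t0 := ltW (le_lt_trans a0 ta).
have ut : error t + 1%:M \in unitmx by apply: reg; rewrite !ltW.
transitivity (2 * ip (error_coord t) (error_dcoord t)); first by rewrite (ipC (error_dcoord t)); ring.
rewrite [LHS](ip_cayley_velocity (error_unitary t0) ut) ip_sumr -sumrN; apply: eq_bigr => k _.
rewrite ipZr gainE // -/(error_coord t) -/(output k t); ring.
Qed.

Lemma fnorm_error_dcoord t : a < t < b -> fnorm (error_dcoord t) <=
  (1 + fnorm (error_coord t)) ^+ 2 / 2 * \sum_k f k / 4 * `|output k t| * fnorm (S k).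
Proof.
move=> /andP[ta tb].
have t0 := ltW (le_lt_trans a0 ta).
have ut : error t + 1%:M \in unitmx by apply: reg; rewrite !ltW.
apply: (le_trans (fnorm_cayley_velocity ut (H t))).
apply: ler_wpM2l; first by rewrite divr_ge0 ?sqr_ge0.
apply: le_trans (fnorm_sum _ _ _) _; apply: ler_sum => k _.
rewrite fnormZ fnorm_moved // gainE // normrN normrM ger0_norm //.
by rewrite divr_ge0 // ltW.
Qed.

Lemma lyapunov_le_on t : a <= t <= b -> ip (error_coord t) (error_coord t) <= ip (error_coord a) (error_coord a).
Proof.
move=> /andP[ta tb].
apply: (rpath_le ta (rpath_sub lyapunov_path_on (lexx a) tb)) => s _.
rewrite oppr_le0; apply: sumr_ge0 => k _.
by rewrite mulr_ge0 ?sqr_ge0 // divr_ge0 // ltW.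
Qed.

End Interval.

(** Continuation. As long as Z + 1 stays invertible, |K| does not increase, hence
    (Z + 1)^-1 stays bounded by a fixed c ([fnorm_cayley_inv]); by [near_unitmx] the
    set of good times is then closed and open. *)
Lemma error_regular t : 0 <= t -> error t + 1%:M \in unitmx.
Proof.
move=> t0; case: (boolP (error t + 1%:M \in unitmx)) => // bad; exfalso.
pose good s := forall r, 0 <= r <= s -> error r + 1%:M \in unitmx.
pose E := [set s | 0 <= s <= t /\ good s].
have E0 : E 0.
  split; first by rewrite lexx.
  by move=> r; rewrite andbC => /le_anti ->.
have Eub : has_ubound E by exists t => s [/andP[]].
have Esup : has_sup E by split; [exists 0|].
pose s := sup E.
have s0 : 0 <= s by apply: ub_le_sup.
have st : s <= t by apply: sup_le_ub => [|r [/andP[]]//]; exists 0.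
pose c := (fnorm (1%:M : 'M[R[i]]_n) + fnorm (error_coord 0)) / 2.
have c0 : 0 <= c by rewrite divr_ge0 ?addr_ge0 ?fnorm_ge0.
have below r : 0 <= r < s -> error r + 1%:M \in unitmx.
  move=> /andP[r0 rs].
  have [q [_ gq] rq] := sup_gt Esup.1 rs.
  by apply: gq; rewrite r0 ltW.
have bound r : 0 <= r -> good r -> fnorm (invmx (error r + 1%:M)) <= c.
  move=> r0 gr.
  have ur : error r + 1%:M \in unitmx by apply: gr; rewrite r0 lexx.
  have h : fnorm (error_coord r) <= fnorm (error_coord 0).
    apply: fnorm_le; first exact: fnorm_ge0.
    by rewrite fnorm_sqr; apply: (lyapunov_le_on (lexx 0) gr); rewrite r0 lexx.
  have i2 : 0 <= 2^-1 :> R by rewrite invr_ge0.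
  exact: le_trans (fnorm_cayley_inv (error r)) (ler_wpM2r i2 (lerD (lexx _) h)).
have near (M N : 'M[R[i]]_n) : M - N = (M + 1%:M) - (N + 1%:M).
  by rewrite opprD addrACA subrr addr0.
have c1 : 0 < (c + 1)^-1 by rewrite invr_gt0 ltr_wpDl.
have close (M N : 'M[R[i]]_n) : N + 1%:M \in unitmx -> fnorm (invmx (N + 1%:M)) <= c ->
    fnorm (M - N) < (c + 1)^-1 -> M + 1%:M \in unitmx.
  move=> uN bN d; apply: (near_unitmx (mulmxV uN)); rewrite -near.
  apply: (@le_lt_trans _ _ ((c + 1)^-1 * c)).
    by rewrite ler_pM ?fnorm_ge0 // ltW.
  by rewrite mulrC ltr_pdivrMr ?mul1r ?ltrDl // ltr_wpDl.
have us : error s + 1%:M \in unitmx.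
  move: s0; rewrite le_eqVlt => /predU1P[<-//|s0].
  have [d d0 hd] := mpath_near_right s0 (error_path s) c1.
  (* A time before s, close enough to s for [close] to carry invertibility over. *)
  pose r := Num.max 0 (s - d / 2).
  have rs : r < s by rewrite /r gt_max s0 gtrBl divr_gt0.
  have r0 : 0 <= r by rewrite /r le_max lexx.
  have gr : good r by move=> q /andP[q0 qr]; apply: below; rewrite q0 (le_lt_trans qr).
  apply: (close _ (error r)); [by apply: gr; rewrite r0 lexx|exact: bound|].
  rewrite fnorm_distC; apply: hd; first by rewrite r0 ltW.
  rewrite ltr0_norm ?subr_lt0 // opprB /r.
  have : s - d / 2 <= r by rewrite /r le_max lexx orbT.
  rewrite -/r; lra.
have gs : good s.
  move=> r /andP[r0]; rewrite le_eqVlt => /predU1P[->//|rs].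
  by apply: below; rewrite r0.
have s1 : s < s + 1 by rewrite ltrDl.
have [d d0 hd] := mpath_near_left s1 (mpath_sub (error_path (s + 1)) s0 (lexx _)) c1.
pose e := Num.min (d / 2) 1.
have e0 : 0 < e by rewrite /e lt_min divr_gt0 //=.
have ed : e < d by rewrite /e gt_min; apply/orP; left; lra.
have e1 : e <= 1 by rewrite /e ge_min lexx orbT.
have ahead r : s <= r <= s + e -> error r + 1%:M \in unitmx.
  move=> /andP[sr re]; apply: (close _ (error s)) => //; first exact: bound.
  apply: hd; first by rewrite sr; lra.
  by rewrite ger0_norm; lra.
have ge : good (s + e).
  move=> r /andP[r0 re]; case: (lerP r s) => rs; first by apply: gs; rewrite r0.
  by apply: ahead; rewrite (ltW rs).
have [te|te] := leP t (s + e).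
  by case/negP: bad; apply: ge; rewrite t0.
have : E (s + e) by split=> //; rewrite (ltW te) addr_ge0 // ltW.
move=> /(ub_le_sup Eub) h; suff : e <= 0 by rewrite leNgt e0.
by rewrite -(gerDl s).
Qed.

Lemma coord_path b : mpath 0 b error_coord error_dcoord.
Proof. by apply: (coord_path_on (lexx 0)) => t /andP[t0 _]; exact: error_regular. Qed.

Lemma coord_skew t : 0 <= t -> (error_coord t)^t* = - error_coord t.
Proof. by move=> t0; apply: cayley_skew; [exact: error_unitary|exact: error_regular]. Qed.

Lemma lyapunov_path b : rpath 0 b (fun t => ip (error_coord t) (error_coord t))
  (fun t => - \sum_k f k / 4 * output k t ^+ 2).
Proof. by apply: (lyapunov_path_on (lexx 0)) => t /andP[t0 _]; exact: error_regular. Qed.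

Lemma lyapunov_le s t : 0 <= s <= t -> ip (error_coord t) (error_coord t) <= ip (error_coord s) (error_coord s).
Proof.
move=> /andP[s0 st].
have reg r : s <= r <= t -> error r + 1%:M \in unitmx.
  by move=> /andP[sr _]; apply: error_regular; exact: le_trans sr.
by apply: (lyapunov_le_on s0 reg); rewrite st lexx.
Qed.

(** Z - 1 = K (Z + 1), so the error tends to 1 when K tends to 0. *)
Lemma fnorm_error1 t : 0 <= t -> fnorm (error t - 1%:M) <= fnorm (error_coord t) * (fnorm (1%:M : 'M[R[i]]_n) *+ 2).
Proof.
move=> t0.
have -> : error t - 1%:M = error_coord t *m (error t + 1%:M).
  rewrite /error_coord /cayley mulmxBl mul1mx -scalemxAl mulVmx ?error_regular //.
  have -> : 2%:C = 1 + 1 :> R[i] by apply: complex_eq => /=; ring.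
  by rewrite scalerDl scale1r addrKA.
apply: le_trans (fnormM _ _) _; rewrite ler_wpM2l ?fnorm_ge0 // mulr2n.
apply: le_trans (fnormD _ _) _; rewrite lerD2r.
by rewrite -[error t]mulmx1 fnorm_unitaryl ?error_unitary.
Qed.

End ClosedLoop.

(** * Quantitative decrease of the Lyapunov function *)

Section Drop.
Context {R : realType} {n : nat}.
Implicit Types A B P Q : 'M[R[i]]_n.

Lemma fnorm_tangent_sub A B (c : R) : 0 <= c -> fnorm A <= c -> fnorm B <= c ->
  fnorm (tangent A - tangent B) <= (1 + 3 * c ^+ 2) * fnorm (A - B).
Proof.
move=> c0 hA hB.
have e : tangent A - tangent B = (A - B) - (((A - B) *m (A *m A) + B *m ((A - B) *m A))
    + (B *m B) *m (A - B)).
  have -> : ((A - B) *m (A *m A) + B *m ((A - B) *m A)) + (B *m B) *m (A - B) =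
      A *m A *m A - B *m B *m B.
    rewrite !(mulmxBl, mulmxBr) !mulmxA.
    by rewrite !addrA !subrK.
  by rewrite /tangent !opprB addrACA [RHS]addrACA (addrC (- B)).
have h1 : fnorm ((A - B) *m (A *m A)) <= c ^+ 2 * fnorm (A - B).
  apply: le_trans (fnormM _ _) _; rewrite mulrC ler_wpM2r ?fnorm_ge0 //.
  by apply: le_trans (fnormM _ _) _; rewrite expr2 ler_pM ?fnorm_ge0.
have h2 : fnorm (B *m ((A - B) *m A)) <= c ^+ 2 * fnorm (A - B).
  apply: le_trans (fnormM _ _) _; apply: le_trans (ler_pM (fnorm_ge0 _) (fnorm_ge0 _) hB (fnormM _ _)) _.
  by rewrite expr2 -mulrA ler_wpM2l // mulrC ler_wpM2r ?fnorm_ge0.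
have h3 : fnorm ((B *m B) *m (A - B)) <= c ^+ 2 * fnorm (A - B).
  apply: le_trans (fnormM _ _) _; rewrite ler_wpM2r ?fnorm_ge0 //.
  by apply: le_trans (fnormM _ _) _; rewrite expr2 ler_pM ?fnorm_ge0.
rewrite e; apply: le_trans (fnormB _ _) _; rewrite mulrDl mul1r lerD2l.
apply: le_trans (fnormD _ _) _; apply: le_trans (lerD (fnormD _ _) (lexx _)) _.
apply: le_trans (lerD (lerD h1 h2) h3) _.
by rewrite -mulrA; move: (c ^+ 2 * fnorm (A - B)) => y; clear; lra.
Qed.

Lemma fnorm_tangent_le A (c : R) : 0 <= c -> fnorm A <= c -> fnorm (tangent A) <= c + c ^+ 3.
Proof.
move=> c0 h; apply: le_trans (fnormB _ _) (lerD h _).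
rewrite !exprS expr0 mulr1 mulrA.
apply: le_trans (fnormM _ _) _; rewrite ler_pM ?fnorm_ge0 //.
by apply: le_trans (fnormM _ _) _; rewrite ler_pM ?fnorm_ge0.
Qed.

Lemma fnorm_conj_sub P Q A : P^t* *m P = 1%:M -> Q^t* *m Q = 1%:M ->
  fnorm (P^t* *m A *m P - Q^t* *m A *m Q) <= 2 * fnorm A * fnorm (P - Q).
Proof.
move=> uP uQ.
have -> : P^t* *m A *m P - Q^t* *m A *m Q =
    P^t* *m (A *m (P - Q)) + (P - Q)^t* *m A *m Q.
  by rewrite adjmxD adjmxN mulmxBr mulmxBr !mulmxBl !mulmxA addrA subrK.
apply: le_trans (fnormD _ _) _.
rewrite (fnorm_unitaryr _ (mulmx1C uQ)) fnorm_unitaryl; last by rewrite adjmxK (mulmx1C uP).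
rewrite mulr2n !mulrDl !mul1r; apply: lerD; first exact: fnormM.
by apply: le_trans (fnormM _ _) _; rewrite fnorm_adj mulrC.
Qed.

Lemma ip_telescope A A' B B' B'' :
  ip A B = ip A' B'' + ip (A - A') B'' + ip A (B - B') + ip A (B' - B'').
Proof.
have alg (a b c d : R) : c = a + (b - a) + (c - d) + (d - b) by ring.
by rewrite ipBl !ipBr -alg.
Qed.

End Drop.

Lemma primitive_gap {R : realType} (c g e u v x y : R) :
  c * (g * e * v - e^-1 * y) - c * (g * e * u - e^-1 * x) =
  c * (g * e * (v - u) + (x - y) / e).
Proof. ring. Qed.

Lemma half_sqr_le {R : realType} (x y : R) : 0 <= x -> x <= y ->
  (1 + x) ^+ 2 / 2 <= (1 + y) ^+ 2 / 2.
Proof. by move=> x0 xy; nra. Qed.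

(** Each constant makes one quarter of q out of the term it controls; the divisors
    carry an extra 1 because the factors may vanish, and d an extra factor eta. *)
Lemma sample_constants {R : realType} (A F L g T q : R) :
  0 <= A -> 0 <= F -> 0 <= L -> 0 <= g -> 0 <= T -> 0 < q ->
  exists e eta d rho : R, [/\ 0 < e, 0 < eta, 0 < d, 0 < rho &
    e + A * (F * eta * L + d / eta) + g * (rho * T) + g * e <= q].
Proof.
move=> A0 F0 L0 g0 T0 q0.
have small a : 0 <= a -> 0 < q / (4 * (a + 1)) /\ a * (q / (4 * (a + 1))) <= q / 4.
  move=> a0; have a1 : 0 < a + 1 by rewrite ltr_wpDl.
  split; first by rewrite divr_gt0 // mulr_gt0.
  rewrite mulrA ler_pdivrMr ?mulr_gt0 //.
  rewrite [leRHS](_ : _ = q * (a + 1)); last by field.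
  by rewrite mulrC ler_pM2l // lerDl.
have [e0 _] := small g g0.
have AFL0 : 0 <= A * F * L by rewrite !mulr_ge0.
have [eta0 eta1] := small _ AFL0.
have [b0 b1] := small A A0.
have gT0 : 0 <= g * T by rewrite mulr_ge0.
have [rho0 rho1] := small _ gT0.
exists (q / (4 * (g + 1))), (q / (4 * (A * F * L + 1))),
  (q / (4 * (A * F * L + 1)) * (q / (4 * (A + 1)))), (q / (4 * (g * T + 1))).
split=> //; first exact: mulr_gt0.
have : q / (4 * (g + 1)) + g * (q / (4 * (g + 1))) = q / 4.
  by field; rewrite gt_eqF // ltr_wpDl.
move: eta0 eta1 b0 b1 rho0 rho1.
move: (q / (4 * (A * F * L + 1))) (q / (4 * (A + 1))) (q / (4 * (g * T + 1))) (q / (4 * (g + 1))) => x y z w.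
move=> x0 x1 y0 y1 z0 z1 he.
rewrite [x * y / x]mulrAC divff ?gt_eqF // mul1r mulrDr.
have -> : A * (F * x * L) = A * F * L * x by ring.
have -> : g * (z * T) = g * T * z by ring.
move: (A * F * L * x) (A * y) (g * T * z) (g * w) x1 y1 z1 he => a b c d; clear; lra.
Qed.

Lemma half_window {R : realType} (h t T : R) : h <= (T - t) / 2 -> t < T -> t + h <= T.
Proof. by lra. Qed.

Lemma norm_sum4 {R : realType} (x y z w a b c d : R) :
  `|x| <= a -> `|y| <= b -> `|z| <= d -> `|w| <= c -> `|x + y + z + w| <= a + b + c + d.
Proof.
move=> xa yb zd wc; rewrite [leRHS]addrAC.
apply: le_trans (ler_normD _ _) (lerD _ wc).
apply: le_trans (ler_normD _ _) (lerD _ zd).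
exact: le_trans (ler_normD _ _) (lerD xa yb).
Qed.

Section Loops.
Context {R : realType} {n m : nat}.
Variables (S : 'I_m -> 'M[R[i]]_n) (f : 'I_m -> R) (T : R) (Xg : 'M[R[i]]_n).
Hypothesis hS : forall k, (S k)^t* = - S k.
Hypothesis hf : forall k, 0 < f k.
Hypothesis T0 : 0 < T.
Hypothesis uXg : Xg^t* *m Xg = 1%:M.
Hypothesis vXg : Xg + 1%:M \in unitmx.

(** The closed loop for an arbitrary skew-Hermitian reference field U, which makes
    the analysis below independent of the shape of the reference controls. *)
Definition closed_loop (U X Y : R -> 'M[R[i]]_n) : Prop :=
  [/\ forall t, (U t)^t* = - U t,
      Y 0 = Xg, X 0 = 1%:M,
      forall b, mpath 0 b Y (fun t => U t *m Y t)
    & forall b, mpath 0 b X (fun t => (U t + \sum_k (gain S f X Y k t)%:C *: S k) *m X t)].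

Definition lyap (X Y : R -> 'M[R[i]]_n) (t : R) : R := ip (error_coord X Y t) (error_coord X Y t).

Let kappa : R := fnorm (cayley (Xg^t*)).

Section Fixed.
Variables U X Y : R -> 'M[R[i]]_n.
Hypothesis h : closed_loop U X Y.

Lemma loop_uY0 : (Y 0)^t* *m Y 0 = 1%:M. Proof. by case: h => _ -> _ _ _. Qed.

Lemma loop_uX0 : (X 0)^t* *m X 0 = 1%:M.
Proof. by case: h => _ _ -> _ _; rewrite adjmx1 mul1mx. Qed.

Lemma loop_error0 : error X Y 0 = Xg^t*.
Proof. by rewrite /error; case: h => _ -> -> _ _; rewrite mulmx1. Qed.

Lemma loop_v0 : error X Y 0 + 1%:M \in unitmx.
Proof.
rewrite loop_error0 (_ : _ + _ = Xg^t* *m (Xg + 1%:M)); last first.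
  by rewrite mulmxDr uXg mulmx1 addrC.
by rewrite unitmx_mul vXg andbT; case: (mulmx1_unit uXg).
Qed.

Let hU := let: And5 h _ _ _ _ := h in h.
Let hY := let: And5 _ _ _ h _ := h in h.
Let hX := let: And5 _ _ _ _ h := h in h.

Lemma loop_unitary t : 0 <= t -> (Y t)^t* *m Y t = 1%:M.
Proof. exact: (reference_unitary hU hY loop_uY0). Qed.

Lemma loop_coord_skew t : 0 <= t -> (error_coord X Y t)^t* = - error_coord X Y t.
Proof. exact: (coord_skew hS hf hU hY hX loop_uY0 loop_uX0 loop_v0). Qed.

Lemma loop_lyap_le s t : 0 <= s <= t -> lyap X Y t <= lyap X Y s.
Proof. exact: (lyapunov_le hS hf hU hY hX loop_uY0 loop_uX0 loop_v0). Qed.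

Lemma loop_lyap_path b : rpath 0 b (lyap X Y)
  (fun t => - \sum_k f k / 4 * output S X Y k t ^+ 2).
Proof. exact: (lyapunov_path hS hf hU hY hX loop_uY0 loop_uX0 loop_v0). Qed.

Lemma loop_coord_le t : 0 <= t -> fnorm (error_coord X Y t) <= kappa.
Proof.
move=> t0; apply: fnorm_le; first exact: fnorm_ge0.
by rewrite fnorm_sqr -loop_error0; apply: loop_lyap_le; rewrite lexx.
Qed.

Lemma loop_fnorm_moved k t : 0 <= t -> fnorm (moved S Y k t) = fnorm (S k).
Proof. exact: (fnorm_moved S hU hY loop_uY0). Qed.

Lemma loop_fnorm_error t : 0 <= t -> fnorm (error X Y t - 1%:M) <= fnorm (error_coord X Y t) * (fnorm (1%:M : 'M[R[i]]_n) *+ 2).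
Proof. exact: (fnorm_error1 hS hf hU hY hX loop_uY0 loop_uX0 loop_v0). Qed.

(** If |K|^2 hardly decreases then K hardly moves: the speed of K is controlled by
    the outputs tau_k, the decrease of |K|^2 by their squares, and
    |tau| <= eta + tau^2 / eta trades one for the other. *)
Lemma loop_coord_dist (eta sigma s t : R) : 0 < eta -> 0 <= sigma -> (forall k, fnorm (S k) <= sigma) ->
  0 <= s <= t ->
  fnorm (error_coord X Y t - error_coord X Y s) <=
  (1 + kappa) ^+ 2 / 2 * sigma *
    ((\sum_k f k / 4) * eta * (t - s) + (lyap X Y s - lyap X Y t) / eta).
Proof.
move=> e0 sig0 hs /andP[s0 st].
set C := (1 + kappa) ^+ 2 / 2 * sigma; set F := \sum_k _.
have hw := rpathZ C (rpathB (rpathZ (F * eta) (rpath_derive s t (fun u => is_derive_id u 1)))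
   (rpathZ eta^-1 (rpath_sub (loop_lyap_path t) s0 (lexx t)))).
have hK := mpath_sub (coord_path hS hf hU hY hX loop_uY0 loop_uX0 loop_v0 t) s0 (lexx t).
apply: (le_trans (mpath_mean_value st hK hw _)); last first.
  by rewrite primitive_gap.
move=> u /andP[su ut]; have u0 := ltW (le_lt_trans s0 su).
have reg r : s <= r <= t -> error X Y r + 1%:M \in unitmx.
  move=> /andP[sr _]; apply: (error_regular hS hf hU hY hX loop_uY0 loop_uX0 loop_v0).
  exact: le_trans sr.
apply: le_trans (fnorm_error_dcoord hS hf hU hY hX loop_uY0 loop_uX0 s0 reg _) _.
  by rewrite su.
have k0 : 0 <= kappa by exact: fnorm_ge0.
have -> : C * (F * eta * 1 - eta^-1 * - \sum_k f k / 4 * output S X Y k u ^+ 2) =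
    (1 + kappa) ^+ 2 / 2 * \sum_k f k / 4 * (eta + eta^-1 * output S X Y k u ^+ 2) * sigma.
  rewrite /C -mulrA; congr (_ * _); rewrite -mulr_suml [LHS]mulrC; congr (_ * _).
  rewrite mulrN opprK mulr1 /F mulr_suml mulr_sumr -big_split; apply: eq_bigr => k _ /=.
  by rewrite mulrDr mulrCA.
apply: ler_pM.
- by rewrite divr_ge0 // sqr_ge0.
- apply: sumr_ge0 => k _; apply: mulr_ge0; last exact: fnorm_ge0.
  by rewrite mulr_ge0 // divr_ge0 // ltW.
- exact: half_sqr_le (fnorm_ge0 _) (loop_coord_le u0).
apply: ler_sum => k _; apply: ler_pM; [|exact: fnorm_ge0| |exact: hs].
  by rewrite mulr_ge0 // divr_ge0 // ltW.
apply: ler_wpM2l; first by rewrite divr_ge0 // ltW.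
move: (output _ _ _ _ _) => x.
have [xe|xe] := leP `|x| eta.
  by apply: le_trans xe _; rewrite lerDl mulr_ge0 ?invr_ge0 ?sqr_ge0 // ltW.
apply: (@le_trans _ _ (eta^-1 * x ^+ 2)); last by rewrite lerDr ltW.
by rewrite mulrC ler_pdivlMr // -real_normK ?num_real // expr2 ler_wpM2l // ltW.
Qed.

Lemma loop_tangent_dist s t : 0 <= s -> 0 <= t ->
  fnorm (tangent (error_coord X Y t) - tangent (error_coord X Y s)) <=
  (1 + 3 * kappa ^+ 2) * fnorm (error_coord X Y t - error_coord X Y s).
Proof. by move=> s0 t0; apply: fnorm_tangent_sub; rewrite ?loop_coord_le //; exact: fnorm_ge0. Qed.

(** Mean value theorem for |K|^2: a small decrease on a window forces a small
    output somewhere in it. *)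
Lemma loop_small_output k a h0 e : 0 <= a -> 0 < h0 -> 0 <= e ->
  lyap X Y a - lyap X Y (a + h0) <= f k / 4 * e ^+ 2 * h0 ->
  exists2 x, a < x < a + h0 & `|output S X Y k x| <= e.
Proof.
move=> a0 h00 e0 hd.
have ab : a < a + h0 by rewrite ltrDl.
have [c hc E] := rpath_MVT ab (rpath_sub (loop_lyap_path (a + h0)) a0 (lexx _)).
exists c => //.
rewrite -(@ler_pXn2r _ 2) ?nnegrE // real_normK ?num_real //.
rewrite -(@ler_pM2l _ (f k / 4 * h0)) ?mulr_gt0 ?invr_gt0 //.
rewrite [leRHS]mulrAC; apply: le_trans hd.
rewrite -opprB E (addrC a) addrK mulNr opprK mulrAC ler_pM2r //.
rewrite (bigD1 k) //= lerDl; apply: sumr_ge0 => l _.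
by rewrite mulr_ge0 ?sqr_ge0 // divr_ge0 // ltW.
Qed.

End Fixed.
(** Suppose |K|^2 decreases very little between s and s + Lam, while during the
    period starting at p the reference follows Yi closely. By [loop_small_output]
    the output is small at some time just after p + ti. There K is still close to
    its value at s ([loop_coord_dist]), and the transported generator is close to
    the one of Yi at ti, so the pairing of these two fixed matrices is small. *)
Lemma sample_small (Ui Yi : R -> 'M[R[i]]_n) (ti Lam : R) (k : 'I_m) :
  mpath 0 T Yi (fun t => Ui t *m Yi t) ->
  (forall t, 0 < t < T -> (Ui t)^t* = - Ui t) -> Yi 0 = Xg -> 0 <= ti < T -> 0 <= Lam ->
  forall q, 0 < q -> exists delta rho : R, [/\ 0 < delta, 0 < rho &
    forall U X Y s p, closed_loop U X Y -> 0 <= s -> s <= p -> p + T <= s + Lam ->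
      Y p = Xg -> (forall r, 0 < r < T -> fnorm (U (p + r) - Ui r) <= rho) ->
      lyap X Y s - lyap X Y (s + Lam) <= delta ->
      `|ip (tangent (error_coord X Y s)) ((Yi ti)^t* *m S k *m Yi ti)| <= q].
Proof.
move=> hYi hUi Yi0 /andP[ti0 tiT] L0 q q0.
pose sigma := \sum_k fnorm (S k).
have sg0 : 0 <= sigma by apply: sumr_ge0 => *; exact: fnorm_ge0.
have sgk l : fnorm (S l) <= sigma.
  by rewrite /sigma (bigD1 l) //= lerDl; apply: sumr_ge0 => *; exact: fnorm_ge0.
have k0 : 0 <= kappa by exact: fnorm_ge0.
pose gam := kappa + kappa ^+ 3.
have gam0 : 0 <= gam by rewrite addr_ge0 // exprn_ge0.
pose A := (1 + 3 * kappa ^+ 2) * ((1 + kappa) ^+ 2 / 2 * sigma) * sigma.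
have A1 : 0 <= 1 + 3 * kappa ^+ 2 by rewrite addr_ge0 // mulr_ge0 // exprn_ge0.
have A0 : 0 <= A.
  apply: mulr_ge0 => //; apply: mulr_ge0 => //; apply: mulr_ge0 => //.
  by rewrite divr_ge0 // sqr_ge0.
pose F := \sum_k f k / 4.
have F0 : 0 <= F by apply: sumr_ge0 => l _; rewrite divr_ge0 // ltW.
pose g := gam * (2 * sigma).
have g0 : 0 <= g by rewrite !mulr_ge0.
have [e [eta [d1 [rho [e0 eta0 d10 rho0 hsum]]]]] := sample_constants A0 F0 L0 g0 (ltW T0) q0.
have [d d0 hd] := mpath_near_left tiT (mpath_sub hYi ti0 (lexx T)) e0.
pose h0 := Num.min (d / 2) ((T - ti) / 2).
have h00 : 0 < h0 by rewrite /h0 lt_min !divr_gt0 // subr_gt0.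
have h0d : h0 <= d / 2 by rewrite /h0 ge_min lexx.
have h0T : h0 <= (T - ti) / 2 by rewrite /h0 ge_min lexx orbT.
exists (Num.min d1 (f k / 4 * e ^+ 2 * h0)), rho; split=> //.
  by rewrite lt_min d10 !mulr_gt0 ?invr_gt0 ?exprn_gt0.
move=> U X Y s p hl s0 sp pL Yp hU; rewrite le_min => /andP[D1 D2].
have p0 : 0 <= p := le_trans s0 sp.
have [hUs _ _ hY _] := hl.
have t1 : 0 <= p + ti by rewrite addr_ge0.
have hh : ti + h0 <= T := half_window h0T tiT.
have t2 : p + ti + h0 <= s + Lam by rewrite -addrA (le_trans _ pL) // lerD2l.
have [xi /andP[x1 x2] hx] : exists2 x, p + ti < x < p + ti + h0 & `|output S X Y k x| <= e.
  apply: (loop_small_output hl t1 h00 (ltW e0)); apply: le_trans D2.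
  apply: lerB; apply: (loop_lyap_le hl); apply/andP; split=> //.
    by apply: le_trans sp _; rewrite lerDl.
  by rewrite addr_ge0 // ltW.
have xi0 : 0 <= xi by apply: le_trans (ltW x1).
pose r := xi - p.
have xr : xi = p + r by rewrite /r addrC subrK.
have r1 : ti < r by rewrite /r ltrBrDl.
have r2 : r < ti + h0 by rewrite /r ltrBlDl addrA.
have r0 : 0 <= r by apply: le_trans (ltW r1).
have rT : r < T by exact: lt_le_trans hh.
have sx : s <= xi by apply: le_trans sp _; apply: le_trans (ltW x1); rewrite lerDl.
have xL : xi <= s + Lam by apply: le_trans t2; exact: ltW.
have uY := loop_unitary hl xi0.
have uYi t : 0 <= t <= T -> (Yi t)^t* *m Yi t = 1%:M.
  by apply: (unitary_flow hYi hUi); rewrite Yi0.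
have dK : fnorm (error_coord X Y xi - error_coord X Y s) <=
    (1 + kappa) ^+ 2 / 2 * sigma * (F * eta * Lam + d1 / eta).
  have s0x : 0 <= s <= xi by rewrite s0.
  apply: (le_trans (loop_coord_dist hl eta0 sg0 sgk s0x)).
  apply: ler_wpM2l; first by apply: mulr_ge0 => //; rewrite divr_ge0 // sqr_ge0.
  apply: lerD.
    by apply: ler_wpM2l; [rewrite mulr_ge0 // ltW|rewrite lerBlDl].
  apply: ler_wpM2r; first by rewrite invr_ge0 ltW.
  apply: le_trans D1; apply: lerB; first exact: lexx.
  by apply: (loop_lyap_le hl); rewrite xi0.
have dG : fnorm (tangent (error_coord X Y s) - tangent (error_coord X Y xi)) <=
    (1 + 3 * kappa ^+ 2) * ((1 + kappa) ^+ 2 / 2 * sigma * (F * eta * Lam + d1 / eta)).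
  rewrite fnorm_distC; apply: (le_trans (loop_tangent_dist hl s0 xi0)).
  exact: ler_wpM2l.
have dY : fnorm (Yi r - Y xi) <= rho * T.
  (* Compare the reference of this period, shifted to time 0, with Yi. *)
  pose Y' t := Y (p + 1 * t).
  have hY' : mpath 0 r Y' (fun t => U (p + t) *m Y' t).
    have m1 t : 0 <= t <= r -> 0 <= p + 1 * t <= p + r.
      by rewrite mul1r lerD2l => /andP[? ->]; rewrite addr_ge0.
    have m2 t : 0 < t < r -> 0 < p + 1 * t < p + r.
      by rewrite mul1r ltrD2l => /andP[? ->]; rewrite ltr_wpDl.
    apply: (mpath_eq (mpath_affine (hY (p + r)) m1 m2)) => t _.
    by rewrite rmorph1 scale1r /Y' mul1r.
  have hYi' := mpath_sub hYi (lexx 0) (ltW rT).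
  have lt_rT t : 0 < t < r -> 0 < t < T by move=> /andP[-> /lt_trans ->].
  have hw := rpathZ rho (rpath_derive 0 r (fun u => is_derive_id u 1)).
  have := flow_compare r0 hYi' hY' (fun t ht => hUi t (lt_rT t ht)) (fun t _ => hUs (p + t)) _ _ hw.
  rewrite /Y' !mul1r !mulr0 addr0 -xr subr0 Yi0 Yp => H.
  apply: (@le_trans _ _ (rho * r)); last by rewrite ler_pM2l // ltW.
  by apply: H => // t ht; rewrite mulr1 fnorm_distC hU // lt_rT.
have dYi : fnorm (Yi ti - Yi r) <= e.
  rewrite fnorm_distC; apply/ltW/hd; first by rewrite !ltW.
  rewrite gtr0_norm ?subr_gt0 // ltrBlDl (lt_le_trans r2) // lerD2l (le_trans h0d) //.
  by rewrite ler_pdivrMr // mulr_natr mulr2n lerDl ltW.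
have uY1 := uYi r; have uY2 := uYi ti.
rewrite ti0 ltW // in uY2; rewrite r0 ltW // in uY1.
have B1 := fnorm_conj_sub (S k) (uY2 isT) (uY1 isT).
have B2 := fnorm_conj_sub (S k) (uY1 isT) uY.
set B := _ *m S k *m Yi ti.
have -> : ip (tangent (error_coord X Y s)) B = output S X Y k xi +
    ip (tangent (error_coord X Y s) - tangent (error_coord X Y xi)) (moved S Y k xi) +
    ip (tangent (error_coord X Y s)) (B - (Yi r)^t* *m S k *m Yi r) +
    ip (tangent (error_coord X Y s)) ((Yi r)^t* *m S k *m Yi r - moved S Y k xi).
  exact: ip_telescope.
have G0 : fnorm (tangent (error_coord X Y s)) <= gam.
  exact: fnorm_tangent_le k0 (loop_coord_le hl s0).
have C1 : `|ip (tangent (error_coord X Y s) - tangent (error_coord X Y xi)) (moved S Y k xi)|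
    <= A * (F * eta * Lam + d1 / eta).
  apply: le_trans (ip_le _ _) _; rewrite (loop_fnorm_moved hl) // /A mulrAC.
  apply: ler_pM; [exact: fnorm_ge0|exact: fnorm_ge0| |exact: sgk].
  by rewrite -[leRHS]mulrA; exact: dG.
have C2 : `|ip (tangent (error_coord X Y s)) (B - (Yi r)^t* *m S k *m Yi r)| <= g * e.
  apply: le_trans (ip_le _ _) _; rewrite /g -mulrA.
  apply: ler_pM; [exact: fnorm_ge0|exact: fnorm_ge0|exact: G0|apply: le_trans B1 _].
  apply: ler_pM; [|exact: fnorm_ge0| |exact: dYi].
    by rewrite mulr_ge0 // fnorm_ge0.
  by apply: ler_wpM2l => //; exact: sgk.
have C3 : `|ip (tangent (error_coord X Y s)) ((Yi r)^t* *m S k *m Yi r - moved S Y k xi)| <= g * (rho * T).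
  apply: le_trans (ip_le _ _) _; rewrite /g -mulrA.
  apply: ler_pM; [exact: fnorm_ge0|exact: fnorm_ge0|exact: G0|apply: le_trans B2 _].
  apply: ler_pM; [|exact: fnorm_ge0| |exact: dY].
    by rewrite mulr_ge0 // fnorm_ge0.
  by apply: ler_wpM2l => //; exact: sgk.
exact: le_trans (norm_sum4 hx C1 C2 C3) hsum.
Qed.

End Loops.

Lemma finite_min_pos {R : realType} (r : nat) (d : 'I_r -> R) : (forall i, 0 < d i) ->
  exists2 e, 0 < e & forall i, e <= d i.
Proof.
move=> d0; exists (\big[Num.min/1]_i d i); last by move=> i; exact: bigmin_le.
by apply/bigmin_gtP; split.
Qed.

Section Blocks.
Context {R : realType} {n m : nat}.
Variables (S : 'I_m -> 'M[R[i]]_n) (f : 'I_m -> R) (T : R) (Xg : 'M[R[i]]_n).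
Hypothesis hS : forall k, (S k)^t* = - S k.
Hypothesis hf : forall k, 0 < f k.
Hypothesis T0 : 0 < T.
Hypothesis uXg : Xg^t* *m Xg = 1%:M.
Hypothesis vXg : Xg + 1%:M \in unitmx.

(** A word of reference periods whose transported generators form a frame forces a
    decrease: otherwise [sample_small] makes all frame coordinates of K - K^3 small,
    hence K - K^3 itself and, by [fnorm_le_tangent], K. The word is the same for
    every initial error, so its occurrence is an event of the coefficients alone. *)
Lemma block_drop (r : nat) (Ui Yi : 'I_r -> R -> 'M[R[i]]_n) (ti : 'I_r -> R)
    (ki : 'I_r -> 'I_m) (C : R) :
  (forall i, mpath 0 T (Yi i) (fun t => Ui i t *m Yi i t)) ->
  (forall i t, 0 < t < T -> (Ui i t)^t* = - Ui i t) ->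
  (forall i, Yi i 0 = Xg) -> (forall i, 0 <= ti i < T) -> 0 <= C ->
  (forall G, G^t* = - G ->
     fnorm G <= C * \sum_i `|ip G ((Yi i (ti i))^t* *m S (ki i) *m Yi i (ti i))|) ->
  forall e, 0 < e -> exists delta rho : R, [/\ 0 < delta, 0 < rho &
    forall U X Y (J : nat), closed_loop S f Xg U X Y ->
      (forall j : nat, Y (j%:R * T) = Xg) ->
      (forall (i : 'I_r) t, 0 < t < T -> fnorm (U ((J + i)%:R * T + t) - Ui i t) <= rho) ->
      lyap X Y (J%:R * T) <= e \/
      lyap X Y ((J + r)%:R * T) <= lyap X Y (J%:R * T) - delta].
Proof.
move=> hYi hUi Yi0 hti C0 hspan e e0.
have Lam0 : 0 <= r%:R * T by rewrite mulr_ge0 // ltW.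
pose q := Num.min 1 e / (C * r%:R + 1).
have Cr : 0 < C * r%:R + 1 by rewrite ltr_wpDl // mulr_ge0.
have q0 : 0 < q by rewrite divr_gt0 // lt_min ltr01.
have samp i := sample_small hS hf T0 uXg vXg (ki i) (hYi i) (hUi i) (Yi0 i) (hti i) Lam0 q0.
have /choice[dr hdr] : forall i, exists dr : R * R, [/\ 0 < dr.1, 0 < dr.2 &
  forall U X Y s p, closed_loop S f Xg U X Y -> 0 <= s -> s <= p -> p + T <= s + r%:R * T ->
      Y p = Xg -> (forall r, 0 < r < T -> fnorm (U (p + r) - Ui i r) <= dr.2) ->
      lyap X Y s - lyap X Y (s + r%:R * T) <= dr.1 ->
      `|ip (tangent (error_coord X Y s)) ((Yi i (ti i))^t* *m S (ki i) *m Yi i (ti i))| <= q].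
  by move=> i; have [d [rho [h1 h2 h3]]] := samp i; exists (d, rho); split.
have [delta d0 hd] : exists2 e, 0 < e & forall i, e <= (dr i).1.
  by apply: finite_min_pos => i; case: (hdr i).
have [rho r0 hr] : exists2 e, 0 < e & forall i, e <= (dr i).2.
  by apply: finite_min_pos => i; case: (hdr i).
exists delta, rho; split=> // U X Y J hl hper hclose.
have J0 : 0 <= J%:R * T by rewrite mulr_ge0 // ltW.
have [hle|hgt] := leP (lyap X Y (J%:R * T) - lyap X Y (J%:R * T + r%:R * T)) delta; last first.
  right; rewrite natrD mulrDl lerBrDr -lerBrDl; exact: ltW.
left.
have sk := loop_coord_skew hS hf uXg vXg hl J0.
have small i : `|ip (tangent (error_coord X Y (J%:R * T)))
    ((Yi i (ti i))^t* *m S (ki i) *m Yi i (ti i))| <= q.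
  have [_ _ h] := hdr i.
  apply: (h U X Y (J%:R * T) ((J + i)%:R * T)) => //.
  - by rewrite ler_pM2r // ler_nat leq_addr.
  - by rewrite -mulrDl -[X in _ + X]mul1r -mulrDl ler_pM2r // -natrD natr1 ler_nat -addnS leq_add2l.
  - by move=> t ht; apply: le_trans (hr i); exact: hclose.
  - exact: le_trans (hd i).
have hK : fnorm (error_coord X Y (J%:R * T)) <= Num.min 1 e.
  apply: le_trans (fnorm_le_tangent sk) _.
  apply: le_trans (hspan _ (tangent_skew sk)) _.
  apply: (@le_trans _ _ (C * (r%:R * q))).
    apply: ler_wpM2l => //; apply: le_trans (ler_sum _ (fun i _ => small i)) _.
    by rewrite sumr_const card_ord mulr_natl.
  have alg (c k M D : R) : c * (k * (M / D)) = M * (c * k / D) by ring.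
  rewrite /q alg ler_piMr //; first by rewrite le_min ler01 ltW.
  by rewrite ler_pdivrMr // mul1r lerDl.
move: hK; rewrite le_min => /andP[K1 K2].
rewrite /lyap -fnorm_sqr expr2; apply: le_trans K2.
by rewrite ler_piMr ?fnorm_ge0.
Qed.

End Blocks.

(** * Periodicity of the reference trajectory *)

Section Reference.
Context {R : realType} {n m : nat}.
Variables (S : 'I_m -> 'M[R[i]]_n) (T : R).
Hypothesis hS : forall k, (S k)^t* = - S k.
Hypothesis T0 : 0 < T.

Lemma sin_addn2pi (k : nat) (x : R) : sin (x + k%:R * (2 * pi)) = sin x.
Proof.
elim: k x => [|k ih] x; first by rewrite mul0r addr0.
have -> : x + k.+1%:R * (2 * pi) = (x + k%:R * (2 * pi)) + pi *+ 2 by ring.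
by rewrite sinD2pi ih.
Qed.

Lemma sin_period_shift (l j : nat) (s : R) :
  sin (l%:R * (2 * pi / T) * (j%:R * T + s)) = sin (l%:R * (2 * pi / T) * s).
Proof.
rewrite -[RHS](sin_addn2pi (l * j)); congr sin.
by rewrite natrM; field; rewrite gt_eqF.
Qed.

Lemma sin_period_reflect (l : nat) (s : R) :
  sin (l%:R * (2 * pi / T) * (T - s)) = - sin (l%:R * (2 * pi / T) * s).
Proof.
rewrite -sinN -[RHS](sin_addn2pi l); congr sin.
by field; rewrite gt_eqF.
Qed.

Definition field_of (u : 'I_m -> R) : 'M[R[i]]_n := \sum_k (u k)%:C *: S k.

Lemma field_of_skew u : (field_of u)^t* = - field_of u.
Proof. exact: skew_comb. Qed.

Lemma fnorm_field_of_sub u v (d : R) : (forall k, `|u k - v k| <= d) ->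
  fnorm (field_of u - field_of v) <= d * \sum_k fnorm (S k).
Proof.
move=> h; rewrite /field_of -sumrB mulr_sumr; apply: le_trans (fnorm_sum _ _ _) _.
apply: ler_sum => k _; rewrite -scalerBl -rmorphB fnormZ.
by apply: ler_wpM2r; [exact: fnorm_ge0|exact: h].
Qed.

Lemma driftlessE u X : driftless S u X = field_of u *m X.
Proof. by rewrite /driftless /field_of mulmx_suml; apply: eq_bigr => k _; rewrite scalemxAl. Qed.

Lemma ode_mpath F X0 (X : R -> 'M[R[i]]_n) : ode_solution F X0 X ->
  forall b, mpath 0 b X (fun t => F t (X t)).
Proof.
move=> [_ h] b i j; have [c1 c2 hd] := h i j.
have sub : ([set` `[0, b]] : set R) `<=` [set` `[0, +oo[].
  by move=> x /=; rewrite !in_itv /= andbT => /andP[].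
by split; split; [exact: continuous_subspaceW c1|move=> t /andP[t0 _]; exact: (hd t t0).1
 |exact: continuous_subspaceW c2|move=> t /andP[t0 _]; exact: (hd t t0).2].
Qed.

Variables (M : nat) (a : nat -> (m * M).-tuple R).

Lemma ref_control_period (j : nat) (s : R) k : 0 <= s < T ->
  ref_control T a k (j%:R * T + s) =
  \sum_(l < M) tnth (a j) (mxvec_index k l) * sin (l.+1%:R * (2 * pi / T) * s).
Proof.
move=> /andP[s0 sT]; rewrite /ref_control.
have -> : Num.truncn ((j%:R * T + s) / T) = j.
  apply/truncn_def; rewrite mulrDl mulfK ?gt_eqF // -natr1.
  by rewrite lerDl divr_ge0 ?(ltW T0) //= ltrD2l ltr_pdivrMr // mul1r.
by apply: eq_bigr => l _; rewrite sin_period_shift.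
Qed.

(** Every sine in the control vanishes at both ends of a period and is odd about
    its midpoint. *)
Lemma ref_control_reflect (j : nat) (s : R) k : 0 < s < T ->
  ref_control T a k (j%:R * T + (T - s)) = - ref_control T a k (j%:R * T + s).
Proof.
move=> /andP[s0 sT]; rewrite !ref_control_period ?(ltW s0) ?sT //; last first.
  by rewrite subr_ge0 (ltW sT) ltrBlDl ltrDr.
rewrite -sumrN; apply: eq_bigr => l _.
by rewrite sin_period_reflect mulrN.
Qed.

Lemma reference_periodic (Xg : 'M[R[i]]_n) Y : Xg^t* *m Xg = 1%:M ->
  ref_trajectory S T Xg a Y -> forall j : nat, Y (j%:R * T) = Xg.
Proof.
move=> uX hY; elim=> [|j ih]; first by rewrite mul0r; case: hY.
have hp b : mpath 0 b Y (fun t => field_of (fun k => ref_control T a k t) *m Y t).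
  by apply: (mpath_eq (ode_mpath hY b)) => t _; rewrite driftlessE.
have j0 : 0 <= j%:R * T by rewrite mulr_ge0 // ltW.
have lt : j%:R * T < j.+1%:R * T by rewrite ltr_pM2r // ltr_nat.
rewrite -[RHS]ih; apply: (flow_return lt (mpath_sub (hp _) j0 (lexx _))).
- by move=> t _; exact: field_of_skew.
- move=> t /andP[t1 t2]; rewrite /field_of -sumrN; apply: eq_bigr => k _.
  have ts : 0 < t - j%:R * T < T.
    by rewrite subr_gt0 t1 ltrBlDl -[X in _ < _ + X]mul1r -mulrDl natr1.
  have -> : j%:R * T + j.+1%:R * T - t = j%:R * T + (T - (t - j%:R * T)).
    by rewrite -natr1; ring.
  rewrite ref_control_reflect // rmorphN scaleNr; do 4 f_equal.
  by rewrite addrC subrK.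
- by rewrite ih.
Qed.

Lemma loop_of_trajectories (f : 'I_m -> R) Xg Y X :
  ref_trajectory S T Xg a Y -> closed_loop_trajectory S T f a Y X ->
  closed_loop S f Xg (fun t => field_of (fun k => ref_control T a k t)) X Y.
Proof.
move=> hY hX; split.
- by move=> t; exact: field_of_skew.
- by case: hY.
- by case: hX.
- by move=> b; apply: (mpath_eq (ode_mpath hY b)) => t _; rewrite driftlessE.
- move=> b; apply: (mpath_eq (ode_mpath hX b)) => t _; rewrite driftlessE.
  congr (_ *m _); rewrite /field_of -big_split; apply: eq_bigr => k _ /=.
  by rewrite -scalerDl -rmorphD.
Qed.

End Reference.

(** * Finite frames of the skew-Hermitian matrices *)

Section Frame.
Context {R : realType} {n : nat}.
Implicit Types A B G : 'M[R[i]]_n.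

Definition real_vec A : 'rV[R]_(n * n + n * n) :=
  row_mx (mxvec (\matrix_(i, j) Re (A i j))) (mxvec (\matrix_(i, j) Im (A i j))).

Lemma sum_mxvec (F : 'I_(n * n) -> R) : \sum_k F k = \sum_i \sum_j F (mxvec_index i j).
Proof.
rewrite pair_bigA /= (reindex (uncurry (@mxvec_index n n))) //=; last exact: curry_mxvec_bij.
by apply: eq_bigr => -[].
Qed.

Lemma ip_real_vec A B : ip A B = (real_vec A *m (real_vec B)^T) 0 0.
Proof.
rewrite ipE mxE big_split_ord /=.
under eq_bigr do rewrite big_split.
rewrite big_split /=; congr (_ + _); rewrite sum_mxvec; do 2!apply: eq_bigr => ? _.
  by rewrite [(_ ^T) _ _]mxE /real_vec !row_mxEl !mxvecE !mxE.
by rewrite [(_ ^T) _ _]mxE /real_vec !row_mxEr !mxvecE !mxE.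
Qed.

Definition frame_mx r (B : 'I_r -> 'M[R[i]]_n) : 'M[R]_(r, n * n + n * n) :=
  \matrix_(i < r) real_vec (B i).

(** The size of a free family is bounded by the dimension of the real vector space of
    matrices; a vector outside the span of a largest one would enlarge it. *)
Lemma maximal_free_family (F : set 'M[R[i]]_n) :
  exists r (B : 'I_r -> 'M[R[i]]_n), [/\ forall i, F (B i), row_free (frame_mx B) &
    forall A, F A -> (real_vec A <= frame_mx B)%MS].
Proof.
pose P r := `[< exists B : 'I_r -> 'M[R[i]]_n, (forall i, F (B i)) /\ row_free (frame_mx B) >].
have P0 : exists r, P r.
  exists 0%N; apply/asboolP; exists (fun i => 0); split; first by case.
  by rewrite -row_leq_rank.
have Pub r : P r -> (r <= n * n + n * n)%N.
  by move=> /asboolP[B [_ fB]]; rewrite -(eqP fB) rank_leq_col.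
have [r /asboolP[B [FB fB]] rmax] := ex_maxnP P0 Pub.
exists r, B; split=> // A FA; apply: contraT => nA.
suff /rmax : P r.+1 by rewrite ltnn.
pose B' (i : 'I_r.+1) := if unlift ord_max i is Some j then B j else A.
apply/asboolP; exists B'; split; first by rewrite /B' => i; case: unliftP.
have sub1 : (real_vec A <= frame_mx B')%MS.
  have <- : row ord_max (frame_mx B') = real_vec A by rewrite rowK /B' unlift_none.
  exact: row_sub.
have sub2 : (frame_mx B <= frame_mx B')%MS.
  apply/row_subP => j.
  have <- : row (lift ord_max j) (frame_mx B') = row j (frame_mx B) by rewrite !rowK /B' liftK.
  exact: row_sub.
rewrite -row_leq_rank.
have lt : (frame_mx B < frame_mx B + real_vec A)%MS.
  by rewrite ltmxE addsmxSl /= addsmx_sub submx_refl (negbTE nA).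
rewrite -{1}(eqP fB); apply: leq_trans (rank_ltmx lt) _.
by apply: mxrankS; rewrite addsmx_sub sub2.
Qed.

(** Project G orthogonally onto a maximal free family by inverting its Gram matrix.
    The remainder is orthogonal to the family, hence to all of F, hence zero; and
    the coefficients of the projection are linear in the products <G, B_i>. *)
Lemma frame_exists (F : set 'M[R[i]]_n) :
  (forall B, F B -> B^t* = - B) ->
  (forall G, G^t* = - G -> (forall B, F B -> ip G B = 0) -> G = 0) ->
  exists r (B : 'I_r -> 'M[R[i]]_n) (C : R), [/\ forall i, F (B i), 0 <= C &
    forall G, G^t* = - G -> fnorm G <= C * \sum_i `|ip G (B i)|].
Proof.
move=> Fskew Fsep; have [r [B [FB fB Bmax]]] := maximal_free_family F.
set Phi := frame_mx B in fB Bmax.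
pose Q := Phi *m Phi^T.
have uQ : Q \in unitmx.
  rewrite -row_free_unit -kermx_eq0; apply/eqP/row_matrixP => i.
  rewrite row0; set x := row i _.
  have xQ : x *m Q = 0.
    by apply/sub_kermxP; exact: row_sub.
  have : x *m Phi = 0.
    have : (x *m Phi) *m (x *m Phi)^T = 0 by rewrite trmx_mul mulmxA -(mulmxA x) xQ mul0mx.
    set y := x *m Phi => /matrixP /(_ 0 0).
    have -> : (y *m y^T) 0 0 = \sum_j y 0 j ^+ 2.
      by rewrite mxE; apply: eq_bigr => j _; rewrite [y^T _ _]mxE expr2.
    rewrite mxE => /eqP; rewrite psumr_eq0; last by move=> j _; exact: sqr_ge0.
    move=> /allP h; apply/rowP => j; rewrite [RHS]mxE.
    by have := h j (mem_index_enum _); rewrite /= sqrf_eq0 => /eqP.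
  by move/eqP; rewrite mulmx_free_eq0 // => /eqP.
have QE i j : Q i j = ip (B i) (B j).
  rewrite ip_real_vec !mxE; apply: eq_bigr => k _.
  by rewrite mxE [RHS]mulrC -[in RHS]mulrC !mxE.
have PhiE G j : (real_vec G *m Phi^T) 0 j = ip G (B j).
  by rewrite ip_real_vec !mxE; apply: eq_bigr => k _; rewrite !mxE.
pose x G : 'rV_r := real_vec G *m Phi^T *m invmx Q.
have expand G : G^t* = - G -> G = \sum_i (x G 0 i)%:C *: B i.
  move=> sG; apply/eqP; rewrite -subr_eq0; apply/eqP.
  set G' := G - _.
  have ortho j : ip G' (B j) = 0.
    rewrite /G' ipBl [X in _ - X]ipC ip_sumr -PhiE.
    have -> : real_vec G *m Phi^T = x G *m Q by rewrite /x mulmxKV.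
    rewrite mxE; apply/eqP; rewrite subr_eq0; apply/eqP; apply: eq_bigr => i _.
    by rewrite ipZr QE ipC.
  apply: Fsep => [|A /Bmax /submxP[D hD]].
    by rewrite adjmxD sG adjmxN (skew_comb (fun i => Fskew _ (FB i))) opprD.
  rewrite ip_real_vec hD trmx_mul mulmxA (_ : real_vec G' *m Phi^T = 0) ?mul0mx ?mxE //.
  by apply/rowP => j; rewrite PhiE ortho mxE.
pose q := \sum_i \sum_j `|invmx Q i j|.
pose b := \sum_i fnorm (B i).
have q0 : 0 <= q by rewrite sumr_ge0 // => i _; rewrite sumr_ge0.
have b0 : 0 <= b by rewrite sumr_ge0 // => i _; rewrite fnorm_ge0.
exists r, B, (q * b); split=> //; first exact: mulr_ge0.
move=> G sG; set s := \sum_i `|_|.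
have s0 : 0 <= s by rewrite sumr_ge0.
have xb i : `|x G 0 i| <= q * s.
  rewrite mxE; apply: le_trans (ler_norm_sum _ _ _) _; rewrite mulr_sumr.
  apply: ler_sum => j _; rewrite normrM PhiE mulrC ler_wpM2r //.
  rewrite /q (bigD1 j) //= (bigD1 i) //= -addrA lerDl addr_ge0 ?sumr_ge0 // => k _.
  by rewrite sumr_ge0.
rewrite {1}(expand G sG) mulrAC /b mulr_sumr; apply: le_trans (fnorm_sum _ _ _) _.
by apply: ler_sum => i _; rewrite fnormZ ler_wpM2r ?fnorm_ge0.
Qed.

End Frame.

(** * Existence of linear flows *)

Lemma picard_base {R : realType} (L x e : R) : 0 <= L -> 0 <= x -> 1 <= e ->
  L * x <= 2 * L * (x * 1 * e).
Proof.
move=> L0 x0 e1; have Lx : 0 <= L * x by exact: mulr_ge0.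
have -> : 2 * L * (x * 1 * e) = L * x * (2 * e) by ring.
by rewrite ler_peMr //; lra.
Qed.

Section Picard.
Context {R : realType}.

Lemma antiderivative (a b : R) (g : R -> R) : a < b -> {within `[a, b], continuous g} ->
  exists2 G, G a = 0 & rpath a b G g.
Proof.
move=> ab cg.
have ig : (@lebesgue_measure R).-integrable `[a, b] (EFin \o g).
  by apply: continuous_compact_integrable => //; exact: segment_compact.
exists (fun x => parameterized_integral lebesgue_measure a x g).
  by rewrite /parameterized_integral set_itv1 Rintegral_set1.
split; first exact: parameterized_integral_continuous (ltW ab) ig.
move=> t /andP[at_ tb].
have [gt _ _] := (continuous_within_itvP _ ab).1 cg.
have [] := @continuous_FTC1 R g (BLeft a) t b tb ig.
- suff : (BLeft (a : R) < BRight (t : R))%O by []. by rewrite bnd_simp ltW.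
- by apply: gt; rewrite in_itv /= at_.
by move=> d1 d2; apply: DeriveDef; [exact: d1|rewrite -derive1E; exact: d2].
Qed.

(** The limit is the supremum of the increasing sequence u_p - 2 E / 2^p. *)
Lemma geometric_limit (u : nat -> R) (E : R) :
  (forall p, `|u p.+1 - u p| <= E * 2^-1 ^+ p) ->
  exists l, forall p, `|u p - l| <= 2 * E * 2^-1 ^+ p.
Proof.
move=> hu.
have E0 : 0 <= E by have := hu 0%N; rewrite expr0 mulr1; apply: le_trans.
pose e p := 2 * E * 2^-1 ^+ p.
have eS p : e p.+1 + E * 2^-1 ^+ p = e p by rewrite /e exprS; field.
have up k p : u p - e p <= u (k + p)%N - e (k + p)%N.
  elim: k => [//|k ih]; apply: le_trans ih _; rewrite addSn.
  have := hu (k + p)%N; have := eS (k + p)%N; rewrite ler_norml.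
  move: (E * _) (e _) (e _) (u _) (u _) => x y z v w; lra.
have down k p : u (k + p)%N + e (k + p)%N <= u p + e p.
  elim: k => [//|k ih]; apply: le_trans ih; rewrite addSn.
  have := hu (k + p)%N; have := eS (k + p)%N; rewrite ler_norml.
  move: (E * _) (e _) (e _) (u _) (u _) => x y z v w; lra.
have e0 p : 0 <= e p by rewrite !mulr_ge0 // exprn_ge0.
have cross p q : u p - e p <= u q + e q.
  apply: le_trans (up q p) _; rewrite addnC; apply: le_trans (down p q).
  by rewrite lerD2l; apply: le_trans (e0 _); rewrite oppr_le0.
pose D := range (fun p => u p - e p).
have D0 : D !=set0 by exists (u 0%N - e 0%N), 0%N.
exists (sup D) => p; rewrite distrC ler_distl; apply/andP; split.
  by apply: ub_le_sup; [exists (u 0%N + e 0%N) => _ [q _ <-]|exists p].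
by apply: sup_le_ub => // _ [q _ <-].
Qed.

Lemma geometric_small (C : R) : 0 <= C -> forall e, 0 < e -> exists p, C * 2^-1 ^+ p < e.
Proof.
move=> C0 e e0.
have [p hp] : exists p : nat, C / e < p%:R.
  by exists (Num.bound (C / e)); apply: archi_boundP; rewrite divr_ge0 // ltW.
exists p; rewrite exprVn ltr_pdivrMr ?exprn_gt0 //.
rewrite -ltr_pdivrMl // mulrC; apply: lt_trans hp _.
by rewrite -natrX ltr_nat ltn_expl.
Qed.

Lemma uniform_limit_within (a b C : R) (u : nat -> R -> R) (v : R -> R) :
  0 <= C -> (forall p, {within `[a, b], continuous (u p)}) ->
  (forall p t, a <= t <= b -> `|u p t - v t| <= C * 2^-1 ^+ p) ->
  {within `[a, b], continuous v}.
Proof.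
move=> C0 cu huv; apply/subspace_continuousP => x /=; rewrite in_itv /= => hx.
apply/cvgrPdist_lt => e e0.
have e3 : 0 < e / 3 by rewrite divr_gt0.
have [p hp] := geometric_small C0 e3.
move/subspace_continuousP: (cu p) => /(_ x); rewrite /= in_itv /= => /(_ hx).
move=> /cvgrPdist_lt /(_ _ e3).
rewrite !near_withinE; apply: filterS => t h /=; rewrite in_itv /= => ht.
have h1 := le_lt_trans (huv p x hx) hp; have h2 := le_lt_trans (huv p t ht) hp.
have h3 : `|u p x - u p t| < e / 3 by apply: h; rewrite /= in_itv.
change (`|v x - v t| < e).
move: h1 h2 h3; rewrite !ltr_norml; move: (u p x) (u p t) (v x) (v t) => c d y z h1 h2 h3.
move: h1 h2 h3; clear; lra.
Qed.

Context {n : nat}.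
Implicit Types X Y A : R -> 'M[R[i]]_n.

Definition mcont (a b : R) X := forall i j,
  {within `[a, b], continuous (fun t => Re (X t i j))} /\
  {within `[a, b], continuous (fun t => Im (X t i j))}.

Lemma mpath_mcont a b X dX : mpath a b X dX -> mcont a b X.
Proof. by move=> h i j; have [[? _] [? _]] := h i j. Qed.

Lemma mantiderivative a b X (X0 : 'M[R[i]]_n) : a < b -> mcont a b X ->
  exists2 Y, Y a = X0 & mpath a b Y X.
Proof.
move=> ab cX.
have /choice[Y hY] : forall ij : 'I_n * 'I_n, exists z : R -> R[i],
    z a = 0 /\ cpath a b z (fun t => X t ij.1 ij.2).
  move=> [i j]; have [c1 c2] := cX i j.
  have [G1 G10 hG1] := antiderivative ab c1; have [G2 G20 hG2] := antiderivative ab c2.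
  by exists (fun t => Complex (G1 t) (G2 t)); rewrite G10 G20.
exists (fun t => X0 + \matrix_(i, j) Y (i, j) t).
  by apply/matrixP => i j; rewrite !mxE (hY (i, j)).1 addr0.
apply: (mpath_eq (mpathD (mpath_cst a b X0) _)); last by move=> t _; exact: add0r.
by move=> i j; have := (hY (i, j)).2; congr cpath; apply/funext => t; rewrite mxE.
Qed.

Lemma Re_subE (P Q : 'M[R[i]]_n) i j : Re ((P - Q) i j) = Re (P i j) - Re (Q i j).
Proof. by rewrite !mxE cReD; case: (Q i j). Qed.

Lemma Im_subE (P Q : 'M[R[i]]_n) i j : Im ((P - Q) i j) = Im (P i j) - Im (Q i j).
Proof. by rewrite !mxE cImD; case: (Q i j). Qed.

Lemma fnorm_le_entries (A : 'M[R[i]]_n) (c : R) : 0 <= c ->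
  (forall i j, `|Re (A i j)| <= c /\ `|Im (A i j)| <= c) ->
  fnorm A <= (2 * n * n)%:R * c.
Proof.
move=> c0 h; apply: fnorm_le; first by rewrite mulr_ge0.
rewrite ipE; apply: (@le_trans _ _ (\sum_(i < n) \sum_(j < n) (2 * c ^+ 2))).
  apply: ler_sum => i _; apply: ler_sum => j _; have [] := h i j.
  rewrite !ler_norml; move: (Re _) (Im _) => x y; nra.
rewrite !sumr_const !card_ord -mulrnA -[leLHS]mulr_natl mulrA -natrM.
rewrite exprMn ler_wpM2r ?sqr_ge0 // -natrX ler_nat.
rewrite mulnC mulnA -mulnn.
by case: (2 * n * n)%N => // k; rewrite leq_pmulr.
Qed.

(** Picard iteration. The weight exp (2 L t) makes the iteration contract by a
    factor 2 on the whole segment; the uniform limit Yl is continuous, and the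
    primitive F of A Yl is at vanishing distance from the iterates, so F = Yl. *)
Lemma linear_flow_exists (T L : R) A dA (X0 : 'M[R[i]]_n) : 0 < T -> mpath 0 T A dA ->
  0 <= L -> (forall t, 0 <= t <= T -> fnorm (A t) <= L) ->
  exists2 Y, Y 0 = X0 & mpath 0 T Y (fun t => A t *m Y t).
Proof.
move=> T0 hA L0 hL.
have /choice[Phi hPhi] : forall Y : R -> 'M[R[i]]_n, exists Y' : R -> 'M[R[i]]_n,
    (exists dY, mpath 0 T Y dY) -> Y' 0 = X0 /\ mpath 0 T Y' (fun t => A t *m Y t).
  move=> Y; case: (pselect (exists dY, mpath 0 T Y dY)) => [[dY hY]|no]; last by exists Y.
  have [Y' Y'0 hY'] := mantiderivative X0 T0 (mpath_mcont (mpathM hA hY)).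
  by exists Y'.
pose Y p := iter p Phi (fun=> X0).
have Ypath p : exists dY, mpath 0 T (Y p) dY.
  elim: p => [|p ih]; first by exists (fun=> 0); exact: mpath_cst.
  by have [_ h] := hPhi _ ih; eexists; exact: h.
have Y0 p : Y p 0 = X0 by case: p => [//|p]; case: (hPhi _ (Ypath p)).
have YS p : mpath 0 T (Y p.+1) (fun t => A t *m Y p t) by case: (hPhi _ (Ypath p)).
pose w p t := fnorm X0 * 2^-1 ^+ p * expR (2 * L * t).
have wd p a b : rpath a b (w p) (fun t => 2 * L * w p t).
  apply: rpath_derive => t.
  have h1 := is_deriveZ (2 * L) (is_derive_id t 1).
  have h2 := is_derive1_comp (is_derive_expR (2 * L * t)) h1.
  have h3 := is_deriveZ (fnorm X0 * 2^-1 ^+ p) h2.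
  apply: (is_derive_eq h3); rewrite /w /GRing.scale /=; ring.
have step p t : 0 <= t <= T -> fnorm (Y p.+1 t - Y p t) <= w p t.
  have w0 q s : 0 <= w q s by rewrite /w !mulr_ge0 ?fnorm_ge0 ?exprn_ge0 ?expR_ge0.
  elim: p t => [|p ih] t /andP[t0 tT].
    have h1 := mpathB (mpath_sub (YS 0%N) (lexx 0) tT) (mpath_cst 0 t X0).
    have := mpath_mean_value t0 h1 (wd 0%N 0 t).
    rewrite Y0 subrr subr0 => h; apply: le_trans (h _) _ => [s /andP[s0 st]|].
      rewrite subr0; apply: le_trans (fnormM _ _) _.
      have sT : 0 <= s <= T by rewrite (ltW s0) (le_trans (ltW st)).
      apply: le_trans (ler_wpM2r (fnorm_ge0 _) (hL s sT)) _.
      rewrite /w expr0; apply: picard_base; rewrite ?fnorm_ge0 //.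
      by rewrite -expR0 ler_expR !mulr_ge0 ?(ltW s0).
    by rewrite gerBl.
  have h1 := mpathB (mpath_sub (YS p.+1) (lexx 0) tT) (mpath_sub (YS p) (lexx 0) tT).
  have := mpath_mean_value t0 h1 (wd p.+1 0 t).
  rewrite !Y0 subrr subr0 => h; apply: le_trans (h _) _ => [s /andP[s0 st]|].
    rewrite -mulmxBr; apply: le_trans (fnormM _ _) _.
    have sT : 0 <= s <= T by rewrite (ltW s0) (le_trans (ltW st)).
    apply: le_trans (ler_pM (fnorm_ge0 _) (fnorm_ge0 _) (hL s sT) (ih s sT)) _.
    by rewrite /w exprS le_eqVlt; apply/orP; left; apply/eqP; field.
  by rewrite gerBl.
pose E := fnorm X0 * expR (2 * L * T).
have E0 : 0 <= E by rewrite mulr_ge0 ?fnorm_ge0 ?expR_ge0.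
have stepE p t : 0 <= t <= T -> fnorm (Y p.+1 t - Y p t) <= E * 2^-1 ^+ p.
  move=> ht; apply: le_trans (step p t ht) _.
  rewrite /w /E mulrAC ler_wpM2r ?exprn_ge0 // ler_wpM2l ?fnorm_ge0 //.
  by rewrite ler_expR; apply: ler_wpM2l; [exact: mulr_ge0|case/andP: ht].
pose C := 2 * E.
have C0 : 0 <= C by rewrite mulr_ge0.
have /choice[Z hZ] : forall tij : R * 'I_n * 'I_n, exists z : R[i], 0 <= tij.1.1 <= T ->
   forall p, `|Re (Y p tij.1.1 tij.1.2 tij.2) - Re z| <= C * 2^-1 ^+ p /\
             `|Im (Y p tij.1.1 tij.1.2 tij.2) - Im z| <= C * 2^-1 ^+ p.
  move=> [[t i] j] /=; case: (boolP (0 <= t <= T)) => ht; last by exists 0.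
  have ent p := fnorm_entry (Y p.+1 t - Y p t) i j.
  have [l1 h1] : exists l, forall p, `|Re (Y p t i j) - l| <= C * 2^-1 ^+ p.
    apply: geometric_limit => p; have [h _] := ent p.
    by apply: le_trans (le_trans h (stepE p t ht)); rewrite Re_subE.
  have [l2 h2] : exists l, forall p, `|Im (Y p t i j) - l| <= C * 2^-1 ^+ p.
    apply: geometric_limit => p; have [_ h] := ent p.
    by apply: le_trans (le_trans h (stepE p t ht)); rewrite Im_subE.
  by exists (Complex l1 l2) => _ p.
pose Yl t := \matrix_(i, j) Z (t, i, j).
have Yl_close p t : 0 <= t <= T -> fnorm (Y p t - Yl t) <= (2 * n * n)%:R * (C * 2^-1 ^+ p).
  move=> ht; apply: fnorm_le_entries => [|i j]; first by rewrite mulr_ge0 ?exprn_ge0.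
  have [h1 h2] := hZ (t, i, j) ht p.
  by rewrite !mxE cReD cImD; split; [move: h1|move: h2]; case: (Z _).
pose C' := (2 * n * n)%:R * C.
have C'0 : 0 <= C' by rewrite mulr_ge0.
have {}Yl_close p t : 0 <= t <= T -> fnorm (Y p t - Yl t) <= C' * 2^-1 ^+ p.
  by move=> ht; rewrite /C' -mulrA; exact: Yl_close.
have AY_close p t : 0 <= t <= T -> fnorm (A t *m Y p t - A t *m Yl t) <= L * C' * 2^-1 ^+ p.
  move=> ht; rewrite -mulmxBr; apply: le_trans (fnormM _ _) _; rewrite -mulrA.
  by apply: ler_pM; [exact: fnorm_ge0|exact: fnorm_ge0|exact: hL|exact: Yl_close].
have AY_cont : mcont 0 T (fun t => A t *m Yl t).
  have LC0 : 0 <= L * C' by rewrite mulr_ge0.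
  have cont p : mcont 0 T (fun t => A t *m Y p t).
    by have [dY hY] := Ypath p; exact: mpath_mcont (mpathM hA hY).
  have ent p t i j (ht : 0 <= t <= T) := fnorm_entry (A t *m Y p t - A t *m Yl t) i j.
  move=> i j; split.
    apply: (uniform_limit_within LC0 (fun p => (cont p i j).1)) => p t ht.
    have [h _] := ent p t i j ht; apply: le_trans (le_trans h (AY_close p t ht)).
    by rewrite Re_subE.
  apply: (uniform_limit_within LC0 (fun p => (cont p i j).2)) => p t ht.
  have [_ h] := ent p t i j ht; apply: le_trans (le_trans h (AY_close p t ht)).
  by rewrite Im_subE.
have [F F0 hF] := mantiderivative X0 T0 AY_cont.
exists F => //; apply: (mpath_eq hF) => t /andP[/ltW t0 /ltW tT]; congr (_ *m _).
have ht : 0 <= t <= T by rewrite t0.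
apply/eqP; rewrite -subr_eq0; apply/eqP/fnorm_eq0/le_anti; rewrite fnorm_ge0 andbT.
apply/ler_addgt0Pl => e e0; rewrite addr0.
pose K := L * C' * T + C'.
have LC0 : 0 <= L * C' by exact: mulr_ge0.
have K0 : 0 <= K by apply: addr_ge0 => //; apply: mulr_ge0 => //; exact: ltW.
have [p hp] := geometric_small K0 e0; apply/ltW; apply: le_lt_trans hp.
have -> : Yl t - F t = (Yl t - Y p.+1 t) + (Y p.+1 t - F t) by rewrite addrA subrK.
apply: le_trans (fnormD _ _) _; rewrite /K mulrDl addrC; apply: lerD; last first.
  rewrite fnorm_distC; apply: le_trans (Yl_close _ _ ht) _.
  by apply: ler_wpM2l => //; rewrite exprS ler_piMl ?exprn_ge0 // invf_le1 // ler1n.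
have h1 := mpathB (mpath_sub (YS p) (lexx 0) tT) (mpath_sub hF (lexx 0) tT).
have hw := rpathZ (L * C' * 2^-1 ^+ p) (rpath_derive 0 t (fun u => is_derive_id u 1)).
have := mpath_mean_value t0 h1 hw; rewrite Y0 F0 subrr !subr0 mulr0 subr0 => h.
apply: le_trans (h _) _ => [s /andP[s0 st]|].
  by rewrite mulr1; apply: AY_close; rewrite (ltW s0) (le_trans (ltW st)).
rewrite mulrAC; apply: ler_wpM2r; first exact: exprn_ge0.
exact: ler_wpM2l.
Qed.

End Picard.

(** * Sine polynomials with a peak at the end of an interval *)

Section SinePolynomials.
Context {R : realType}.
Implicit Types (d : nat -> R) (M : nat) (x : R).

Definition sine_sum d M x := \sum_(l < M) d l * sin (l.+1%:R * x).
Definition vanish_from M d := forall l, (M <= l)%N -> d l = 0.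

Lemma sine_sum_widen d M M' x : vanish_from M d -> (M <= M')%N ->
  sine_sum d M' x = sine_sum d M x.
Proof.
move=> hd le; rewrite /sine_sum -(subnKC le) big_split_ord /= [X in _ + X]big1 ?addr0 //.
by move=> i _; rewrite hd ?mul0r // leq_addr.
Qed.

Definition sine_poly (w : R -> R) := exists M d, vanish_from M d /\
  forall x, w x = sine_sum d M x.

Lemma sine_poly_sin (l : nat) : sine_poly (fun x => sin (l%:R * x)).
Proof.
case: l => [|l]; first by exists 0%N, (fun=> 0); split=> // x; rewrite mul0r sin0 /sine_sum big_ord0.
exists l.+1, (fun k => (k == l)%:R); split.
  by move=> k; rewrite ltnNge; case: eqVneq => // ->; rewrite leqnn.
move=> x; rewrite /sine_sum (bigD1 ord_max) //= eqxx mul1r big1 ?addr0 // => i.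
by rewrite -val_eqE /= => /negbTE ->; rewrite mul0r.
Qed.

Lemma sine_polyD w v : sine_poly w -> sine_poly v -> sine_poly (fun x => w x + v x).
Proof.
move=> [M [d [hd hw]]] [N [e [he hv]]]; exists (maxn M N), (fun l => d l + e l); split.
  by move=> l; rewrite geq_max => /andP[h1 h2]; rewrite hd ?he ?addr0.
move=> x; rewrite hw hv -(sine_sum_widen _ hd (leq_maxl M N)).
rewrite -(sine_sum_widen _ he (leq_maxr M N)) /sine_sum -big_split.
by apply: eq_bigr => i _; rewrite mulrDl.
Qed.

Lemma sine_polyZ (c : R) w : sine_poly w -> sine_poly (fun x => c * w x).
Proof.
move=> [M [d [hd hw]]]; exists M, (fun l => c * d l); split.
  by move=> l h; rewrite hd ?mulr0.
by move=> x; rewrite hw /sine_sum mulr_sumr; apply: eq_bigr => i _; rewrite mulrA.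
Qed.

Lemma sine_poly_eq w v : w =1 v -> sine_poly w -> sine_poly v.
Proof. by move=> e [M [d [hd hw]]]; exists M, d; split=> // x; rewrite -e. Qed.

Lemma sine_poly_sum M (w : nat -> R -> R) : (forall l, sine_poly (w l)) ->
  sine_poly (fun x => \sum_(l < M) w l x).
Proof.
move=> h; elim: M => [|M ih].
  by apply: sine_poly_eq (sine_poly_sin 0) => x; rewrite mul0r sin0 big_ord0.
by apply: sine_poly_eq (sine_polyD ih (h M)) => x; rewrite big_ord_recr.
Qed.

(** cos x sin (l + 1) x = (sin (l + 2) x + sin l x) / 2. *)
Lemma sine_poly_cos w : sine_poly w -> sine_poly (fun x => cos x * w x).
Proof.
move=> [M [d [_ hw]]].
have h l : sine_poly (fun x => d l / 2 * (sin (l.+2%:R * x) + sin (l%:R * x))).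
  by apply/sine_polyZ/sine_polyD; exact: sine_poly_sin.
apply: sine_poly_eq (sine_poly_sum M h) => x; rewrite hw mulr_sumr.
apply: eq_bigr => l _.
have -> : l.+2%:R * x = l.+1%:R * x + x by rewrite -[l.+2%:R]natr1 mulrDl mul1r.
have -> : l%:R * x = l.+1%:R * x - x by rewrite -[l.+1%:R]natr1 mulrDl mul1r addrK.
rewrite sinD sinB; move: (sin _) (cos _) (sin x) (cos x) => a b c e; by field.
Qed.

(** As N grows the value at x0 stays sin x0 while the integral over [0, x0] tends
    to 0, and all the peaks are sine polynomials. *)
Definition peak (N : nat) (x0 x : R) := sin x * ((2 - cos x) / (2 - cos x0)) ^+ N.

Lemma peak_sine_poly N x0 : sine_poly (peak N x0).
Proof.
elim: N => [|N ih].
  by apply: sine_poly_eq (sine_poly_sin 1) => x; rewrite mul1r /peak expr0 mulr1.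
have h := sine_polyD (sine_polyZ (2 / (2 - cos x0)) ih)
   (sine_polyZ (- (2 - cos x0)^-1) (sine_poly_cos ih)).
apply: sine_poly_eq h => x; rewrite /peak exprS; ring.
Qed.

Lemma cos_lt2 x : 0 < 2 - cos x.
Proof. by have := cos_le1 x; lra. Qed.

(** A primitive of t |-> peak N x0 (w t). *)
Definition peak_integral (N : nat) (w x0 t : R) :=
  (2 - cos (w * t)) ^+ N.+1 / ((2 - cos x0) ^+ N * (w * N.+1%:R)).

Lemma peak_integral_path a b N w x0 : 0 < w ->
  rpath a b (peak_integral N w x0) (fun t => peak N x0 (w * t)).
Proof.
move=> w0.
have h1 : rpath a b (fun t => w * t) (fun=> w).
  apply: (rpath_eq (rpathZ w (rpath_derive a b (fun t => is_derive_id t 1)))) => t _.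
  by rewrite mulr1.
have h2 := @rpath_comp _ _ _ _ _ cos (fun y => - sin y) (fun t _ => is_derive_cos (w * t)) h1.
have h3 := rpathB (rpath_cst a b (2 : R)) h2.
have dX (y : R) : is_derive y (1 : R) (fun y : R => y ^+ N.+1) (N.+1%:R * y ^+ N : R).
  apply: DeriveDef; first exact: exprn_derivable.
  by rewrite exp_derive [LHS]mulr1.
have h4 := @rpath_comp _ _ _ _ _ _ (fun y => N.+1%:R * y ^+ N) (fun t _ => dX (2 - cos (w * t))) h3.
have h5 := rpathM h4 (rpath_cst a b (((2 - cos x0) ^+ N * (w * N.+1%:R))^-1)).
apply: (rpath_eq h5) => t _; rewrite /peak expr_div_n mulr0 addr0.
have c0 : (2 - cos x0) ^+ N != 0 by rewrite expf_neq0 // gt_eqF // cos_lt2.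
have n0 : N.+1%:R != 0 :> R by rewrite pnatr_eq0.
move: ((2 - cos x0) ^+ N) ((2 - cos (w * t)) ^+ N) (N.+1%:R : R) (sin _) c0 n0 => p q r s p0 r0.
by field; rewrite p0 r0 gt_eqF.
Qed.

Lemma peak_integral_le N w x0 : 0 < w ->
  peak_integral N w x0 (x0 / w) - peak_integral N w x0 0 <= (2 - cos x0) / w * N.+1%:R^-1.
Proof.
move=> w0; have p0 := cos_lt2 x0.
have i0 : 0 <= peak_integral N w x0 0.
  by rewrite /peak_integral divr_ge0 ?mulr_ge0 ?exprn_ge0 ?(ltW p0) ?(ltW w0) ?(ltW (cos_lt2 _)).
rewrite lerBlDr; apply: ler_wpDr => //.
rewrite /peak_integral mulrCA divff ?gt_eqF // mulr1 exprS.
have c0 : (2 - cos x0) ^+ N != 0 by rewrite expf_neq0 // gt_eqF.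
have n0 : N.+1%:R != 0 :> R by rewrite pnatr_eq0.
move: ((2 - cos x0) ^+ N) (2 - cos x0) (N.+1%:R : R) c0 n0 => p q r pn rn.
rewrite le_eqVlt; apply/orP; left; apply/eqP; field.
by rewrite pn rn gt_eqF.
Qed.

Lemma peak_ge0 N x0 x : 0 <= x <= pi -> 0 <= peak N x0 x.
Proof.
move=> hx; rewrite /peak mulr_ge0 ?sin_ge0_pi // exprn_ge0 // divr_ge0 // ltW ?cos_lt2 //.
Qed.

Lemma peak_at N x0 : peak N x0 x0 = sin x0.
Proof. by rewrite /peak divff ?expr1n ?mulr1 // gt_eqF // cos_lt2. Qed.

End SinePolynomials.

(** * Transported generators separate skew-Hermitian matrices *)

Lemma peak_algebra {R : realType} (eta w g s fE fD I x y e : R) :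
  0 < eta -> eta <= 1 -> 0 <= w -> 0 <= g -> 0 <= s -> 0 <= fE -> 0 <= fD -> 0 <= I ->
  `|e| <= g * (2 * fE * (eta * s * I)) -> `|y - x| <= g * (2 * fD * (eta * s * I)) ->
  e + eta * w * x = 0 -> w * `|y| <= 2 * g * s * (fE + w * fD) * I.
Proof.
move=> eta0 eta1 w0 g0 s0 E0 D0 I0 b1 b2 c3.
have a0 : 0 <= 2 * g * fD * s * I by rewrite !mulr_ge0.
have h1 : w * `|x| <= 2 * g * fE * s * I.
  rewrite -(@ler_pM2l _ eta) // mulrA -{1}(ger0_norm (ltW eta0)) -{1}(ger0_norm w0) -!normrM.
  have -> : eta * w * x = - e by apply/eqP; rewrite -addr_eq0 addrC c3.
  by rewrite normrN; apply: le_trans b1 _; rewrite le_eqVlt; apply/orP; left; apply/eqP; ring.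
have h2 : `|y - x| <= 2 * g * fD * s * I.
  apply: le_trans b2 _; rewrite (_ : g * _ = eta * (2 * g * fD * s * I)); last by ring.
  by rewrite ler_piMl.
have h3 : `|y| <= `|x| + `|y - x|.
  by have := ler_normD x (y - x); rewrite addrC subrK.
apply: (@le_trans _ _ (w * `|x| + w * `|y - x|)); first by rewrite -mulrDr ler_wpM2l.
rewrite (_ : 2 * g * s * _ * I = 2 * g * fE * s * I + w * (2 * g * fD * s * I)); last by ring.
by apply: lerD => //; apply: ler_wpM2l.
Qed.

Section Separation.
Context {R : realType} {n m : nat}.
Variables (S : 'I_m -> 'M[R[i]]_n) (T amax : R) (Xg : 'M[R[i]]_n).
Hypothesis hS : forall k, (S k)^t* = - S k.
Hypothesis T0 : 0 < T.
Hypothesis uXg : Xg^t* *m Xg = 1%:M.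
Implicit Types (u v : 'I_m -> R -> R) (Y : R -> 'M[R[i]]_n) (c : 'I_m -> nat -> R).

(** Reference motions over one period; they start at Xg as the reference does. *)
Definition flow u Y := Y 0 = Xg /\ mpath 0 T Y (fun t => field_of S (u^~ t) *m Y t).

Definition sine_control c M k (s : R) := sine_sum (c k) M (2 * pi / T * s).

Lemma sine_control_path c M k : exists du, rpath 0 T (sine_control c M k) du.
Proof.
elim: M => [|M [du ih]].
  exists (fun=> 0); move: (rpath_cst 0 T (0 : R)); congr rpath; apply/funext => s.
  by rewrite /sine_control /sine_sum big_ord0.
have h1 := rpathZ (M.+1%:R * (2 * pi / T)) (rpath_derive 0 T (fun t => is_derive_id t 1)).
have h2 := @rpath_comp _ _ _ _ _ sin cos (fun t _ => is_derive_sin _) h1.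
eexists; have := rpathD ih (rpathZ (c k M) h2); congr rpath; apply/funext => s.
by rewrite /sine_control /sine_sum big_ord_recr /=; congr (_ + _ * sin _); rewrite -[LHS]mulrA.
Qed.

Lemma sine_control_le c M k s : `|sine_control c M k s| <= \sum_(l < M) `|c k l|.
Proof.
apply: le_trans (ler_norm_sum _ _ _) _; apply: ler_sum => l _.
by rewrite normrM ler_piMr // ler_norml sin_geN1 sin_le1.
Qed.

Lemma trig_flow_exists c M : exists Y, flow (sine_control c M) Y.
Proof.
have /choice[du hdu] := sine_control_path c M.
have hA : mpath 0 T (fun t => field_of S (fun k => sine_control c M k t))
    (fun t => field_of S (fun k => du k t)).
  move=> i j.
  have h k : cpath 0 T (fun t => (sine_control c M k t)%:C * S k i j) (fun t => (du k t)%:C * S k i j).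
    have hc : cpath 0 T (fun t => (sine_control c M k t)%:C) (fun t => (du k t)%:C).
      by split; [exact: hdu|exact: rpath_cst].
    by apply: cpath_eq (cpathM hc (cpath_cst 0 T (S k i j))) _ => t _; rewrite mulr0 addr0.
  have := @cpath_sum _ 0 T _ (index_enum 'I_m) xpredT _ _ h.
  by congr cpath; apply/funext => t; rewrite summxE; apply: eq_bigr => k _; rewrite mxE.
have L0 : 0 <= \sum_k (\sum_(l < M) `|c k l|) * fnorm (S k).
  by apply: sumr_ge0 => k _; rewrite mulr_ge0 ?fnorm_ge0 ?sumr_ge0.
have [t ht|Y Y0 hY] := linear_flow_exists Xg T0 hA L0; last by exists Y.
apply: le_trans (fnorm_sum _ _ _) _; apply: ler_sum => k _; rewrite fnormZ.
by apply: ler_wpM2r; [exact: fnorm_ge0|exact: sine_control_le].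
Qed.

Lemma flow_unitary u Y t : flow u Y -> 0 <= t <= T -> (Y t)^t* *m Y t = 1%:M.
Proof.
move=> [Y0 hY] ht; apply: (unitary_flow hY (fun s _ => field_of_skew hS _)) => //.
by rewrite Y0.
Qed.

Definition transported Y B t := (Y t)^t* *m B *m Y t.

Lemma transportedD Y C D (r : R) t :
  transported Y (C + r%:C *: D) t = transported Y C t + r%:C *: transported Y D t.
Proof. by rewrite /transported mulmxDr mulmxDl -scalemxAr -scalemxAl. Qed.

Section Commutator.
Variables (G B : 'M[R[i]]_n).
Local Notation bracket B C := (B *m C - C *m B).

(** Differentiate the vanishing function at t0. *)
Lemma commutator_zero u Y t0 : flow u Y -> 0 < t0 < T / 2 ->
  (forall t, 0 < t < T / 2 -> ip G (transported Y B t) = 0) ->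
  ip G (transported Y (bracket B (field_of S (u^~ t0))) t0) = 0.
Proof.
move=> [_ hY] /andP[t00 t0T] hz.
have T2 : T / 2 <= T by lra.
pose a := t0 / 2; pose b := (t0 + T / 2) / 2.
have [ap a_t] : 0 < a /\ a < t0 by rewrite /a; split; lra.
have [t_b bT] : t0 < b /\ b < T / 2 by rewrite /b; split; lra.
have hY' := mpath_sub hY (ltW ap) (le_trans (ltW bT) T2).
have h1 := rpath_ip (mpath_cst a b G) (mpathM (mpathM (mpath_adj hY') (mpath_cst a b B)) hY').
have h2 : rpath a b (fun=> 0) (fun t => ip G (transported Y (bracket B (field_of S (u^~ t))) t)).
  apply: (rpath_eq (rpath_congr _ h1)) => [t|t _].
    rewrite in_itv /= => /andP[ta tb]; apply: hz.
    by rewrite (lt_le_trans ap ta) (le_lt_trans tb bT).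
  rewrite ip0l add0r mulmx0 addr0; congr ip; rewrite /transported adjmxM (field_of_skew hS).
  by rewrite !(mulmxBr, mulmxBl, mulmxN, mulNmx) !mulmxA addrC.
have ht : a < t0 < b by rewrite a_t.
have d1 := h2.2 t0 ht; have d2 := (rpath_cst a b (0 : R)).2 t0 ht.
by have [_ <-] := d1; have [_ ->] := d2.
Qed.

Lemma ip_transported_sub u v Y Z C t0 : flow u Y -> flow v Z -> 0 <= t0 <= T ->
  `|ip G (transported Y C t0) - ip G (transported Z C t0)| <=
  fnorm G * (2 * fnorm C * fnorm (Y t0 - Z t0)).
Proof.
move=> hY hZ ht; rewrite -ipBr; apply: le_trans (ip_le _ _) _.
apply: ler_wpM2l; first exact: fnorm_ge0.
by apply: fnorm_conj_sub; [exact: flow_unitary hY ht|exact: flow_unitary hZ ht].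
Qed.

(** Let Z be driven by u plus eta w in direction l. Subtracting the two identities
    given by [commutator_zero] leaves the bracket with S l, with coefficient eta w t0,
    against the difference of Y and Z at t0, which is at most eta times the integral
    of w. The factor eta cancels, so it may be taken as small as the bound on the
    coefficients of the controls requires. *)
Lemma peak_step u v Y Z l eta w W t0 : flow u Y -> flow v Z -> 0 < eta <= 1 ->
  0 < t0 < T / 2 -> (forall k t, v k t = u k t + (k == l)%:R * (eta * w t)) ->
  (forall t, 0 <= t <= t0 -> 0 <= w t) -> rpath 0 t0 W w ->
  (forall t, 0 < t < T / 2 -> ip G (transported Y B t) = 0) ->
  (forall t, 0 < t < T / 2 -> ip G (transported Z B t) = 0) ->
  w t0 * `|ip G (transported Y (bracket B (S l)) t0)| <=
  2 * fnorm G * fnorm (S l) * (fnorm (bracket B (field_of S (u^~ t0))) + w t0 * fnorm (bracket B (S l))) *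
  (W t0 - W 0).
Proof.
move=> hY hZ /andP[eta0 eta1] ht0 hv hw hW zY zZ.
have [t00 t0T] := andP ht0.
have htT : 0 <= t0 <= T by rewrite (ltW t00) /=; lra.
set I := W t0 - W 0.
have Ev t : field_of S (v^~ t) = field_of S (u^~ t) + (eta * w t)%:C *: S l.
  rewrite /field_of; under eq_bigr do rewrite hv rmorphD scalerDl.
  rewrite big_split /=; congr (_ + _); rewrite (bigD1 l) //= eqxx mul1r big1 ?addr0 // => k /negbTE ->.
  by rewrite mul0r rmorph0 scale0r.
have dYZ : fnorm (Z t0 - Y t0) <= eta * fnorm (S l) * I.
  have [Y0 hY'] := hY; have [Z0 hZ'] := hZ.
  have [h00 hT] := andP htT.
  have uZ : (Z 0)^t* *m Z 0 = 1%:M by rewrite Z0.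
  have ZY : Z 0 = Y 0 by rewrite Z0 Y0.
  have := flow_compare h00 (mpath_sub hZ' (lexx 0) hT) (mpath_sub hY' (lexx 0) hT)
    (fun t _ => field_of_skew hS _) (fun t _ => field_of_skew hS _) uZ ZY
    (rpathZ (eta * fnorm (S l)) hW).
  rewrite -mulrBr; apply => t /andP[h1 h2].
  rewrite Ev addrAC subrr add0r fnormZ ger0_norm.
    by rewrite mulrAC.
  by rewrite mulr_ge0 ?(ltW eta0) // hw // !ltW.
have wt0 : 0 <= w t0 by apply: hw; rewrite (ltW t00) lexx.
have c1 := commutator_zero hY ht0 zY.
have c2 := commutator_zero hZ ht0 zZ.
set E := bracket B (field_of S (u^~ t0)) in c1 *.
set D := bracket B (S l).
have ED : bracket B (field_of S (v^~ t0)) = E + (eta * w t0)%:C *: D.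
  by rewrite Ev mulmxDr mulmxDl -scalemxAr -scalemxAl /D scalerBr opprD addrACA.
rewrite ED in c2.
have c3 : ip G (transported Z E t0) + eta * w t0 * ip G (transported Z D t0) = 0.
  by rewrite -[RHS]c2 transportedD ipDr ipZr.
have e1 := ip_transported_sub E hZ hY htT.
have e2 := ip_transported_sub D hY hZ htT.
rewrite c1 subr0 in e1.
have b1 := le_trans e1 (ler_wpM2l (fnorm_ge0 G) (ler_wpM2l (mulr_ge0 (ler0n _ 2) (fnorm_ge0 E)) dYZ)).
rewrite fnorm_distC in e2.
have b2 := le_trans e2 (ler_wpM2l (fnorm_ge0 G) (ler_wpM2l (mulr_ge0 (ler0n _ 2) (fnorm_ge0 D)) dYZ)).
have I0 : 0 <= I.
  rewrite subr_ge0 -lerN2; apply: (rpath_le (ltW t00) (rpathN hW)) => t /andP[h1 h2].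
  by rewrite oppr_le0 hw // !ltW.
exact: (peak_algebra eta0 eta1 wt0 (fnorm_ge0 G) (fnorm_ge0 (S l)) (fnorm_ge0 E) (fnorm_ge0 D) I0 b1 b2 c3).
Qed.

End Commutator.
(** The strict bound leaves room for perturbations inside the cube. *)
Definition bounded_coefs c M :=
  (exists2 b, b < amax / 2 & forall k l, `|c k l| <= b) /\ forall k, vanish_from M (c k).

Definition annihilated G B := forall c M Y t, bounded_coefs c M ->
  flow (sine_control c M) Y -> 0 < t < T / 2 -> ip G (transported Y B t) = 0.

Lemma le0_harmonic (x C : R) : (forall N : nat, x <= C * N.+1%:R^-1) -> x <= 0.
Proof.
move=> h; rewrite leNgt; apply/negP => x0.
have C0 : 0 <= C.
  by have := h 0%N; rewrite invr1 mulr1; apply: le_trans; exact: ltW.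
have hN := archi_boundP (divr_ge0 C0 (ltW x0)).
have := h (Num.bound (C / x)); rewrite leNgt => /negP; apply.
rewrite ltr_pdivrMr // mulrC -ltr_pdivrMr //; apply: lt_trans hN _.
by rewrite ltr_nat.
Qed.

(** Perturb by peaks at t0: in [peak_step] the left-hand side keeps the factor
    sin x0 while the integral of the peak is of order 1 / (N + 1). *)
Lemma annihilated_bracket G B l : annihilated G B ->
  annihilated G (B *m S l - S l *m B).
Proof.
move=> hB c M Y t0 hc hY ht0; have [[b bA cb] cM] := hc.
have [t00 t0T] := andP ht0.
have b0 : 0 <= b := le_trans (normr_ge0 _) (cb l 0%N).
pose om := 2 * pi / T; pose x0 := om * t0.
have om0 : 0 < om by rewrite divr_gt0 // mulr_gt0 // pi_gt0.
have x00 : 0 < x0 by rewrite mulr_gt0.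
have x0pi : x0 < pi.
  have -> : pi = om * (T / 2) by rewrite /om; field; rewrite gt_eqF.
  by rewrite ltr_pM2l.
have s0 : 0 < sin x0 by rewrite sin_gt0_pi // x00.
set D := B *m S l - S l *m B.
set Q := 2 * fnorm G * fnorm (S l) * (fnorm (B *m field_of S (fun k => sine_control c M k t0) -
   field_of S (fun k => sine_control c M k t0) *m B) + sin x0 * fnorm D).
suff step N : sin x0 * `|ip G (transported Y D t0)| <= Q * ((2 - cos x0) / om) * N.+1%:R^-1.
  have := le0_harmonic step; rewrite pmulr_rle0 // normr_le0 => /eqP.
  by [].
have [M1 [d [dM hd]]] := peak_sine_poly N x0.
pose Dd := \sum_(i < M1) `|d i|.
have dD i : `|d i| <= Dd.
  case: (ltnP i M1) => [iM|/dM ->]; last by rewrite normr0 sumr_ge0.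
  by rewrite /Dd (bigD1 (Ordinal iM)) //= lerDl sumr_ge0.
have D0 : 0 <= Dd by rewrite sumr_ge0.
(* Small enough for the perturbed coefficients to stay below amax / 2. *)
pose eta := Num.min 1 ((amax / 2 - b) / (Dd + 1)).
have D1 : 0 < Dd + 1 by rewrite ltr_wpDl.
have eta0 : 0 < eta by rewrite lt_min ltr01 divr_gt0 // subr_gt0.
have eta1 : eta <= 1 by rewrite ge_min lexx.
have etaD : b + eta * Dd < amax / 2.
  rewrite -ltrBrDl; apply: (@lt_le_trans _ _ (eta * (Dd + 1))).
    by rewrite ltr_pM2l // ltrDl.
  by rewrite -ler_pdivlMr // ge_min lexx orbT.
pose M' := maxn M M1.
pose c' k i := c k i + (k == l)%:R * (eta * d i).
have hc' : bounded_coefs c' M'.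
  split.
    exists (b + eta * Dd) => // k i; apply: le_trans (ler_normD _ _) (lerD (cb k i) _).
    rewrite normrM normrM (ger0_norm (ltW eta0)); case: eqP => _ /=.
      by rewrite normr1 mul1r ler_wpM2l // ltW.
    by rewrite normr0 mul0r mulr_ge0 // ltW.
  by move=> k i; rewrite geq_max => /andP[h1 h2]; rewrite /c' (cM k) // dM // !mulr0 addr0.
have [Z hZ] := trig_flow_exists c' M'.
have hv k t : sine_control c' M' k t =
    sine_control c M k t + (k == l)%:R * (eta * peak N x0 (om * t)).
  rewrite /sine_control -/om hd -(sine_sum_widen _ (cM k) (leq_maxl M M1)).
  rewrite -(sine_sum_widen _ dM (leq_maxr M M1)) /sine_sum !mulr_sumr -big_split.
  by apply: eq_bigr => i _; rewrite /c' mulrDl !mulrA.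
have hw t : 0 <= t <= t0 -> 0 <= peak N x0 (om * t).
  move=> /andP[h1 h2]; apply: peak_ge0; rewrite mulr_ge0 ?(ltW om0) //=.
  by apply: le_trans (ltW x0pi); rewrite ler_pM2l.
have eta01 : 0 < eta <= 1 by rewrite eta0.
have := peak_step hY hZ eta01 ht0 hv hw (peak_integral_path 0 t0 N x0 om0)
  (fun t ht => hB _ _ _ _ hc hY ht) (fun t ht => hB _ _ _ _ hc' hZ ht).
rewrite peak_at -/D -/Q => h; apply: le_trans h _; rewrite -[leRHS]mulrA.
apply: ler_wpM2l.
  by rewrite !(mulr_ge0, addr_ge0) ?fnorm_ge0 // ltW.
have -> : t0 = x0 / om by rewrite /x0 mulrC mulKf // gt_eqF.
exact: peak_integral_le.
Qed.

(** The annihilated matrices B such that [C, B] is annihilated whenever C is form a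
    Lie algebra, by the Jacobi identity. It contains the S k by
    [annihilated_bracket], hence all of u(n). Under the zero control the reference
    rests at Xg, so G is orthogonal to Xg^* B Xg for all B in u(n); take
    B = Xg G Xg^*. *)
Lemma separation G : controllable S -> 0 < amax ->
  (forall k, annihilated G (S k)) -> G^t* = - G -> G = 0.
Proof.
move=> hctrl amax0 hG sG.
pose L := [set B | annihilated G B /\
  forall C, annihilated G C -> annihilated G (C *m B - B *m C)].
have ann0 : annihilated G 0.
  by move=> c M Y t _ _ _; rewrite /transported mulmx0 mul0mx ip0r.
have annD A B : annihilated G A -> annihilated G B -> annihilated G (A + B).
  move=> hA hB c M Y t h1 h2 h3; rewrite /transported mulmxDr mulmxDl ipDr.
  by rewrite (hA _ _ _ _ h1 h2 h3) (hB _ _ _ _ h1 h2 h3) addr0.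
have annZ (r : R) A : annihilated G A -> annihilated G (r%:C *: A).
  move=> hA c M Y t h1 h2 h3; rewrite /transported -scalemxAr -scalemxAl ipZr.
  by rewrite (hA _ _ _ _ h1 h2 h3) mulr0.
have annB A B : annihilated G A -> annihilated G B -> annihilated G (A - B).
  move=> hA hB; have -> : A - B = A + (-1)%:C *: B by rewrite rmorphN1 scaleN1r.
  by apply: annD; [exact: hA|exact: annZ].
have hL : real_lie_subalgebra L.
  split.
  - split; first exact: ann0.
    by move=> C _; rewrite mulmx0 mul0mx subrr; exact: ann0.
  - move=> A B [A1 A2] [B1 B2]; split=> [|C hC]; first exact: annD.
    by rewrite mulmxDr mulmxDl opprD addrACA; apply: annD; [exact: A2|exact: B2].
  - move=> r A [A1 A2]; split=> [|C hC]; first exact: annZ.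
    by rewrite -scalemxAr -scalemxAl -scalerBr; apply: annZ; exact: A2.
  - move=> A B [A1 A2] [B1 B2]; split=> [|C hC]; first exact: B2.
    have -> : C *m (A *m B - B *m A) - (A *m B - B *m A) *m C =
        ((C *m A - A *m C) *m B - B *m (C *m A - A *m C)) -
        ((C *m B - B *m C) *m A - A *m (C *m B - B *m C)).
      rewrite !(mulmxBr, mulmxBl) !mulmxA.
      move: (C *m A *m B) (C *m B *m A) (A *m B *m C) (B *m A *m C) (A *m C *m B)
        (B *m C *m A) => p q r s u v.
      by apply/matrixP => i j; rewrite !mxE; ring.
    by apply: annB; [apply: B2; exact: A2|apply: A2; exact: B2].
have sub : skew_hermitian `<=` L.
  rewrite -hctrl; apply: smallest_sub; first exact: hL.
  move=> _ [k _ <-]; split; first exact: hG.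
  by move=> C; exact: annihilated_bracket.
have sB : skew_hermitian (Xg *m G *m Xg^t*).
  by rewrite /skew_hermitian /= !adjmxM adjmxK sG mulNmx mulmxN mulmxA.
have [hB _] := sub _ sB.
have h0 : bounded_coefs (fun _ _ => 0) 0.
  split; last by move=> k l.
  by exists 0; rewrite ?divr_gt0 // => k l; rewrite normr0.
have hY : flow (sine_control (fun _ _ => 0) 0) (fun=> Xg).
  split=> //; apply: (mpath_eq (mpath_cst 0 T Xg)) => t _.
  rewrite /field_of big1 ?mul0mx // => k _.
  by rewrite /sine_control /sine_sum big_ord0 scale0r.
have ht : 0 < T / 4 < T / 2 by rewrite divr_gt0 //= ltr_pM2l // ltf_pV2 ?posrE // ltr_nat.
have := hB _ _ _ _ h0 hY ht.
rewrite /transported !mulmxA uXg mul1mx -mulmxA uXg mulmx1.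
exact: ip_eq0.
Qed.

End Separation.

(** * Uniform probability of a box *)

Section Boxes.
Context {R : realType}.

Definition box d (l u : 'I_d -> R) : set (d.-tuple R) :=
  [set v | forall i, l i <= tnth v i <= u i].

Lemma measurable_box d (l u : 'I_d -> R) : measurable (box l u).
Proof.
have -> : box l u = \bigcap_(i in [set: 'I_d]) ((fun v => tnth v i) @^-1` `[l i, u i]).
  apply/seteqP; split=> v /= h i; last by have := h i Logic.I; rewrite /= in_itv.
  by move=> _; rewrite /= in_itv; exact: h.
apply: fin_bigcap_measurable => // i _.
rewrite -[X in measurable X]setTI; apply: measurable_tnth => //.
Qed.

Lemma box_setI d (l u l' u' : 'I_d -> R) : box l u `&` box l' u' =
  box (fun i => Num.max (l i) (l' i)) (fun i => Num.min (u i) (u' i)).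
Proof.
apply/seteqP; split=> v /=.
  by move=> [h1 h2] i; have := h1 i; have := h2 i; rewrite ge_max le_min => /andP[-> ->] /andP[-> ->].
by move=> h; split=> i; have := h i; rewrite ge_max le_min => /andP[/andP[h1 h2] /andP[h3 h4]]; apply/andP.
Qed.

Lemma lebesgue_tuple_set0 d : lebesgue_tuple (set0 : set (d.-tuple R)) = 0%E.
Proof.
elim: d => [|d ih] /=; first by rewrite /dirac indic0.
rewrite (_ : (fun x => _) = (fun=> 0%E)) ?integral0 //; apply/funext => x.
exact: ih.
Qed.

Lemma lebesgue_tuple_box d (l u : 'I_d -> R) : (forall i, l i <= u i) ->
  lebesgue_tuple (box l u) = (\prod_i (u i - l i))%:E.
Proof.
elim: d l u => [|d ih] l u lu /=.
  rewrite big_ord0 /dirac indicE mem_set //= => i; by case: i.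
rewrite big_ord_recl.
pose c := \prod_(i < d) (u (lift ord0 i) - l (lift ord0 i)).
have slice (x : R) : lebesgue_tuple [set v : d.-tuple R | box l u [tuple of x :: v]] =
    (c * \1_(`[l ord0, u ord0] : set R) x)%:E.
  have [hx|hx] := boolP (l ord0 <= x <= u ord0).
    rewrite indicE mem_set ?mulr1; last by rewrite /= in_itv.
    rewrite /c -(ih (fun i => l (lift ord0 i)) (fun i => u (lift ord0 i))) //.
    congr lebesgue_tuple; apply/seteqP; split=> v /= h i.
      by have := h (lift ord0 i); rewrite tnthS.
    case: (unliftP ord0 i) => [j|] -> //; by rewrite tnthS.
  rewrite indicE memNset ?mulr0; last by rewrite /= in_itv; exact/negP.
  rewrite (_ : [set v | _] = set0) ?lebesgue_tuple_set0 //.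
  by apply/seteqP; split=> v //= /(_ ord0); rewrite tnth0 (negbTE hx).
under eq_integral do rewrite slice.
have c0 : 0 <= c by apply: prodr_ge0 => i _; rewrite subr_ge0.
have neg : c < 0 -> `[l ord0, u ord0]%classic = set0 :> set R.
  by move=> /lt_le_trans /(_ c0); rewrite ltxx.
rewrite [LHS](@integralZl_indic _ _ _ (@lebesgue_measure R) setT measurableT
  (fun=> `[l ord0, u ord0]%classic) c neg) //.
rewrite integral_indic // setIT [X in (_ * X)%E](@lebesgue_measure_itv R `[l ord0, u ord0]) /= lte_fin.
case: ltP => h; first by rewrite -EFinB -EFinM mulrC.
have -> : u ord0 - l ord0 = 0 by apply/eqP; rewrite subr_eq0 eq_le h lu.
by rewrite mule0 mul0r.
Qed.

Context {disp : measure_display} {Omega : measurableType disp} (P : probability Omega R).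

(** A box around a point of the cube meets the cube in a box with nonempty interior;
    its probability is the same for every uniform vector. *)
Lemma uniform_box_gt0 d (amax rho : R) (b : 'I_d -> R) :
  0 < amax -> 0 < rho -> (forall i, `|b i| <= amax / 2) ->
  exists2 p : R, 0 < p & forall a : {RV P >-> d.-tuple R}, uniform_on_cube amax a ->
    P (a @^-1` box (fun i => b i - rho) (fun i => b i + rho)) = p%:E.
Proof.
move=> a0 r0 hb.
pose lo i := Num.max (b i - rho) (- (amax / 2)); pose hi i := Num.min (b i + rho) (amax / 2).
have a2 : 0 < amax / 2 by rewrite divr_gt0.
have lh i : lo i < hi i.
  have := hb i; rewrite ler_norml => /andP[h1 h2].
  rewrite /lo /hi gt_max !lt_min; apply/andP; split; apply/andP; split; lra.
have cubeE : (cube amax : set (d.-tuple R)) = box (fun=> - (amax / 2)) (fun=> amax / 2) by [].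
have mc : lebesgue_tuple (cube amax : set (d.-tuple R)) = (\prod_(i < d) (amax / 2 - - (amax / 2)))%:E.
  by rewrite cubeE lebesgue_tuple_box // => i; lra.
exists ((\prod_(i < d) (amax / 2 - - (amax / 2)))^-1 * \prod_i (hi i - lo i)).
  by rewrite mulr_gt0 ?invr_gt0 // prodr_gt0 // => i _; [lra|rewrite subr_gt0].
move=> a ua; have := ua _ (measurable_box (fun i => b i - rho) (fun i => b i + rho)).
rewrite /distribution /pushforward => ->; rewrite mc /= cubeE box_setI.
by rewrite lebesgue_tuple_box // => i; rewrite -/(lo i) -/(hi i) ltW.
Qed.

End Boxes.

(** * Recurrence of a word in an independent sequence *)

Lemma le0_geometric {R : realType} (x q : R) : 0 <= q -> q < 1 ->
  (forall Q : nat, x <= q ^+ Q) -> x <= 0.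
Proof.
move=> q0 q1 h; have := @cvg_geometric R 1 q; rewrite ger0_norm // => /(_ q1) c.
apply: (@cvgr_to_ge _ _ _ _ (fun Q => geometric 1 q Q) _ _ c).
by apply: nearW => Q; rewrite /geometric /= mul1r.
Qed.

Section InfinitelyOften.
Context {R : realType} {disp : measure_display} {Omega : measurableType disp}
        (P : probability Omega R).
Context (d : nat).
Variables (a : nat -> {RV P >-> d.-tuple R}) (W : nat -> set (d.-tuple R)).
Hypothesis ind : mutually_independent a.
Hypothesis mW : forall i, measurable (W i).
Variable pw : nat -> R.
Hypothesis hpw : forall j i, P (a j @^-1` W i) = (pw i)%:E.
Variable r : nat.

Let pr A : R := fine (P A).

Let prE A : measurable A -> P A = (pr A)%:E.
Proof. by move=> mA; rewrite fineK // fin_num_measure. Qed.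

Let cylinder (I : seq nat) (E : nat -> set (d.-tuple R)) : set Omega :=
  \bigcap_(j in [set` I]) (a j @^-1` E j).

Let m_preimage j (E : set (d.-tuple R)) : measurable E -> measurable (a j @^-1` E).
Proof. by move=> mE; rewrite -[X in measurable X]setTI; exact: measurable_funP. Qed.

Let m_cylinder I E : (forall j, measurable (E j)) -> measurable (cylinder I E).
Proof.
by move=> mE; apply: fin_bigcap_measurable => // j _; exact: m_preimage.
Qed.

Let pr_cylinder I E : uniq I -> (forall j, measurable (E j)) ->
  pr (cylinder I E) = \prod_(j <- I) pr (a j @^-1` E j).
Proof.
move=> uI mE; rewrite /pr /cylinder (ind uI mE) -[RHS]/(fine (_%:E)); congr fine.
elim: I {uI} => [|j I ih]; first by rewrite !big_nil.
by rewrite !big_cons ih EFinM (prE (m_preimage _ (mE j))).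
Qed.

(** Disjoint blocks of r consecutive letters make these events independent. *)
Definition occurs (j : nat) : set Omega :=
  \bigcap_(i in `I_r) (a (j * r + i)%N @^-1` W i).

Definition never (J Q : nat) : set Omega :=
  \bigcap_(q in `I_Q) ~` occurs (J + q).

Let m_occurs j : measurable (occurs j).
Proof. by apply: fin_bigcap_measurable => [|i _]; [exact: finite_II|exact: m_preimage]. Qed.

Let m_never J Q : measurable (never J Q).
Proof. by apply: fin_bigcap_measurable => [|i _]; [exact: finite_II|exact: measurableC]. Qed.

Let neverS J Q : never J Q.+1 = never J Q `\` occurs (J + Q).
Proof.
apply/seteqP; split=> w.
  move=> h; split; last by apply: h => /=.
  by move=> q hq; apply: h; rewrite /= ltnS ltnW.
move=> [h1 h2] q; rewrite /= ltnS leq_eqVlt => /predU1P[-> //|hq]; exact: h1.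
Qed.

Let p := \prod_(i <- iota 0 r) pw i.

Let pr_never J Q I E : uniq I -> (forall j, measurable (E j)) ->
  (forall j, j \in I -> ((J + Q) * r <= j)%N) ->
  pr (cylinder I E `&` never J Q) = pr (cylinder I E) * (1 - p) ^+ Q.
Proof.
move=> + mE; elim: Q I E mE => [|Q ih] I E mE uI hI.
  by rewrite expr0 mulr1; congr pr; rewrite /never II0 bigcap_set0 setIT.
(* Induction over Q works because I is arbitrary: the extra block joins it. *)
pose I' := I ++ iota ((J + Q) * r) r.
pose E' k := if (k < (J + Q).+1 * r)%N then W (k - (J + Q) * r) else E k.
have hI1 j : j \in I -> ((J + Q).+1 * r <= j)%N by move/hI; rewrite addnS.
have mE' k : measurable (E' k) by rewrite /E'; case: ifP.
have uI' : uniq I'.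
  rewrite cat_uniq uI iota_uniq andbT /=; apply/hasPn => k; rewrite mem_iota => /andP[_ h].
  by apply/negP => /hI1; rewrite leqNgt mulSn addnC h.
have hI' j : j \in I' -> ((J + Q) * r <= j)%N.
  rewrite mem_cat => /orP[/hI1|]; last by rewrite mem_iota => /andP[].
  by apply: leq_trans; rewrite leq_mul2r leqnSn orbT.
have hI2 j : j \in I -> ((J + Q) * r <= j)%N by move=> h; apply: hI'; rewrite mem_cat h.
(* Reading the word in block J + Q is itself a product event, on later indices. *)
have cyl : cylinder I' E' = cylinder I E `&` occurs (J + Q).
  apply/seteqP; split=> w.
    move=> h; split=> j hj.
      have := h j; rewrite /= /E' mem_cat hj ltnNge hI1 //=; exact.
    have := h ((J + Q) * r + j)%N; move: hj; rewrite /= mem_cat !mem_iota => hj.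
    rewrite leq_addr ltn_add2l hj orbT /E' mulSn addnC ltn_add2r hj addnK; exact.
  move=> [h1 h2] j; rewrite /= mem_cat => /orP[hj|].
    by rewrite /E' ltnNge hI1 //=; exact: h1.
  rewrite mem_iota => /andP[h3 h4]; rewrite /E' mulSn addnC h4.
  have := h2 (j - (J + Q) * r)%N; rewrite /= subnKC //; apply.
  by rewrite ltn_subLR.
have prc : pr (cylinder I' E') = pr (cylinder I E) * p.
  rewrite !pr_cylinder // big_cat /=; congr (_ * _).
    by apply: eq_big_seq => j hj; rewrite /E' ltnNge hI1.
  rewrite -[X in iota X _]addn0 iotaDl big_map /p; apply: eq_big_seq => i.
  rewrite mem_iota add0n => /andP[_ hi].
  by rewrite /E' mulSn addnC ltn_add2r hi addnK /pr hpw.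
rewrite neverS setIDA.
have -> : pr ((cylinder I E `&` never J Q) `\` occurs (J + Q)) =
    pr (cylinder I E `&` never J Q) - pr (cylinder I' E' `&` never J Q).
  have m1 : measurable (cylinder I E `&` never J Q) by apply: measurableI => //; exact: m_cylinder.
  have m2 : measurable (cylinder I' E' `&` never J Q) by apply: measurableI => //; exact: m_cylinder.
  have -> : cylinder I' E' `&` never J Q = (cylinder I E `&` never J Q) `&` occurs (J + Q).
    by rewrite cyl setIAC.
  have mo := m_occurs (J + Q).
  have e : P ((cylinder I E `&` never J Q) `\` occurs (J + Q)) =
      (P (cylinder I E `&` never J Q) - P ((cylinder I E `&` never J Q) `&` occurs (J + Q)))%E.
    by apply: measureD => //; rewrite -ge0_fin_numE // fin_num_measure.
  by rewrite /pr e fineB // fin_num_measure //; exact: measurableI.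
rewrite (ih I E mE uI hI2) (ih I' E' mE' uI' hI') prc exprS; ring.
Qed.

(** The probability that the word is missing from Q consecutive blocks is
    (1 - p)^Q, where p is the probability of the word. *)
Lemma occurs_infinitely_often : (forall i, 0 < pw i) ->
  {ae P, forall w, forall J, exists2 j, (J <= j)%N & occurs j w}.
Proof.
move=> pw0.
have p0 : 0 < p by apply: prodr_gt0.
have p1 : p <= 1.
  rewrite /p; elim: (iota 0 r) => [|i s ih]; first by rewrite big_nil.
  rewrite big_cons mulr_ile1 ?(ltW (pw0 _)) ?prodr_ge0 // => [i' _|]; first exact: ltW.
  by rewrite -lee_fin -(hpw 0%N); apply: probability_le1; exact: m_preimage.
have neg J : P.-negligible (\bigcap_Q never J Q).
  exists (\bigcap_Q never J Q); split=> //; first exact: bigcapT_measurable.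
  have mB : measurable (\bigcap_Q never J Q) by exact: bigcapT_measurable.
  rewrite (prE mB); congr EFin; apply/le_anti; rewrite fine_ge0 ?measure_ge0 // andbT.
  have bound Q : pr (\bigcap_Q never J Q) <= (1 - p) ^+ Q.
    have := @pr_never J Q [::] (fun=> setT) isT (fun=> measurableT) (fun _ => ltac:(by [])).
    rewrite /cylinder (_ : [set` [::]] = set0) ?bigcap_set0 ?setTI; last first.
      by apply/seteqP; split.
    rewrite {2}/pr probability_setT mul1r => <-.
    rewrite -lee_fin -!prE //; apply: le_measure; rewrite ?inE //.
    by move=> w; apply.
  apply: (le0_geometric _ _ bound); first by rewrite subr_ge0.
  by rewrite ltrBlDr ltrDl.
have := negligible_bigcup neg.
apply: negligibleS => w; rewrite /= -existsNP => -[J hJ]; exists J => // Q _ q _ hq.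
by apply: hJ; exists (J + q)%N => //; exact: leq_addr.
Qed.

End InfinitelyOften.

(** * Almost sure convergence *)

Section Attraction.
Context {R : realType} {n m : nat}.
Variables (S : 'I_m -> 'M[R[i]]_n) (f : 'I_m -> R) (T : R) (Xg : 'M[R[i]]_n).
Hypothesis hS : forall k, (S k)^t* = - S k.
Hypothesis hf : forall k, 0 < f k.
Hypothesis T0 : 0 < T.
Hypothesis uXg : Xg^t* *m Xg = 1%:M.
Hypothesis vXg : Xg + 1%:M \in unitmx.

(** Otherwise V would decrease by delta infinitely often. *)
Lemma eventually_small (V : nat -> R) (r : nat) (D : nat -> Prop) (delta e : R) :
  0 < delta -> (forall j, 0 <= V j) -> (forall i j, (i <= j)%N -> V j <= V i) ->
  (forall J, exists2 j, (J <= j)%N & D j) ->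
  (forall j, D j -> V (j * r)%N <= e \/ V (j * r + r)%N <= V (j * r)%N - delta) ->
  exists N, forall j, (N <= j)%N -> V j <= e.
Proof.
move=> d0 V0 Vm Dio Ddrop.
suff [N hN] : exists N, V N <= e by exists N => j Nj; exact: le_trans (Vm _ _ Nj) hN.
have [//|no] := pselect (exists N, V N <= e).
have drop k : exists j, V (j * r)%N <= V 0%N - k%:R * delta.
  elim: k => [|k [j hj]]; first by exists 0%N; rewrite mul0r subr0 mul0n.
  have [j' jj' Dj'] := Dio j.
  exists j'.+1; rewrite mulSn addnC.
  case: (Ddrop _ Dj') => [h|h]; first by case: no; exists (j' * r)%N.
  apply: le_trans h _; rewrite -natr1 mulrDl mul1r opprD addrA lerD2r.
  by apply: le_trans hj; apply: Vm; rewrite leq_mul2r jj' orbT.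
have hK := archi_boundP (divr_ge0 (V0 0%N) (ltW d0)).
have [j hj] := drop (Num.bound (V 0%N / delta)).
have := le_trans (V0 _) hj; rewrite subr_ge0 leNgt => /negP; case.
by rewrite -ltr_pdivrMr.
Qed.

Lemma normc_le (z : R[i]) : `|z| <= (`|Re z| + `|Im z|)%:C.
Proof.
rewrite normc_def lecR -(@ler_pXn2r _ 2) ?nnegrE ?sqrtr_ge0 ?addr_ge0 //.
rewrite sqr_sqrtr ?addr_ge0 ?sqr_ge0 // sqrrD !real_normK ?num_real //.
by rewrite -addrA lerD2l lerDr mulrn_wge0 // mulr_ge0.
Qed.

Lemma cvg_mx_fnorm (Z : nat -> 'M[(R[i] : numFieldType)]_n) (L : 'M[(R[i] : numFieldType)]_n) :
  (forall e : R, 0 < e -> exists N, forall j, (N <= j)%N -> fnorm (Z j - L) <= e) ->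
  Z @ \oo --> L.
Proof.
move=> h; apply/cvg_ballP => e e0.
have [er e_eq] : exists er : R, e = er%:C.
  by exists (Re e); rewrite RRe_real // gtr0_real.
have er0 : 0 < er by move: e0; rewrite e_eq ltcR.
have [N hN] := h (er / 4) (divr_gt0 er0 (ltr0n _ 4)).
exists N => // j /= /hN hj; split=> // i k.
rewrite /ball /= -opprB normrN.
have [h1 h2] := fnorm_entry (Z j - L) i k.
have e1 : Z j i k - L i k = (Z j - L) i k by rewrite !mxE.
rewrite e1; apply: le_lt_trans (normc_le _) _; rewrite e_eq ltcR.
by apply: le_lt_trans (lerD (le_trans h1 hj) (le_trans h2 hj)) _; lra.
Qed.

Lemma state_converges U X Y : closed_loop S f Xg U X Y ->
  (forall j : nat, Y (j%:R * T) = Xg) ->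
  (forall e, 0 < e -> exists N, forall j, (N <= j)%N -> lyap X Y (j%:R * T) <= e) ->
  ((fun j : nat => X (j%:R * T)) : nat -> 'M[(R[i] : numFieldType)]_n) @ \oo -->
    (Xg : 'M[(R[i] : numFieldType)]_n).
Proof.
move=> hl hper hV; apply: cvg_mx_fnorm => e e0.
pose c := fnorm (1%:M : 'M[R[i]]_n) *+ 2.
have c0 : 0 <= c by rewrite mulrn_wge0 // fnorm_ge0.
have c1 : 0 < c + 1 by rewrite ltr_wpDl.
have q0 : 0 < e / (c + 1) by rewrite divr_gt0.
have [N hN] := hV _ (exprn_gt0 2 q0).
exists N => j /hN hj.
have j0 : 0 <= j%:R * T by rewrite mulr_ge0 // ltW.
have Xe : X (j%:R * T) - Xg = Xg *m (error X Y (j%:R * T) - 1%:M).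
  by rewrite mulmxBr mulmx1 /error hper mulmxA (mulmx1C uXg) mul1mx.
rewrite Xe fnorm_unitaryl //; apply: le_trans (loop_fnorm_error hS hf uXg vXg hl j0) _.
have hc : fnorm (error_coord X Y (j%:R * T)) <= e / (c + 1).
  by apply: fnorm_le hj; exact: ltW.
apply: le_trans (ler_wpM2r c0 hc) _.
by rewrite mulrAC ler_pdivrMr // ler_pM2l // lerDl.
Qed.

End Attraction.

Section Word.
Context {R : realType} {n m : nat}.
Variables (S : 'I_m -> 'M[R[i]]_n) (T : R).
Hypothesis hS : forall k, (S k)^t* = - S k.
Hypothesis T0 : 0 < T.

(** The point near which a random vector must fall for the reference to follow the
    motion with coefficients c during its period. *)
Definition letter M (c : 'I_m -> nat -> R) : 'I_(m * M) -> R :=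
  fun idx => mxvec (\matrix_(k < m, l < M) c k l) 0 idx.

Lemma letter_close M M0 (c : 'I_m -> nat -> R) (rho : R) (a : nat -> (m * M).-tuple R) (j : nat) :
  (forall k, vanish_from M0 (c k)) -> (M0 <= M)%N -> 0 <= rho ->
  box (fun i => letter c i - rho) (fun i => letter c i + rho) (a j) ->
  forall t, 0 < t < T ->
  fnorm (field_of S (fun k => ref_control T a k (j%:R * T + t)) -
      field_of S (fun k => sine_control T c M0 k t)) <= rho * M%:R * \sum_k fnorm (S k).
Proof.
move=> hc M0M rho0 hb t /andP[t0 tT]; apply: fnorm_field_of_sub => k.
have tT' : 0 <= t < T by rewrite (ltW t0).
rewrite (ref_control_period T0 a j k tT').
rewrite /sine_control -(sine_sum_widen _ (hc k) M0M) /sine_sum -sumrB.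
apply: le_trans (ler_norm_sum _ _ _) _.
apply: le_trans (ler_sum _ (G := fun=> rho) _) _ => [l _|]; last first.
  by rewrite sumr_const card_ord mulr_natr.
have -> : l.+1%:R * (2 * pi / T * t) = l.+1%:R * (2 * pi / T) * t by rewrite mulrA.
rewrite -mulrBl normrM -[leRHS]mulr1; apply: ler_pM => //.
  have := hb (mxvec_index k l); rewrite /letter mxvecE mxE => h.
  by rewrite ler_distl.
by rewrite ler_norml sin_geN1 sin_le1.
Qed.

End Word.

Section Main.
Context {R : realType} {n m : nat}.
Variables (S : 'I_m -> 'M[R[i]]_n) (f : 'I_m -> R) (T amax : R) (Xg : 'M[R[i]]_n).
Hypothesis hS : forall k, (S k)^t* = - S k.
Hypothesis hctrl : controllable S.
Hypothesis hf : forall k, 0 < f k.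
Hypothesis T0 : 0 < T.
Hypothesis amax0 : 0 < amax.
Hypothesis uXg : Xg^t* *m Xg = 1%:M.
Hypothesis vXg : Xg + 1%:M \in unitmx.

(** By [separation] the transported generators of all admissible reference motions
    separate u(n); [frame_exists] extracts a finite frame. Each frame element uses
    finitely many frequencies. *)
Lemma spanning_word : exists r (c : 'I_r -> 'I_m -> nat -> R) (M : 'I_r -> nat)
    (Y : 'I_r -> R -> 'M[R[i]]_n) (t : 'I_r -> R) (k : 'I_r -> 'I_m) (C : R),
  [/\ forall i, bounded_coefs amax (c i) (M i),
      forall i, flow S T Xg (sine_control T (c i) (M i)) (Y i),
      forall i, 0 < t i < T / 2, 0 <= C
    & forall G, G^t* = - G -> fnorm G <= C * \sum_i `|ip G ((Y i (t i))^t* *m S (k i) *m Y i (t i))|].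
Proof.
pose F := [set B : 'M[R[i]]_n | exists c M Y t k, [/\ bounded_coefs amax c M,
  flow S T Xg (sine_control T c M) Y, 0 < t < T / 2 & B = (Y t)^t* *m S k *m Y t]].
have Fskew B : F B -> B^t* = - B.
  by move=> [c [M [Y [t [k [_ _ _ ->]]]]]]; rewrite !adjmxM adjmxK hS mulNmx mulmxN mulmxA.
have Fsep G : G^t* = - G -> (forall B, F B -> ip G B = 0) -> G = 0.
  move=> sG hG; apply: (@separation _ _ _ S T amax Xg) => // k c M Y t h1 h2 h3.
  by apply: hG; exists c, M, Y, t, k.
have [r [B [C [FB C0 hC]]]] := frame_exists Fskew Fsep.
have /choice[c FB1] := FB; have /choice[M FB2] := FB1; have /choice[Y FB3] := FB2.
have /choice[t FB4] := FB3; have /choice[k FB5] := FB4.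
exists r, c, M, Y, t, k, C; split=> //; [by move=> i; case: (FB5 i)..|].
move=> G sG; apply: le_trans (hC G sG) _; apply: ler_wpM2l => //.
by apply: ler_sum => i _; case: (FB5 i) => _ _ _ ->.
Qed.

(** Mbar exceeds all frequencies of the word, which does not depend on the
    precision. For each precision 1 / (q + 1) the word, up to the tolerance rho q, is
    almost surely read infinitely often, whatever the state: this event
    involves the random coefficients only, while X and Xbar depend on w arbitrarily.
    Then [block_drop] and [eventually_small] apply path by path. *)
Lemma attraction_almost_surely : exists Mbar : nat, (0 < Mbar)%N /\
  forall M : nat, (Mbar <= M)%N ->
  forall (disp : measure_display) (Omega : measurableType disp) (P : probability Omega R)
    (a : nat -> {RV P >-> (m * M).-tuple R}) (Xbar X : Omega -> R -> 'M[R[i]]_n),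
  mutually_independent a -> (forall j, uniform_on_cube amax (a j)) ->
  (forall w, ref_trajectory S T Xg (fun j => a j w) (Xbar w)) ->
  (forall w, closed_loop_trajectory S T f (fun j => a j w) (Xbar w) (X w)) ->
  {ae P, forall w,
    ((fun j : nat => X w (j%:R * T)) : nat -> 'M[(R[i] : numFieldType)]_n)
      @ \oo --> (Xg : 'M[(R[i] : numFieldType)]_n)}.
Proof.
have [r [c [M0 [Y [t [k [C [hc hY ht C0 hC]]]]]]]] := spanning_word.
exists (\sum_i M0 i).+1; split=> // M hM disp Omega P a Xbar X ind unif href hcl.
have M0M i : (M0 i <= M)%N.
  by apply: leq_trans (ltnW hM); rewrite (bigD1 i) //= leq_addr.
have hti i : 0 <= t i < T.
  have /andP[h1 h2] := ht i; rewrite (ltW h1) /=; apply: lt_le_trans h2 _.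
  by rewrite ler_pdivrMr // mulr_natr mulr2n lerDl ltW.
(* Positions beyond the end of the word get zero coefficients as a default value. *)
pose cc (i : nat) : 'I_m -> nat -> R := if insub i is Some j then c j else fun _ _ => 0.
have ccE (i : 'I_r) : cc i = c i by rewrite /cc valK.
have lett i (idx : 'I_(m * M)) : `|letter (cc i) idx| <= amax / 2.
  rewrite /letter; case/mxvec_indexP: idx => k' l; rewrite mxvecE mxE /cc.
  case: insubP => [j _ _|_]; last by rewrite normr0 divr_ge0 // ltW.
  by have [[b b1 b2] _] := hc j; apply: le_trans (b2 _ _) (ltW b1).
have drops (q : nat) : exists dr : R * R, [/\ 0 < dr.1, 0 < dr.2 &
    forall U X Yb (J : nat), closed_loop S f Xg U X Yb ->
      (forall j : nat, Yb (j%:R * T) = Xg) ->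
      (forall (i : 'I_r) s, 0 < s < T -> fnorm (U ((J + i)%:R * T + s) -
         field_of S (fun k => sine_control T (c i) (M0 i) k s)) <= dr.2) ->
      lyap X Yb (J%:R * T) <= q.+1%:R^-1 \/
      lyap X Yb ((J + r)%:R * T) <= lyap X Yb (J%:R * T) - dr.1].
  have q0 : 0 < q.+1%:R^-1 :> R by rewrite invr_gt0.
  have [d [rho [h1 h2 h3]]] := @block_drop _ _ _ S f T Xg hS hf T0 uXg vXg r
    (fun i s => field_of S (fun k => sine_control T (c i) (M0 i) k s)) Y t k C
    (fun i => (hY i).2) (fun i s _ => field_of_skew hS _) (fun i => (hY i).1) hti C0 hC _ q0.
  by exists (d, rho).
have /choice[dr hdr] := drops.
pose K := M%:R * \sum_k fnorm (S k).
have K0 : 0 <= K by rewrite mulr_ge0 // sumr_ge0 // => *; exact: fnorm_ge0.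
have K1 : 0 < K + 1 by rewrite ltr_wpDl.
pose rho q := (dr q).2 / (K + 1).
have rho0 q : 0 < rho q by rewrite divr_gt0 //; case: (hdr q).
have rhoK q : rho q * M%:R * \sum_k fnorm (S k) <= (dr q).2.
  rewrite -mulrA -/K /rho mulrAC ler_pdivrMr // ler_wpM2l ?lerDl //.
  by case: (hdr q) => _ /ltW.
pose W q i := box (fun idx : 'I_(m * M) => letter (cc i) idx - rho q) (fun idx => letter (cc i) idx + rho q).
have io q : {ae P, forall w, forall J, exists2 j, (J <= j)%N & occurs a (W q) r j w}.
  have /choice[pw hpw] : forall i, exists p : R, 0 < p /\ forall j, P (a j @^-1` W q i) = p%:E.
    move=> i; have [p p0 hp] := uniform_box_gt0 P amax0 (rho0 q) (lett i).
    by exists p; split=> // j; exact: hp.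
  by apply: (occurs_infinitely_often ind _ (fun j i => (hpw i).2 j)) => i;
    [exact: measurable_box|exact: (hpw i).1].
have : {ae P, forall w, forall q J, exists2 j, (J <= j)%N & occurs a (W q) r j w}.
  by apply/ae_foralln.
apply: filterS => w hw.
have hl := loop_of_trajectories hS (href w) (hcl w).
have hper := reference_periodic hS T0 uXg (href w).
apply: (state_converges hS hf T0 uXg vXg hl hper) => e e0.
have [q hq] : exists q : nat, q.+1%:R^-1 < e.
  exists (Num.bound e^-1); rewrite invf_plt ?posrE //.
  by apply: lt_trans (archi_boundP _) _; rewrite ?invr_ge0 ?ltr_nat // ltW.
have [d0 _ hdrop] := hdr q.
pose V (j : nat) := lyap (X w) (Xbar w) (j%:R * T).
have V0 j : 0 <= V j by exact: ip_ge0.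
have Vm i j : (i <= j)%N -> V j <= V i.
  move=> ij; apply: (loop_lyap_le hS hf uXg vXg hl).
  by rewrite mulr_ge0 ?(ltW T0) //= ler_pM2r // ler_nat.
have Vdrop j : occurs a (W q) r j w ->
    V (j * r)%N <= q.+1%:R^-1 \/ V (j * r + r)%N <= V (j * r)%N - (dr q).1.
  move=> occ; apply: (hdrop _ _ _ (j * r)%N hl hper) => i s hs.
  apply: le_trans (rhoK q).
  have hi : box (fun idx => letter (c i) idx - rho q) (fun idx => letter (c i) idx + rho q)
      (a (j * r + i)%N w).
    by have := occ i (ltn_ord i); rewrite /W ccE.
  exact: (letter_close (a := fun j => a j w) S T0 (hc i).2 (M0M i) (ltW (rho0 q)) hi hs).
have [N hN] := eventually_small d0 V0 Vm (hw q) Vdrop.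
by exists N => j /hN h; exact: le_trans h (ltW hq).
Qed.

End Main.

End LocalSettings.

Theorem theorem2 (R : realType) (n m : nat) (hn : (1 <= n)%N)
    (S : 'I_m -> 'M[R[i]]_n) (hS : forall k, skew_hermitian (S k))
    (hctrl : controllable S)
    (T : R) (hT : 0 < T)
    (Xgoal : 'M[R[i]]_n) (hgoal : Wset Xgoal)
    (f : 'I_m -> R) (hf : forall k, 0 < f k)
    (amax : R) (hamax : 0 < amax) :
  exists Mbar : nat, (0 < Mbar)%N /\
    forall M : nat, (Mbar <= M)%N ->
    forall (disp : measure_display) (Omega : measurableType disp)
      (P : probability Omega R)
      (a : nat -> {RV P >-> (m * M).-tuple R})
      (Xbar X : Omega -> R -> 'M[R[i]]_n),
    mutually_independent a ->
    (forall j, uniform_on_cube amax (a j)) ->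
    (forall w, ref_trajectory S T Xgoal (fun j => a j w) (Xbar w)) ->
    (forall w, closed_loop_trajectory S T f (fun j => a j w) (Xbar w) (X w)) ->
    {ae P, forall w,
      ((fun j : nat => X w (j%:R * T)) : nat -> 'M[(R[i] : numFieldType)]_n)
        @ \oo --> (Xgoal : 'M[(R[i] : numFieldType)]_n)}.
Proof.
have [/unitarymxP uXg vXg] := hgoal.
apply: (attraction_almost_surely hS hctrl hf hT hamax (mulmx1C uXg)).
by rewrite addrC unitmxE unitfE.
Qed.
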